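(* $$\lim_{X\to\infty}\frac{\sum_{0<n<X,\ n \text{ squarefree}} \#\mathcal{F}^{0,\mathrm{sol}}_{4n^2}}{\sum_{0<n<X,\ n\text{ squarefree}} \#\mathcal{F}^{0,\mathrm{ls}}_{4n^2}} = 1.$$ Equivalently: when the locally soluble forms in $\bigcup_{n\ge1 \text{ squarefree}}\mathcal{F}^0_{4n^2}$ are ordered by the Bhargava–Ho height, $100\%$ of them are soluble.
   Context: For integers $B,M$, $W^B_M(\mathbb{Z})$ is the set of binary quartic forms $ax^4+Bx^2y^2+cy^4$ with $a,c\in\mathbb{Z}$, $ac=M$, and $\mathcal{F}^B_M=\{ax^4+Bx^2y^2+cy^4\in W^B_M(\mathbb{Z}): 0\le\operatorname{ord}_pa\le1 \text{ for all primes } p\}$. A form $f$ is locally soluble if for every place $v$ of $\mathbb{Q}$ there are $x,y,z\in\mathbb{Q}_v$, $(x,y)\ne(0,0)$, with $z^2=f(x,y)$; it is soluble if such $x,y,z$ exist in $\mathbb{Q}$. $\mathcal{F}^{B,\mathrm{ls}}_M$ and $\mathcal{F}^{B,\mathrm{sol}}_M$ denote the locally soluble and soluble elements of $\mathcal{F}^B_M$. The Bhargava–Ho height of $ax^4+Bx^2y^2+cy^4$ is $\max\{B^2,|ac|\}$. *)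

(* Defs.v *)
From Stdlib Require Import ZArith Znumtheory QArith Reals List ClassicalDescription.
From Coquelicot Require Import Coquelicot.
Import ListNotations.

Open Scope Z_scope.

Definition ord_le1 (a : Z) : Prop := a <> 0 /\ forall p : Z, prime p -> ~ (p * p | a).

(* Membership of a x^4 + B x^2 y^2 + c y^4 in F^B_M (B fixed). *)
Definition in_F (M a c : Z) : Prop := a * c = M /\ ord_le1 a.

Definition soluble_Q (B a c : Z) : Prop :=
  exists x y z : Q, ~ (x == 0 /\ y == 0)%Q /\
    (z * z == inject_Z a * (x*x*x*x) + inject_Z B * (x*x*y*y) + inject_Z c * (y*y*y*y))%Q.

Definition soluble_R (B a c : Z) : Prop :=
  exists x y z : R, (x <> 0 \/ y <> 0)%R /\
    (z * z = IZR a * (x*x*x*x) + IZR B * (x*x*y*y) + IZR c * (y*y*y*y))%R.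

(* p-adic integers as the inverse limit Z_p = lim Z/p^k : coherent sequences
   x k (a residue mod p^k).  Ring operations are componentwise, so an identity
   holds in Z_p iff it holds modulo p^k for every k, and x <> 0 in Z_p iff
   some component x k is nonzero mod p^k. *)
Definition Zp_coherent (p : Z) (x : nat -> Z) : Prop :=
  forall k : nat, (p ^ Z.of_nat k | x (S k) - x k).

(* over Q_p; by the weighted homogeneity (x,y,z) -> (p^e x, p^e y, p^(2e) z)
   a solution over Q_p is the same as one over Z_p. *)
Definition soluble_Qp (p B a c : Z) : Prop :=
  exists x y z : nat -> Z,
    Zp_coherent p x /\ Zp_coherent p y /\ Zp_coherent p z /\
    (exists k : nat, ~ (p ^ Z.of_nat k | x k) \/ ~ (p ^ Z.of_nat k | y k)) /\
    forall k : nat,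
      (p ^ Z.of_nat k | z k * z k - (a * x k ^ 4 + B * x k ^ 2 * y k ^ 2 + c * y k ^ 4)).

Definition locally_soluble (B a c : Z) : Prop :=
  soluble_R B a c /\ forall p : Z, prime p -> soluble_Qp p B a c.

Definition ccount {A : Type} (P : A -> Prop) (l : list A) : nat :=
  length (filter (fun x => if excluded_middle_informative (P x) then true else false) l).

(* all integers in [-|M|, |M|]; contains every a with a*c = M, M <> 0 *)
Definition cand (M : Z) : list Z :=
  map (fun k => Z.of_nat k - Z.abs M) (seq 0 (2 * Z.to_nat (Z.abs M) + 1)).

(* # { a x^4 + B x^2y^2 + c y^4 in F^B_M : P B a c }  (forms are determined by a) *)
Definition countF (P : Z -> Z -> Z -> Prop) (B M : Z) : nat :=
  ccount (fun a => exists c, in_F M a c /\ P B a c) (cand M).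

Definition countF_sol (B M : Z) : nat := countF soluble_Q B M.
Definition countF_ls (B M : Z) : nat := countF locally_soluble B M.

Definition squarefree_nat (n : nat) : Prop :=
  forall p : Z, prime p -> ~ (p * p | Z.of_nat n).

Definition sum_sqfree_lt (f : nat -> R) (X : R) : R :=
  fold_right Rplus 0%R
    (map f (filter (fun n => if excluded_middle_informative
                                  (squarefree_nat n /\ (INR n < X)%R)
                             then true else false)
                   (seq 1 (Z.to_nat (up X))))).

(* Main.v *)
(* The form with a = 1 is always soluble and a positive proportion of integers
   is squarefree, so it is enough that the locally soluble forms with a <> 1
   and n < X number o(X).  Such a form has a > 0; write a = 2^s d and
   n = 2^v d e with d, e odd, and let t be the parity of s + v.  Local
   solubility at the odd primes forces every p | d to be 1 mod 4 with 2^t e a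
   square mod p, and 2^s d to be a square modulo every p | e.

   Put W = (log X)^C.  If d <= W^2 or e <= W^2, the prime factors of the other
   variable avoid half of the residue classes for a fixed quadratic character,
   a set of density zero.  Otherwise cut (d, e) into dyadic boxes and expand the
   conditions into Jacobi symbols over factorisations d = d0 d1, e = e0 e1.
   Terms with two large variables facing each other across a symbol cancel, by
   quadratic reciprocity and a bilinear estimate.  In the remaining ones d and
   e each have a factor at most W; they are bounded trivially, the weights
   2^-omega(d) on primes 1 mod 4 and 2^-omega(e) saving (log X)^(3/4) and
   (log X)^(1/2) over about log X boxes. *)

From mathcomp Require all_boot all_order all_algebra all_fingroup all_solvable all_field.
From mathcomp Require ssrZ zify ring lra reals sequences exp Rstruct.

(** The density estimates rest on one squaring argument. For squarefree [n] with prescribed primes,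
    the square of the sum of [1/n] is at most twice a sum of [tau n / n] over the same set. If a
    real character [f] is 1 on all these primes, then [tau n] is there the divisor sum of [f], which
    is nonnegative everywhere and whose mean is bounded by periodicity, with a loss of only the log
    of the modulus. So the sum of [1/n] is at most of order (log x)^(1/2), and Chebyshev's bound
    turns this into a density of order (log x)^(-1/2), uniformly for moduli up to a power of log X.
    With the weight [1 / tau n], squaring twice gives (log x)^(1/4), hence the saving 3/4; for odd
    numbers one squaring gives 1/2.

    In the boxes log M + log N is about log X, and the sum of j^(-3/4) (n-j)^(-1/2) over j has size
    n^(-1/4): the savings win because 3/4 + 1/2 exceeds 1. Factors at most [W] cost only powers of
    log log X. The bilinear saving is W^(1/32), so C must be large enough to beat moments of [tau]
    and the number of boxes. *)

Module Analytic.
Import all_boot all_order all_algebra all_fingroup all_solvable all_field.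
Import zify ring lra reals sequences exp.
Import Order.TTheory GRing.Theory Num.Theory.
Set Implicit Arguments. Unset Strict Implicit. Unset Printing Implicit Defensive.
Local Open Scope nat_scope.

(** * Squarefree numbers and divisor sums *)

(** The clause [0 < n] is essential: [primes 0] is empty, so the second clause alone would admit
    0. *)
Definition sqf n := (0 < n) && all (fun p => logn p n == 1) (primes n).

Lemma sqf_gt0 n : sqf n -> 0 < n. Proof. by case/andP. Qed.

Lemma sqfP n : 0 < n -> reflect (forall p, prime p -> ~~ (p ^ 2 %| n)) (sqf n).
Proof.
move=> n0; rewrite /sqf n0 /=; apply: (iffP allP) => [H p pp | H p].
  apply/negP => h; have pn : p \in primes n.
    by rewrite mem_primes pp n0 (dvdn_trans _ h) // dvdn_exp.
  by move: h; rewrite pfactor_dvdn // (eqP (H p pn)).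
rewrite -logn_gt0 => h; have pp : prime p by move: h; rewrite logn_gt0 mem_primes => /andP[].
by have := H p pp; rewrite pfactor_dvdn // -ltnNge ltnS eqn_leq h => ->.
Qed.

Lemma sqf_dvd d n : d %| n -> sqf n -> sqf d.
Proof.
move=> dn sn; have n0 := sqf_gt0 sn; apply/sqfP => [|p pp]; first exact: dvdn_gt0 dn.
by apply: contra (sqfP n0 sn p pp) => /dvdn_trans; apply.
Qed.

Lemma sqfM_coprime a b : sqf (a * b) -> coprime a b.
Proof.
move=> s; have ab0 := sqf_gt0 s; move: (ab0); rewrite muln_gt0 => /andP[a0 b0].
rewrite coprime_has_primes //; apply/hasPn => p pb /=.
move: pb; rewrite !mem_primes => /and3P[pp _ pb]; apply/negP => /and3P[_ _ pa].
by have := sqfP ab0 s p pp; rewrite -mulnn dvdn_mul.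
Qed.

Lemma perm_primesM m n : 0 < m -> 0 < n -> coprime m n ->
  perm_eq (primes (m * n)) (primes m ++ primes n).
Proof.
move=> m0 n0 c; apply: uniq_perm; rewrite ?primes_uniq //.
  by rewrite cat_uniq !primes_uniq -coprime_has_primes // c.
by move=> p; rewrite mem_cat primesM.
Qed.

Lemma sqf_coprimeM a b : coprime a b -> sqf a -> sqf b -> sqf (a * b).
Proof.
move=> c /andP[a0 sa] /andP[b0 sb]; rewrite /sqf muln_gt0 a0 b0 /=.
apply/allP => p; rewrite (perm_mem (perm_primesM a0 b0 c)) mem_cat lognM //.
have disj q : q \in primes a -> q \notin primes b.
  move=> qa; move: c; rewrite coprime_has_primes // => /hasPn h.
  by apply/negP => /h; rewrite /= qa.
case/orP => h.
  by move/allP/(_ p h)/eqP: sa => ->; move: (disj p h); rewrite -logn_gt0 lt0n negbK => /eqP->.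
move/allP/(_ p h)/eqP: sb => ->; case: (posnP (logn p a)) => [-> //|].
by rewrite logn_gt0 => /disj; rewrite h.
Qed.

Lemma sqf_prod n : sqf n -> n = \prod_(p <- primes n) p.
Proof.
move=> /andP[n0 /allP h]; rewrite {1}(prod_prime_decomp n0) prime_decompE big_map /=.
by apply: eq_big_seq => p /h /= /eqP ->; rewrite expn1.
Qed.

Lemma sqf_prime p : prime p -> sqf p.
Proof.
move=> pp; apply/sqfP => [|q pq]; first exact: prime_gt0.
apply/negP => h; have : q %| p by apply: dvdn_trans h; rewrite dvdn_exp.
rewrite dvdn_prime2 // => /eqP e; move: h; rewrite e.
by rewrite gtnNdvd ?prime_gt0 // -{1}(expn1 p) ltn_exp2l // prime_gt1.
Qed.

Lemma divisors_le n x d : 0 < n -> n <= x ->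
  (d \in divisors n) = (0 < d < x.+1) && (d %| n).
Proof.
move=> n0 nx; rewrite -dvdn_divisors // andbC; case: (boolP (d %| n)) => //= dn.
by rewrite ltnS (dvdn_gt0 n0 dn) (leq_trans (dvdn_leq n0 dn)).
Qed.

(** Multiplication of divisors is inverted by [d -> (gcdn d m, gcdn d n)]; it is injective because
    the gcd of [m] with [a * b] is [a]. *)
Lemma perm_divisorsM m n : 0 < m -> 0 < n -> coprime m n ->
  perm_eq (divisors (m * n)) [seq a * b | a <- divisors m, b <- divisors n].
Proof.
move=> m0 n0 c; apply: uniq_perm; first exact: divisors_uniq.
  apply: allpairs_uniq; rewrite ?divisors_uniq // => -[a b] [a' b'] /=.
  move=> /allpairsP[[u v] /= [um vn [-> ->]]] /allpairsP[[u' v'] /= [um' vn' [-> ->]]] e.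
  move: um vn um' vn'; rewrite -!dvdn_divisors // => um vn um' vn'.
  have g w z : w %| m -> z %| n -> gcdn m (w * z) = w.
    move=> wm zn; rewrite Gauss_gcdl; first exact/gcdn_idPr.
    exact: coprime_dvdr zn c.
  have e1 : u = u' by rewrite -(g u v) // e g.
  rewrite -e1 in e *; congr (_, _); apply/eqP; move/eqP: e.
  by rewrite eqn_pmul2l // (dvdn_gt0 m0 um).
move=> d; rewrite -dvdn_divisors ?muln_gt0 ?m0 //; apply/idP/allpairsP.
  move=> dmn; exists (gcdn d m, gcdn d n); rewrite /= -!dvdn_divisors // !dvdn_gcdr; split=> //.
  apply/eqP; rewrite eqn_dvd; apply/andP; split.
    rewrite muln_gcdr dvdn_gcd dvdn_mull //= muln_gcdl dvdn_gcd dmn dvdn_mulr //.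
  rewrite Gauss_dvd ?dvdn_gcdl //.
  exact: coprime_dvdl (dvdn_gcdr _ _) (coprime_dvdr (dvdn_gcdr _ _) c).
by move=> [[a b] /= []]; rewrite -!dvdn_divisors // => am bn ->; exact: dvdn_mul.
Qed.

Definition tau n := size (divisors n).

Lemma tau_gt0 n : 0 < n -> 0 < tau n.
Proof. by move=> n0; rewrite /tau lt0n size_eq0; apply/eqP => h; have := @dvdn_divisors 1 n n0; rewrite h dvd1n. Qed.

Lemma tauM m n : 0 < m -> 0 < n -> coprime m n -> tau (m * n) = tau m * tau n.
Proof. by move=> m0 n0 c; rewrite /tau (perm_size (perm_divisorsM m0 n0 c)) size_allpairs. Qed.

Lemma tau_dvd d n : 0 < n -> d %| n -> tau d <= tau n.
Proof.
move=> n0 dn; apply: uniq_leq_size; first exact: divisors_uniq.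
move=> e; rewrite -!dvdn_divisors // ?(dvdn_gt0 n0 dn) // => /dvdn_trans; exact.
Qed.

Local Open Scope ring_scope.

Section Sums.
Variable R : pzRingType.

Lemma sum_divisors (F : nat -> R) n x : (0 < n)%N -> (n <= x)%N ->
  \sum_(d <- divisors n) F d = \sum_(1 <= d < x.+1 | (d %| n)%N) F d.
Proof.
move=> n0 nx; rewrite -[RHS]big_filter; apply: perm_big; apply: uniq_perm.
- exact: divisors_uniq.
- by rewrite filter_uniq // iota_uniq.
by move=> d; rewrite (@divisors_le _ x) // mem_filter mem_index_iota andbC.
Qed.

Lemma sum_multiples (G : nat -> R) d x : (0 < d)%N ->
  \sum_(1 <= n < x.+1 | (d %| n)%N) G (n %/ d)%N = \sum_(1 <= m < (x %/ d).+1) G m.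
Proof.
move=> d0; elim: x => [|x IH]; first by rewrite div0n !big_geq.
rewrite big_mkcond big_nat_recr //= -big_mkcond /= IH divnS //.
by case: (d %| x.+1)%N => /=; rewrite ?addr0 // add1n [RHS]big_nat_recr.
Qed.

Lemma sum_divisors_pairs (F : nat -> nat -> R) x :
  \sum_(1 <= n < x.+1) \sum_(d <- divisors n) F d (n %/ d)%N =
  \sum_(1 <= d < x.+1) \sum_(1 <= m < (x %/ d).+1) F d m.
Proof.
rewrite (eq_big_nat _ _ (F2 := fun n => \sum_(1 <= d < x.+1 | (d %| n)%N) F d (n %/ d)%N)); last first.
  by move=> n /andP[n0 nx]; rewrite (@sum_divisors _ _ x).
rewrite (exchange_big_dep xpredT) //=; apply: eq_big_nat => d /andP[d0 _].
by rewrite sum_multiples.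
Qed.

Lemma sum_divisorsM (F : nat -> R) m n : (0 < m)%N -> (0 < n)%N -> coprime m n ->
  \sum_(d <- divisors (m * n)) F d =
  \sum_(a <- divisors m) \sum_(b <- divisors n) F (a * b)%N.
Proof. by move=> m0 n0 c; rewrite (perm_big _ (perm_divisorsM m0 n0 c)) big_allpairs_dep. Qed.

End Sums.

(** * Legendre symbols *)

(** Euler's criterion serves as the definition of the Legendre symbol. The values are integers, so
    that symbols for different primes multiply in one ring. *)
Definition legF p (x : 'F_p) : int :=
  let y := x ^+ p.-1./2 in if y == 0 then 0 else if y == 1 then 1 else -1.
Definition leg p a : int := legF (a%:R : 'F_p).

Lemma legF_cases p (x : 'F_p) : [\/ legF x = 0, legF x = 1 | legF x = -1].
Proof. rewrite /legF; case: eqP => _; [by constructor 1|]; case: eqP => _; [by constructor 2|by constructor 3]. Qed.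

(** The values 0, 1, -1 stay distinct where 2 is nonzero, so an identity of symbols may be checked
    on Euler powers, in ['F_p] or in an extension of it. *)
Lemma sgn_inj (F : fieldType) (u v : int) : (2%:R : F) != 0 ->
  [\/ u = 0, u = 1 | u = -1] -> [\/ v = 0, v = 1 | v = -1] ->
  u%:~R = v%:~R :> F -> u = v.
Proof.
move=> h2; have h1 := oner_neq0 F; have h0 : (0 : F) != 1 by rewrite eq_sym.
have n1 : (- 1 : F) != 0 by rewrite oppr_eq0.
have n2 : (1 : F) != -1 by rewrite -subr_eq0 opprK.
have n3 : (- 1 : F) != 1 by rewrite eq_sym.
have n4 : (0 : F) != -1 by rewrite eq_sym.
by case=> ->; case=> ->; rewrite ?mulr0z ?mulr1z ?mulrN1z // => /eqP; rewrite ?(negPf h1)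
  ?(negPf h0) ?(negPf n1) ?(negPf n2) ?(negPf n3) ?(negPf n4).
Qed.

Lemma two_neq0 p (L : fieldType) : prime p -> odd p -> p \in [pchar L] -> (2%:R : L) != 0.
Proof.
move=> pp op pc; rewrite -(dvdn_pcharf pc); apply/negP => /dvdn_leq h.
by have := h isT; have := prime_gt1 pp; case: p op {pp pc h} => [|[|[|]]].
Qed.

Section Leg.
Variable p : nat.
Hypotheses (pp : prime p) (op : odd p).
Implicit Types x y : 'F_p.

Let two : (2%:R : 'F_p) != 0. Proof. exact: two_neq0 pp op (pchar_Fp pp). Qed.
Let half0 : (0 < p.-1./2)%N.
Proof. by have := prime_gt1 pp; case: p op => [|[|[|]]]. Qed.
Let halfK : (p.-1./2 + p.-1./2)%N = p.-1.
Proof. by rewrite addnn even_halfK //; case: p op. Qed.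

Lemma expFp_card x : x ^+ p = x.
Proof. by have := expf_card x; rewrite card_Fp. Qed.

Lemma expFp_pred x : x != 0 -> x ^+ p.-1 = 1.
Proof.
move=> x0; apply: (mulfI x0); rewrite -exprS prednK ?prime_gt0 // mulr1; exact: expFp_card.
Qed.

Lemma legFE x : (legF x)%:~R = x ^+ p.-1./2.
Proof.
rewrite /legF; case: eqP => [->|/eqP h0]; first by [].
case: eqP => [->|/eqP h1]; first by [].
have x0 : x != 0 by apply: contra h0 => /eqP ->; rewrite expr0n; case: (p.-1./2) half0.
apply/esym/eqP; rewrite -[_ == _]orFb -(negPf h1) -eqf_sqr expr1n expr2 -exprD halfK.
by rewrite expFp_pred.
Qed.

Lemma legFM x y : legF (x * y) = legF x * legF y.
Proof.
apply: (sgn_inj two); first exact: legF_cases.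
  case: (legF_cases x) => ->; case: (legF_cases y) => ->; rewrite ?mul0r ?mulr0 ?mul1r ?mulr1 ?mulrNN ?mulr1 /=;
   by [constructor 1|constructor 2|constructor 3].
by rewrite rmorphM /= !legFE exprMn.
Qed.

Lemma legF1 : legF (1 : 'F_p) = 1.
Proof. by rewrite /legF expr1n oner_eq0 eqxx. Qed.

Lemma legF_eq0 x : (legF x == 0) = (x == 0).
Proof.
have -> : (x == 0) = (x ^+ p.-1./2 == 0) by rewrite expf_eq0 half0.
by rewrite /legF; case: ifP => // _; case: ifP.
Qed.

Lemma legF0 : legF (0 : 'F_p) = 0. Proof. by apply/eqP; rewrite legF_eq0. Qed.

Lemma legF_sqr1 x : x != 0 -> legF x * legF x = 1.
Proof. by rewrite -legF_eq0; case: (legF_cases x) => ->. Qed.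

Lemma legF_square x : x != 0 -> legF (x ^+ 2) = 1.
Proof. by move=> x0; rewrite expr2 legFM legF_sqr1. Qed.

(** Otherwise all [p.-1] nonzero residues would be roots of unity of order dividing [p.-1./2], too
    many for the degree. *)
Lemma legF_nonres : exists x : 'F_p, legF x = -1.
Proof.
case: (boolP [exists x : 'F_p, legF x == -1]) => [/existsP[x /eqP]|]; first by exists x.
rewrite negb_exists => /forallP h.
pose rs := [seq x <- enum 'F_p | x != 0].
have a : all (p.-1./2).-unity_root rs.
  apply/allP => x; rewrite mem_filter => /andP[x0 _]; rewrite unity_rootE -legFE.
  by move: x0 (h x); rewrite -legF_eq0; case: (legF_cases x) => ->.
have u : uniq rs by rewrite filter_uniq ?enum_uniq.
have s : size rs = p.-1.
  have := count_predC (pred1 (0 : 'F_p)) (enum 'F_p).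
  rewrite -cardE card_Fp // count_uniq_mem ?enum_uniq // mem_enum add1n => e.
  by rewrite size_filter; move: (congr1 predn e) => /= <-.
have := max_unity_roots half0 a u; rewrite s -{1}halfK -{3}(addn0 p.-1./2) leq_add2l leqNgt.
by rewrite half0.
Qed.

Lemma legFN1 : (4 %| p.-1)%N -> legF (-1 : 'F_p) = 1.
Proof.
move=> h; apply: (sgn_inj two); [exact: legF_cases| by constructor 2|].
rewrite legFE -signr_odd.
have -> : odd p.-1./2 = false by case/dvdnP: h => k ->; rewrite -divn2 -[4%N]/(2 * 2)%N mulnA mulnK // oddM andbF.
by [].
Qed.

End Leg.

Lemma legM p a b : prime p -> odd p -> leg p (a * b) = leg p a * leg p b.
Proof. by move=> pp op; rewrite /leg natrM legFM. Qed.

Lemma leg_mod p a : prime p -> leg p (a %% p) = leg p a.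
Proof. by move=> pp; rewrite /leg Fp_nat_mod. Qed.

Lemma leg_cases p a : [\/ leg p a = 0, leg p a = 1 | leg p a = -1].
Proof. exact: legF_cases. Qed.

Lemma leg1 p : prime p -> leg p 1 = 1. Proof. by move=> pp; rewrite /leg legF1. Qed.

Lemma leg_eq0 p a : prime p -> odd p -> (leg p a == 0) = (p %| a)%N.
Proof. by move=> pp op; rewrite /leg legF_eq0 // (dvdn_pcharf (pchar_Fp pp)). Qed.

Lemma leg_nonres p : prime p -> odd p -> exists a, leg p a = -1.
Proof.
move=> pp op; have [x hx] := legF_nonres pp op; exists (x : nat).
by rewrite /leg natr_Zp.
Qed.

(** * Quadratic reciprocity *)

Section Gauss.
Variables (q : nat) (L : fieldType) (z : L).
Hypotheses (qp : prime q) (oq : odd q) (zq : q.-primitive_root z).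

Let e (x : 'F_q) : L := z ^+ (x : nat).
Let chi (x : 'F_q) : L := (legF x)%:~R.

Let e_nat n : e n%:R = z ^+ n.
Proof. by rewrite /e val_Fp_nat // (prim_expr_mod zq). Qed.

Let eD x y : e (x + y) = e x * e y.
Proof. by rewrite -[x]natr_Zp -[y]natr_Zp -natrD !e_nat exprD. Qed.

Let e1_neq1 : e 1 != 1.
Proof.
rewrite -[1]/(1%:R) e_nat -(prim_order_dvd zq) gtnNdvd //; exact: prime_gt1.
Qed.

Let sum_e a : \sum_x e (x * a) = if a == 0 then q%:R else 0.
Proof.
case: eqP => [->|/eqP a0].
  under eq_bigr do rewrite mulr0 /e expr0.
  by rewrite sumr_const card_Fp.
rewrite (reindex_onto (fun x => x * a^-1) (fun x => x * a)) /=; last by move=> x _; rewrite mulfK.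
rewrite (eq_bigl xpredT) => [|x]; last by rewrite mulfVK ?eqxx.
under eq_bigr do rewrite mulfVK //.
apply/eqP; have : (e 1 - 1) * \sum_x e x = 0.
  rewrite mulrBl mul1r mulr_sumr; under eq_bigr do rewrite -eD addrC.
  apply/eqP; rewrite subr_eq0; apply/eqP.
  by rewrite [RHS](reindex_inj (addIr 1)).
by move/eqP; rewrite mulf_eq0 subr_eq0 (negPf e1_neq1).
Qed.

Let chiM x y : chi (x * y) = chi x * chi y.
Proof. by rewrite /chi legFM // rmorphM. Qed.

Let sum_chi : 2%:R != 0 :> L -> \sum_x chi x = 0.
Proof.
move=> two; have [a ha] := legF_nonres qp oq.
have a0 : a != 0 by rewrite -(legF_eq0 qp) // ha.
have : \sum_x chi x = - \sum_x chi x.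
  rewrite {1}(reindex_inj (mulIf a0)) -sumrN; apply: eq_bigr => x _.
  by rewrite chiM /chi ha mulrN1z mulrN1.
by move/eqP; rewrite -addr_eq0 -mulr2n -mulr_natl mulf_eq0 (negPf two) => /eqP.
Qed.

(** The quadratic Gauss sum of [q], formed in [L] with the root of unity [z]. *)
Let G := \sum_x chi x * e x.

(** Replacing the second index by [x * c] makes the sum over [x] an additive character sum; since
    [chi] sums to zero, only [c = -1] survives. *)
Let G_sqr : 2%:R != 0 :> L -> G ^+ 2 = q%:R * chi (-1).
Proof.
move=> two; rewrite expr2 /G mulr_suml.
transitivity (\sum_(x | x != 0) \sum_c chi c * e (x * (1 + c))).
  rewrite (bigD1 0) //= {1}/chi legF0 // !mul0r add0r; apply: eq_bigr => x x0.
  rewrite mulr_sumr (reindex_inj (mulfI x0)); apply: eq_bigr => c _.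
  rewrite chiM mulrDr mulr1 eD.
  have -> : chi x * e x * (chi x * chi c * e (x * c)) = (chi x * chi x) * (chi c * (e x * e (x * c))).
    by rewrite !mulrA; congr (_ * _); rewrite -!mulrA; congr (_ * _); rewrite mulrCA; congr (_ * _); rewrite mulrC.
  by rewrite /chi -rmorphM /= legF_sqr1 // mul1r.
rewrite exchange_big /=.
transitivity (\sum_c chi c * ((if 1 + c == 0 then q%:R else 0) - 1)).
  apply: eq_bigr => c _; rewrite -mulr_sumr -sum_e [in RHS](bigD1 0) //= mul0r /e expr0.
  by rewrite addrAC subrr add0r.
under eq_bigr do rewrite mulrBr mulr1.
rewrite sumrB sum_chi // subr0 (bigD1 (-1)) //= subrr eqxx big1 ?addr0; first by rewrite mulrC.
by move=> c c1; rewrite addrC addr_eq0 (negPf c1) mulr0.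
Qed.

(** Frobenius permutes the terms, so [G ^ p] is [chi p] times [G]. On the other hand [G ^ 2 = q]
    because [q] is 1 mod 4, so [G ^ p.-1] is the Euler power of [q] modulo [p]. Comparing the two
    gives the law without a sign. *)
Lemma gauss_reciprocity p : prime p -> odd p -> p != q -> (4 %| q.-1)%N ->
  forall f : {rmorphism 'F_p -> L}, leg p q = leg q p.
Proof.
move=> pp op pq q4 f.
have pL : p \in [pchar L] by rewrite (fmorph_pchar f); exact: pchar_Fp.
have two : (2%:R : L) != 0 by exact: two_neq0 pL.
have G2 : G ^+ 2 = q%:R by rewrite G_sqr // /chi legFN1 // mulr1.
have q0 : (q%:R : L) != 0 by rewrite -(dvdn_pcharf pL) dvdn_prime2.
have G0 : G != 0 by apply: contra q0 => /eqP g; rewrite -G2 g expr0n.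
have chip x : chi x ^+ p = chi x.
  rewrite /chi; case: (legF_cases x) => ->; rewrite ?expr1n // ?expr0n.
    by case: (p) (prime_gt0 pp).
  by rewrite mulrN1z -signr_odd op expr1.
have p0 : (p%:R : 'F_q) != 0 by rewrite -(dvdn_pcharf (pchar_Fp qp)) dvdn_prime2 // eq_sym.
have Gp : chi p%:R * G ^+ p = G.
  rewrite -(pFrobenius_autE pL) rmorph_sum /= mulr_sumr.
  rewrite [RHS](reindex_inj (mulIf p0)); apply: eq_bigr => x _.
  rewrite pFrobenius_autE exprMn chip chiM mulrA [chi p%:R * _]mulrC; congr (_ * _).
  by rewrite -[x in RHS]natr_Zp -natrM e_nat exprM.
have : chi p%:R * (leg p q)%:~R = 1.
  apply: (mulIf G0); rewrite mul1r -{2}Gp -mulrA; congr (_ * _).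
  have -> : (leg p q)%:~R = (q%:R : L) ^+ p.-1./2.
    by rewrite -[q%:R](rmorph_nat f) -rmorphXn /= -legFE // rmorph_int.
  rewrite -G2 -exprM mul2n even_halfK; last by case: (p) op.
  by rewrite -exprSr prednK // prime_gt0.
move=> h; apply: (sgn_inj two); rewrite -/(leg p q); try exact: leg_cases.
move: h; rewrite /chi -/(leg q p) -{2}(mulr1z 1).
by case: (leg_cases p q) => ->; case: (leg_cases q p) => ->; rewrite ?mulr0z ?mul0r ?mulr0 ?mulr1z
  ?mulrN1z ?mulr1 ?mul1r ?mulrN1 ?opprK // => /eqP; rewrite 1?eq_sym ?oner_eq0.
Qed.

End Gauss.

(** As [p] does not divide [n], ['X^n - 1] is separable and has [n] distinct roots in an algebraic
    closure; a group of [n] roots of unity in a field is cyclic. *)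
Lemma closed_prim_root p n : prime p -> (0 < n)%N -> ~~ (p %| n)%N ->
  exists (L : fieldType) (f : {rmorphism 'F_p -> L}) (z : L), n.-primitive_root z.
Proof.
move=> pp n0 pn; have [L [f _]] := countable_algebraic_closure 'F_p.
have pL : p \in [pchar L] by rewrite (fmorph_pchar f); exact: pchar_Fp.
exists L; exists f; have [rs] := closed_field_poly_normal ('X^n - 1 : {poly L}).
rewrite lead_coefXnsubC // scale1r => e.
have u : uniq rs.
  by rewrite -separable_prod_XsubC -e; apply: separable_Xn_sub_1; rewrite -(dvdn_pcharf pL).
have a : all n.-unity_root rs.
  by apply/allP => x xr; rewrite /root_of_unity e root_prod_XsubC.
have s : (n <= size rs)%N.
  have := size_prod_XsubC rs id; rewrite -e size_XnsubC // => -[<-]; exact: leqnn.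
by have /hasP[z _ hz] := has_prim_root n0 a u s; exists z.
Qed.

Lemma reciprocity p q : prime p -> odd p -> prime q -> odd q -> (4 %| q.-1)%N ->
  leg p q = leg q p.
Proof.
move=> pp op pq oq q4; case: (eqVneq p q) => [-> //|npq].
have [L [f [z hz]]] : exists (L : fieldType) (f : {rmorphism 'F_p -> L}) (z : L), q.-primitive_root z.
  by apply: closed_prim_root => //; [exact: prime_gt0|rewrite dvdn_prime2].
exact: gauss_reciprocity hz _ pp op npq q4 f.
Qed.

(** The even primitive character modulo 8; at odd primes it is the Legendre symbol of 2. *)
Definition chi8 n : int := if odd n then (if (n %% 8 \in [:: 1; 7])%N then 1 else -1) else 0.

(** With a primitive 8th root of unity [z], the element [z + z ^ 7] is a square root of 2, and
    Frobenius multiplies it by [chi8 p]. *)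
Lemma leg_two p : prime p -> odd p -> leg p 2 = chi8 p.
Proof.
move=> pp op.
have [L [f [z hz]]] : exists (L : fieldType) (f : {rmorphism 'F_p -> L}) (z : L), 8.-primitive_root z.
  apply: closed_prim_root => //; apply/negP => h.
  have : (p %| 2 ^ 3)%N by [].
  by rewrite Euclid_dvdX // andbT dvdn_prime2 // => /eqP pe; rewrite pe in op.
have pL : p \in [pchar L] by rewrite (fmorph_pchar f); exact: pchar_Fp.
have two : (2%:R : L) != 0 by exact: two_neq0 pL.
have z0 : z != 0 by apply: contra_eq_neq (prim_expr_order hz) => ->; rewrite expr0n eq_sym oner_eq0.
have z4 : z ^+ 4 = -1.
  have := prim_expr_order hz; rewrite -[8%N]/(4 * 2)%N exprM => /eqP.
  by rewrite -{1}(expr1n L 2) eqf_sqr -(prim_order_dvd hz) /= => /eqP.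
pose g := z + z ^+ 7.
have z8 : z ^+ 8 = 1 by exact: prim_expr_order.
have g2 : g ^+ 2 = 2%:R.
  rewrite /g sqrrD -exprS z8 -exprM -[(7 * 2)%N]/(8 + 6)%N exprD z8 mul1r -[6%N]/(4+2)%N exprD z4 mulN1r.
  by rewrite addrAC subrr add0r.
have g0 : g != 0 by apply: contra two => /eqP g'; rewrite -g2 g' expr0n.
have gp : g ^+ p = (chi8 p)%:~R * g.
  rewrite -(pFrobenius_autE pL) rmorphD /= !pFrobenius_autE -exprM.
  rewrite -(prim_expr_mod hz p) -(prim_expr_mod hz (7 * p)) -modnMmr /chi8 op.
  have : odd (p %% 8) by rewrite odd_mod.
  have : (p %% 8 < 8)%N by rewrite ltn_mod.
  have z3 : z ^+ 3 = - z ^+ 7 by rewrite -[7%N]/(4+3)%N exprD z4 mulN1r opprK.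
  have z5 : z ^+ 5 = - z by rewrite -[5%N]/(4+1)%N exprD z4 mulN1r.
  case: (p %% 8)%N => [|[|[|[|[|[|[|[|m]]]]]]]] //= _ _; rewrite ?mulr1z ?mul1r ?mulrN1z ?mulN1r /g ?z3 ?z5 ?expr1 //.
  - by rewrite opprD addrC.
  - by rewrite opprD.
  - by rewrite addrC.
apply: (sgn_inj two); first exact: leg_cases.
  by rewrite /chi8 op; case: ifP => _; [constructor 2|constructor 3].
apply: (mulIf g0); rewrite -gp.
have -> : (leg p 2)%:~R = (2%:R : L) ^+ p.-1./2.
  by rewrite -(rmorph_nat f) -rmorphXn /= -legFE // rmorph_int.
rewrite -g2 -exprM mul2n even_halfK; last by case: (p) op.
by rewrite -exprSr prednK // prime_gt0.
Qed.

(** * Jacobi symbols *)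

(** The product runs over distinct primes, so this is the Jacobi symbol of [a] over [b] for odd
    squarefree [b]. *)
Definition kron b a : int := \prod_(p <- primes b) leg p a.

Lemma odd_primes b p : odd b -> p \in primes b -> prime p /\ odd p.
Proof.
move=> ob; rewrite mem_primes => /and3P[pp _ pb]; split=> //.
by move: ob; apply: contraTT => ep; have := dvdn_odd pb; case: (odd b) => // /(_ isT); rewrite (negPf ep).
Qed.

Lemma kronMr b a1 a2 : odd b -> kron b (a1 * a2) = kron b a1 * kron b a2.
Proof.
move=> ob; rewrite /kron -big_split; apply: eq_big_seq => p /(odd_primes ob)[pp op].
by rewrite /= legM.
Qed.

Lemma kron1r b : kron b 1 = 1.
Proof.
rewrite /kron big1_seq // => p; rewrite /= mem_primes => /andP[pp _]; exact: leg1.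
Qed.

Lemma kron1l a : kron 1 a = 1. Proof. by rewrite /kron big_nil. Qed.

Lemma kron_mod b m a : (0 < m)%N -> (b %| m)%N -> kron b (a %% m) = kron b a.
Proof.
move=> m0 bm; apply: eq_big_seq => p; rewrite mem_primes => /and3P[pp _ pb].
by rewrite -leg_mod // modn_dvdm ?leg_mod // (dvdn_trans pb).
Qed.

Lemma kron_cases b a : [\/ kron b a = 0, kron b a = 1 | kron b a = -1].
Proof.
rewrite /kron; elim: (primes b) => [|p s IH]; first by rewrite big_nil; constructor 2.
rewrite big_cons; case: IH => ->; case: (leg_cases p a) => ->;
 rewrite ?mul0r ?mulr0 ?mul1r ?mulr1 ?mulrNN ?mulr1 /=; by [constructor 1|constructor 2|constructor 3].
Qed.

Lemma kronMl b1 b2 a : (0 < b1)%N -> (0 < b2)%N -> coprime b1 b2 ->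
  kron (b1 * b2) a = kron b1 a * kron b2 a.
Proof. by move=> h1 h2 c; rewrite /kron (perm_big _ (perm_primesM h1 h2 c)) big_cat. Qed.

Lemma kron_prime p a : prime p -> kron p a = leg p a.
Proof. by move=> pp; rewrite /kron primes_prime // big_seq1. Qed.

Lemma leg_prod p (s : seq nat) : prime p -> odd p ->
  leg p (\prod_(i <- s) i) = \prod_(i <- s) leg p i.
Proof.
move=> pp op; elim: s => [|i s IH]; first by rewrite !big_nil leg1.
by rewrite !big_cons legM // IH.
Qed.

Definition one4 d := sqf d && all (fun p => p %% 4 == 1)%N (primes d).
Definition oddsq n := odd n && sqf n.

Lemma oddsq_gt0 n : oddsq n -> (0 < n)%N. Proof. by case/andP => _ /sqf_gt0. Qed.

Lemma oddsq_dvd d n : (d %| n)%N -> oddsq n -> oddsq d.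
Proof. by move=> dn /andP[o s]; rewrite /oddsq (dvdn_odd dn o) (sqf_dvd dn s). Qed.

Lemma one4_dvd d n : (d %| n)%N -> one4 n -> one4 d.
Proof.
move=> dn /andP[s /allP a]; rewrite /one4 (sqf_dvd dn s) /=; apply/allP => p.
rewrite mem_primes => /and3P[pp d0 pd]; apply: a.
by rewrite mem_primes pp (sqf_gt0 s) (dvdn_trans pd).
Qed.

Lemma one4_oddsq d : one4 d -> oddsq d.
Proof.
move=> /andP[s /allP a]; rewrite /oddsq s andbT; apply/negPn/negP => ev.
have : 2%N \in primes d by rewrite mem_primes /= (sqf_gt0 s) dvdn2.
by move/a.
Qed.

(** Both sides expand over pairs of primes; all primes of [d] are 1 mod 4, so reciprocity brings no
    sign. *)
Lemma kron_sym d e : one4 d -> oddsq e -> kron e d = kron d e.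
Proof.
move=> hd he; have /andP[od sd] := one4_oddsq hd; have /andP[oe se] := he.
have -> : kron e d = \prod_(p <- primes e) \prod_(q <- primes d) leg p q.
  by apply: eq_big_seq => p /(odd_primes oe)[pp op]; rewrite {1}(sqf_prod sd) leg_prod.
have -> : kron d e = \prod_(q <- primes d) \prod_(p <- primes e) leg q p.
  by apply: eq_big_seq => p /(odd_primes od)[pp op]; rewrite {1}(sqf_prod se) leg_prod.
rewrite exchange_big /=; apply: eq_big_seq => q qd; apply: eq_big_seq => p pe.
have [pp op] := odd_primes oe pe; have [pq oq] := odd_primes od qd.
apply: reciprocity => //.
have /allP/(_ q qd) h4 := (proj2 (andP hd)).
by rewrite (divn_eq q 4) (eqP h4) addn1 /= dvdn_mull.
Qed.

Lemma kron_good e a m : all (fun p => leg p a == 1) (primes e) -> (m %| e)%N -> (0 < e)%N ->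
  kron m a = 1.
Proof.
move=> /allP h me e0; rewrite /kron big1_seq // => p /=; rewrite mem_primes => /and3P[pp m0 pm].
by apply/eqP/h; rewrite mem_primes pp e0 (dvdn_trans pm).
Qed.

(** * Nonnegative divisor sums of multiplicative functions *)

Section DivisorSums.
Variable R : numDomainType.

Lemma sum_divisors_pfactor (f : nat -> R) p k : prime p ->
  \sum_(d <- divisors (p ^ k)) f d = \sum_(i < k.+1) f (p ^ i)%N.
Proof.
move=> pp; rewrite -(big_mkord xpredT (fun i => f (p ^ i)%N)) -(big_map (expn p) xpredT).
apply: perm_big; apply: uniq_perm; first exact: divisors_uniq.
  by rewrite map_inj_uniq ?iota_uniq // => i j /eqP; rewrite eqn_exp2l ?prime_gt1 // => /eqP.
move=> d; rewrite -dvdn_divisors ?expn_gt0 ?prime_gt0 //; apply/(dvdn_pfactor _ _ pp)/mapP.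
  by case=> m mk ->; exists m => //; rewrite mem_index_iota.
by case=> m; rewrite mem_index_iota => /= mk ->; exists m.
Qed.

(** The divisor sum factors over prime powers; the part at the smallest prime is split off and the
    induction goes on with the cofactor. *)
Lemma sum_divisors_ge0 (f : nat -> R) n : (0 < n)%N -> f 1%N = 1 ->
  (forall a b, (0 < a)%N -> (0 < b)%N -> coprime a b -> f (a * b)%N = f a * f b) ->
  (forall p k, prime p -> (p ^ k %| n)%N -> 0 <= \sum_(i < k.+1) f (p ^ i)%N) ->
  0 <= \sum_(d <- divisors n) f d.
Proof.
move=> + f1 fM; elim/ltn_ind: n => n IH n0 H.
case: (ltngtP n 1) => [|n1|->]; first by case: (n) n0.
  set p := pdiv n; have pp : prime p by exact: pdiv_prime.
  have [m mp e] := pfactor_coprime pp n0; set k := logn p n in e.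
  have k0 : (0 < k)%N by rewrite logn_gt0 mem_primes pp n0 pdiv_dvd.
  have m0 : (0 < m)%N by move: n0; rewrite e muln_gt0 => /andP[].
  have pk0 : (0 < p ^ k)%N by rewrite expn_gt0 prime_gt0.
  have c : coprime m (p ^ k) by rewrite coprime_sym coprimeXl.
  rewrite e sum_divisorsM //.
  rewrite (eq_big_seq (fun a => f a * \sum_(b <- divisors (p ^ k)) f b)); last first.
    move=> a; rewrite -dvdn_divisors // => am; rewrite mulr_sumr.
    apply: eq_big_seq => b; rewrite -dvdn_divisors // => bp.
    rewrite fM ?(dvdn_gt0 m0 am) ?(dvdn_gt0 pk0 bp) //.
    exact: coprime_dvdl am (coprime_dvdr bp c).
  rewrite -mulr_suml mulr_ge0 //; last by rewrite sum_divisors_pfactor // H // e dvdn_mull.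
  apply: IH => //.
    by rewrite e ltn_Pmulr // -{1}(expn0 p) ltn_exp2l // prime_gt1.
  by move=> q j qp qj; apply: H => //; rewrite e dvdn_mulr.
by rewrite big_cons big_nil f1 addr0 ler01.
Qed.

End DivisorSums.

(** The sum is the product of the factors [1 + leg p a], each 0, 1 or 2. Nonnegativity is what lets
    it serve as a majorant of the condition that all these symbols are 1. *)
Lemma sum_kron_ge0 e a : oddsq e -> 0 <= \sum_(m <- divisors e) kron m a.
Proof.
move=> he; have /andP[oe se] := he; apply: sum_divisors_ge0.
- exact: sqf_gt0.
- exact: kron1l.
- by move=> x y x0 y0 c; rewrite kronMl.
move=> p k pp pe; have k1 : (k <= 1)%N.
  have s := sqf_dvd pe se; rewrite leqNgt; apply/negP => k2.
  by have := sqfP (sqf_gt0 s) s p pp; rewrite dvdn_exp2l.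
case: k k1 pe => [|[|//]] _ pe; first by rewrite big_ord1 expn0 kron1l.
rewrite big_ord_recl big_ord1 /= expn0 kron1l expn1 kron_prime //.
by case: (leg_cases p a) => ->.
Qed.

Lemma sum_kron_good e a : (0 < e)%N -> all (fun p => leg p a == 1) (primes e) ->
  \sum_(m <- divisors e) kron m a = (tau e)%:R.
Proof.
move=> e0 h; rewrite (eq_big_seq (fun=> 1)).
  by rewrite big_const_seq count_predT iter_addr_0.
by move=> m; rewrite -dvdn_divisors // => me; rewrite (kron_good h).
Qed.

(** * Periodicity and orthogonality *)

Section Periodic.
Variable R : numDomainType.

(** Multiplication by [y0] permutes the residues and negates [f], so the sum is its own negative. *)
Lemma flip_sum0 (f : nat -> R) q y0 : (0 < q)%N -> (forall n, f (n %% q)%N = f n) ->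
  coprime y0 q -> (forall n, f (y0 * n)%N = - f n) -> \sum_(0 <= n < q) f n = 0.
Proof.
move=> q0 fq c fN; rewrite big_mkord.
pose h (i : 'I_q) := Ordinal (ltn_pmod (y0 * i)%N q0).
have hi : injective h.
  suff H (i j : 'I_q) : (j <= i)%N -> h i = h j -> i = j.
    by move=> i j; case/orP: (leq_total j i) => l e; [|apply/esym]; apply: H.
  move=> ji /(congr1 val) /= /eqP; rewrite eqn_mod_dvd ?leq_mul // -mulnBr Gauss_dvdr; last by rewrite coprime_sym.
  rewrite /dvdn modn_small; last by apply: leq_ltn_trans (leq_subr _ _) (ltn_ord i).
  by rewrite subn_eq0 => ij; apply/val_inj/eqP; rewrite eqn_leq ij.
have : \sum_(i < q) f i = - \sum_(i < q) f i.
  by rewrite {1}(reindex_inj hi) -sumrN; apply: eq_bigr => i _; rewrite fq fN.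
by move/eqP; rewrite -addr_eq0 -mulr2n mulrn_eq0 => /eqP.
Qed.

Lemma periodic_sum_shift (f : nat -> R) q m : (0 < q)%N -> (forall n, f (n %% q)%N = f n) ->
  \sum_(m <= n < m + q) f n = \sum_(0 <= n < q) f n.
Proof.
move=> q0 fq; elim: m => [|m <-]; first by rewrite add0n.
have e1 : \sum_(m <= n < (m + q).+1) f n = f m + \sum_(m.+1 <= n < m.+1 + q) f n.
  by rewrite big_ltn ?ltnS ?leq_addr.
have e2 : \sum_(m <= n < (m + q).+1) f n = \sum_(m <= n < m + q) f n + f (m + q)%N.
  by rewrite big_nat_recr ?leq_addr.
by move: e1; rewrite e2 -[f (m + q)%N]fq modnDr fq addrC => /addrI.
Qed.

Lemma periodic_sum_le (f : nat -> R) q m n : (0 < q)%N -> (forall n, f (n %% q)%N = f n) ->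
  (forall n, `|f n| <= 1) -> \sum_(0 <= n < q) f n = 0 -> `|\sum_(m <= i < n) f i| <= q%:R.
Proof.
move=> q0 fq f1 s0; move: {2}(n - m)%N (leqnn (n - m)) => k; elim/ltn_ind: k m => k IH m hk.
case: (leqP (n - m) q) => h.
  apply: le_trans (ler_norm_sum _ _ _) _; apply: le_trans (ler_sum _ (fun i _ => f1 i)) _.
  by rewrite sumr_const_nat ler_nat.
have l1 : (m <= m + q)%N by lia. have l2 : (m + q <= n)%N by lia.
  rewrite (big_cat_nat l1 l2) /=.
  by rewrite periodic_sum_shift // s0 add0r; apply: (IH (n - (m + q))%N); lia.
Qed.

End Periodic.

(** A real nonprincipal character. Nontriviality is recorded through the vanishing sum over a
    period, the form in which the cancellation estimates consume it. *)
Record rchar (R : numDomainType) (q : nat) (f : nat -> R) : Prop := Rchar {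
  rc_gt0 : (0 < q)%N;
  rc_1 : f 1%N = 1;
  rc_M : forall a b, f (a * b)%N = f a * f b;
  rc_val : forall n, [\/ f n = 0, f n = 1 | f n = -1];
  rc_mod : forall n, f (n %% q)%N = f n;
  rc_sum0 : \sum_(0 <= n < q) f n = 0 }.

Lemma flip_rchar (f : nat -> int) q y0 : (0 < q)%N -> f 1%N = 1 ->
  (forall a b, f (a * b)%N = f a * f b) -> (forall n, [\/ f n = 0, f n = 1 | f n = -1]) ->
  (forall n, f (n %% q)%N = f n) -> coprime y0 q -> f y0 = -1 -> rchar q f.
Proof.
move=> q0 f1 fM fv fq c fy; split=> //; apply: flip_sum0 c _ => // n.
by rewrite fM fy mulN1r.
Qed.

(** By the Chinese remainder theorem [y] is taken to be a nonresidue modulo [p] and 1 modulo [M]: it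
    flips the sign at [p] and leaves every symbol of modulus dividing [M] unchanged. *)
Lemma exists_flip p M : prime p -> odd p -> coprime p M -> (0 < M)%N ->
  exists y, [/\ leg p y = -1, (y = 1 %[mod M])%N & coprime y (p * M)].
Proof.
move=> pp op c M0; have [a ha] := leg_nonres pp op.
have ep : leg p (chinese p M a 1) = -1 by rewrite -leg_mod // chinese_modl // leg_mod.
have eM : (chinese p M a 1 = 1 %[mod M])%N by rewrite chinese_modr.
exists (chinese p M a 1); split=> //; rewrite coprimeMr; apply/andP; split.
  by rewrite coprime_sym prime_coprime // -leg_eq0 // ep.
by rewrite -coprime_modl eM coprime_modl coprime1n.
Qed.

Lemma kron_mod1 b M y : (0 < M)%N -> (b %| M)%N -> (y = 1 %[mod M])%N -> kron b y = 1.
Proof. by move=> M0 bM e; rewrite -(kron_mod y M0 bM) e kron_mod // kron1r. Qed.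

Lemma sqf_primes_inj a b : sqf a -> sqf b -> primes a =i primes b -> a = b.
Proof.
move=> sa sb e; rewrite (sqf_prod sa) (sqf_prod sb); apply: perm_big.
by apply: uniq_perm; rewrite ?primes_uniq.
Qed.

Lemma kron_pair_flip x1 x2 p : oddsq x1 -> oddsq x2 -> p \in primes x1 -> p \notin primes x2 ->
  exists y, coprime y (x1 * x2) /\ kron x1 y * kron x2 y = -1.
Proof.
move=> h1 h2 p1 p2; have /andP[o1 s1] := h1; have /andP[o2 s2] := h2.
have [pp op] := odd_primes o1 p1; have x10 := sqf_gt0 s1; have x20 := sqf_gt0 s2.
have pd : (p %| x1)%N by move: p1; rewrite mem_primes => /and3P[].
have e1 : x1 = (p * (x1 %/ p))%N by rewrite mulnC divnK.
set x1' := (x1 %/ p)%N in e1.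
have c1 : coprime p x1' by apply: sqfM_coprime; rewrite -e1.
have c2 : coprime p x2 by rewrite prime_coprime //; apply: contra p2 => ?; rewrite mem_primes pp x20.
have x1'0 : (0 < x1')%N by move: x10; rewrite e1 muln_gt0 => /andP[].
have M0 : (0 < x1' * x2)%N by rewrite muln_gt0 x1'0.
have [|y [hy yM cy]] := exists_flip pp op _ M0; first by rewrite coprimeMr c1.
exists y; rewrite e1 -mulnA; split=> //.
rewrite (kronMl _ (prime_gt0 pp) x1'0 c1) (kron_prime _ pp) hy.
by rewrite (kron_mod1 M0 (dvdn_mulr _ (dvdnn _)) yM) (kron_mod1 M0 (dvdn_mull _ (dvdnn _)) yM) !mulr1.
Qed.

(** Distinct squarefree numbers differ at some prime, so the product of the two symbols can be
    flipped there. It has period [x1 * x2] and mean zero, and only an incomplete period remains. *)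
Lemma kron_orthogonal x1 x2 m n : oddsq x1 -> oddsq x2 -> x1 != x2 ->
  `|\sum_(m <= y < n) kron x1 y * kron x2 y| <= (x1 * x2)%N%:R :> int.
Proof.
move=> h1 h2 ne; have /andP[o1 s1] := h1; have /andP[o2 s2] := h2.
have M0 : (0 < x1 * x2)%N by rewrite muln_gt0 !oddsq_gt0.
have [y [cy fy]] : exists y, coprime y (x1 * x2) /\ kron x1 y * kron x2 y = -1.
  case: (boolP (all (mem (primes x2)) (primes x1))) => [/allP a1|/allPn[p p1 p2]]; last first.
    exact: (kron_pair_flip h1 h2 p1 p2).
  case: (boolP (all (mem (primes x1)) (primes x2))) => [/allP a2|/allPn[p p2 p1]].
    case/eqP: ne; apply: sqf_primes_inj => // p; apply/idP/idP; [exact: a1|exact: a2].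
  by have [y [cy fy]] := kron_pair_flip h2 h1 p2 p1; exists y; rewrite mulnC mulrC.
have per k : kron x1 (k %% (x1 * x2)) * kron x2 (k %% (x1 * x2)) = kron x1 k * kron x2 k.
  by rewrite (kron_mod k M0 (dvdn_mulr _ (dvdnn _))) (kron_mod k M0 (dvdn_mull _ (dvdnn _))).
apply: periodic_sum_le => //.
  by move=> k; case: (kron_cases x1 k) => ->; case: (kron_cases x2 k) => ->.
apply: flip_sum0 cy _ => //.
by move=> k; rewrite !kronMr // mulrACA fy mulN1r.
Qed.

Lemma chi8_mod n : chi8 (n %% 8) = chi8 n.
Proof. by rewrite /chi8 odd_mod // modn_mod. Qed.

Lemma chi8M a b : chi8 (a * b) = chi8 a * chi8 b.
Proof.
rewrite -chi8_mod -modnMm chi8_mod -(chi8_mod a) -(chi8_mod b).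
move: (a %% 8)%N (b %% 8)%N (ltn_pmod a (isT : 0 < 8)%N) (ltn_pmod b (isT : 0 < 8)%N) => {}a {}b.
by case: a => [|[|[|[|[|[|[|[|]]]]]]]] // _; case: b => [|[|[|[|[|[|[|[|]]]]]]]].
Qed.

Lemma chi8_cases n : [\/ chi8 n = 0, chi8 n = 1 | chi8 n = -1].
Proof. by rewrite /chi8; case: (odd n); [case: ifP => _; [constructor 2|constructor 3]|constructor 1]. Qed.

Definition chi4 n : int := if odd n then (if (n %% 4 == 1)%N then 1 else -1) else 0.

Lemma rchar_chi4 : rchar 4 chi4.
Proof.
have cm n : chi4 (n %% 4) = chi4 n by rewrite /chi4 odd_mod // modn_mod.
apply: (@flip_rchar _ _ 3) => //.
  move=> a b; rewrite -cm -modnMm cm -(cm a) -(cm b).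
  move: (a %% 4)%N (b %% 4)%N (ltn_pmod a (isT : 0 < 4)%N) (ltn_pmod b (isT : 0 < 4)%N) => {}a {}b.
  by case: a => [|[|[|[|]]]] // _; case: b => [|[|[|[|]]]].
by move=> n; rewrite /chi4; case: (odd n); [case: ifP => _; [constructor 2|constructor 3]|constructor 1].
Qed.

(** For [one4 d] and an odd prime [n], reciprocity identifies this with the Legendre symbol of
    [2 ^ s * d] modulo [n]; in this form it is periodic in [n]. *)
Definition psi (s : bool) d n : int := chi8 n ^+ s * kron d n.

(** The side condition excludes exactly the trivial character. For [d = 1] the value at 3 is
    [chi8 3 = -1]; otherwise the sign is flipped at the smallest prime of [d] by some [y] that is 1
    modulo 8 and modulo the rest of [d]. *)
Lemma rchar_psi (s : bool) d : oddsq d -> s || (d != 1)%N -> rchar (8 * d) (psi s d).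
Proof.
move=> hd sd; have /andP[od sqd] := hd; have d0 := oddsq_gt0 hd.
have q0 : (0 < 8 * d)%N by rewrite muln_gt0.
have [y [cy fy]] : exists y, coprime y (8 * d) /\ psi s d y = -1.
  case: (eqVneq d 1%N) sd => [->|d1 _].
    by rewrite orbF => ->; exists 3%N; split; rewrite /psi ?kron1l.
  have pp : prime (pdiv d) by apply: pdiv_prime; case: (d) d0 d1 => [|[]].
  have pd := pdiv_dvd d; set p := pdiv d in pp pd.
  have op := dvdn_odd pd od.
  have e : d = (p * (d %/ p))%N by rewrite mulnC divnK.
  set d' := (d %/ p)%N in e.
  have c1 : coprime p d' by apply: sqfM_coprime; rewrite -e.
  have d'0 : (0 < d')%N by move: d0; rewrite e muln_gt0 => /andP[].
  have M0 : (0 < 8 * d')%N by rewrite muln_gt0.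
  have c8 : coprime p 8 by rewrite -[8%N]/(2 ^ 3)%N coprimeXr // coprimen2.
  have [|y [hy yM cy]] := exists_flip pp op _ M0; first by rewrite coprimeMr c8.
  exists y; rewrite e mulnCA; split=> //; rewrite /psi (kronMl _ (prime_gt0 pp) d'0 c1) (kron_prime _ pp) hy.
  rewrite (kron_mod1 M0 (dvdn_mull _ (dvdnn _)) yM) mulr1.
  have -> : chi8 y = 1.
    by rewrite -chi8_mod -(@modn_dvdm (8 * d')%N) ?dvdn_mulr // yM modn_dvdm ?dvdn_mulr.
  by rewrite expr1n mul1r.
apply: (flip_rchar _ _ _ _ _ cy fy) => //.
- by rewrite /psi kron1r expr1n.
- by move=> a b; rewrite /psi kronMr // chi8M exprMn mulrACA.
- by move=> n; rewrite /psi; case: (kron_cases d n) => ->; case: s {sd fy} => /=; case: (chi8_cases n) => ->;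
  by [constructor 1|constructor 2|constructor 3].
move=> n; rewrite /psi (kron_mod n q0 (dvdn_mull _ (dvdnn _))); congr (_ ^+ _ * _).
by rewrite -chi8_mod modn_dvdm ?dvdn_mulr // chi8_mod.
Qed.

Lemma leg_psi (s : bool) d p : prime p -> odd p -> one4 d -> leg p (2 ^ s * d) = psi s d p.
Proof.
move=> pp op hd; rewrite legM // /psi; congr (_ * _).
  by case: s => /=; rewrite ?expn1 ?expn0 ?leg_two // leg1 // expr0.
by rewrite -kron_prime // kron_sym // /oddsq op sqf_prime.
Qed.

(** * Chebyshev and mean values of multiplicative functions *)

Local Open Scope nat_scope.

Lemma dvdn_prod_primes (s : seq nat) N : uniq s -> all prime s -> all (fun p => p %| N) s ->
  \prod_(p <- s) p %| N.
Proof.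
elim: s => [|p s IH] /=; first by rewrite big_nil dvd1n.
move=> /andP[ps us] /andP[pp sp] /andP[pN sN]; rewrite big_cons Gauss_dvd ?pN ?IH //.
elim: s sp ps {IH us sN} => [|q s IH] /=; first by rewrite big_nil coprimen1.
rewrite inE negb_or => /andP[pq sp] /andP[npq ps].
by rewrite big_cons coprimeMr IH // andbT prime_coprime // dvdn_prime2.
Qed.

Lemma prime_dvd_fact p k : prime p -> p %| k`! -> p <= k.
Proof.
move=> pp; elim: k => [|k IH]; first by rewrite fact0 Euclid_dvd1.
by rewrite factS Euclid_dvdM // => /orP[/dvdn_leq->//|/IH/leqW].
Qed.

(** Two equal middle coefficients occur in the expansion of [2 ^ m.*2.+1], so each is at most half
    of it. *)
Lemma bin_odd_le m : 'C(m.*2.+1, m) <= 4 ^ m.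
Proof.
rewrite -(@leq_pmul2l 2) // -[4]/(2 ^ 2) -expnM -expnS (mul2n m).
have e : 'C(m.*2.+1, m.+1) = 'C(m.*2.+1, m).
  by rewrite -bin_sub; [congr ('C(_, _)); lia|lia].
have := expnDn 1 1 m.*2.+1; rewrite addn1 => ->.
rewrite (bigD1 (inord m)) //= (bigD1 (inord m.+1)) /=; last first.
  by apply/eqP => /(congr1 val) /=; rewrite !inordK; lia.
by rewrite !inordK; [rewrite !exp1n !muln1 e addnA mul2n -addnn leq_addr|lia|lia].
Qed.

(** Erdos's argument: the primes from [m + 2] to [2 * m + 1] all divide ['C(m.*2.+1, m)], which is
    at most [4 ^ m]; an even [n > 2] adds no prime. *)
Lemma primorial_le n : \prod_(1 <= p < n.+1 | prime p) p <= 4 ^ n.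
Proof.
elim/ltn_ind: n => n IH; case: (ltnP n 3) => n3.
  by case: n n3 {IH} => [|[|[|]]] // _; rewrite unlock.
case: (boolP (odd n)) => on; last first.
  rewrite big_mkcond big_nat_recr /=; last by lia.
  rewrite -big_mkcond /=; case: ifP => [pn|_]; first by have := even_prime pn; rewrite (negPf on); case=> // e2; rewrite e2 in n3.
  rewrite muln1; have := IH n.-1; rewrite prednK; last by lia.
  by move=> h; apply: leq_trans (h _) _; [lia|rewrite leq_exp2l //; lia].
have [m em] : exists m, n = m.*2.+1 by exists n./2; rewrite -{1}(odd_double_half n) on.
have m0 : 0 < m by lia.
rewrite em (big_cat_nat (n := m.+2)) //=; last by lia.
have -> : 4 ^ m.*2.+1 = 4 ^ m.+1 * 4 ^ m by rewrite -expnD; congr (_ ^ _); lia.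
apply: leq_mul; first by apply: IH; lia.
apply: leq_trans _ (bin_odd_le m); apply: dvdn_leq; first by rewrite bin_gt0; lia.
rewrite -big_filter; apply: dvdn_prod_primes; first by rewrite filter_uniq ?iota_uniq.
  by apply/allP => p; rewrite mem_filter => /andP[].
apply/allP => p; rewrite mem_filter mem_index_iota => /and3P[pp p1 p2].
have : p %| (m.*2.+1)`! by rewrite dvdn_fact // prime_gt0.
have <- : 'C(m.*2.+1, m) * (m`! * (m.+1)`!) = (m.*2.+1)`!.
  by rewrite -(@bin_fact m.*2.+1 m); [congr (_ * (_ * _`!)); lia|lia].
by rewrite Euclid_dvdM // (Euclid_dvdM m`! (m.+1)`!) // => /or3P[//|h|h]; have := prime_dvd_fact pp h; lia.
Qed.

Local Open Scope ring_scope.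

Section Analytic.
Variable R : realType.
Implicit Types (f : nat -> R) (x n : nat).

Lemma ln_nat_ge0 n : 0 <= ln (n%:R : R).
Proof.
case: n => [|n]; first by rewrite ln0.
by rewrite ln_ge0 // ler1n.
Qed.

Lemma lnM_nat m n : (0 < m)%N -> (0 < n)%N -> ln ((m * n)%:R : R) = ln m%:R + ln n%:R.
Proof. by move=> m0 n0; rewrite natrM lnM // posrE ltr0n. Qed.

Lemma le_ln_nat m n : (0 < m)%N -> (m <= n)%N -> ln (m%:R : R) <= ln n%:R.
Proof. by move=> m0 mn; rewrite ler_ln ?posrE ?ltr0n ?ler_nat //; lia. Qed.

Lemma ln_le_sub1 (y : R) : 0 < y -> ln y <= y - 1.
Proof. by move=> y0; rewrite -{1}(subrK 1 y) addrC le_ln1Dx //; lra. Qed.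

Lemma ln_prod (s : seq nat) (P : pred nat) : all (fun p => 0 < p)%N s ->
  ln ((\prod_(p <- s | P p) p)%:R : R) = \sum_(p <- s | P p) ln p%:R.
Proof.
elim: s => [|p s IH] /=; first by rewrite !big_nil ln1.
move=> /andP[p0 sp]; rewrite !big_cons; case: ifP => _; last exact: IH.
rewrite lnM_nat ?IH //; elim: s sp {IH} => [|q s IH] /=; first by rewrite big_nil.
by move=> /andP[q0 sp]; rewrite big_cons; case: ifP => _; rewrite ?muln_gt0 ?q0 IH.
Qed.

Lemma chebyshev_theta n : \sum_(1 <= p < n.+1 | prime p) ln (p%:R : R) <= 3 * n%:R.
Proof.
rewrite -ln_prod; last by apply/allP => p; rewrite mem_index_iota => /andP[].
have h := primorial_le n.
have p0 : (0 < \prod_(1 <= p < n.+1 | prime p) p)%N.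
  by rewrite big_seq_cond; apply: prodn_cond_gt0 => p /andP[_ /prime_gt0].
apply: le_trans (le_ln_nat p0 h) _; rewrite natrX lnXn ?ltr0n // -[_ *+ n]mulr_natr ler_wpM2r //.
by apply: le_trans (ln_le_sub1 _) _; rewrite ?ltr0n //; lra.
Qed.

Lemma natr_div_le x d : (x %/ d)%N%:R <= x%:R / d%:R :> R.
Proof.
case: d => [|d]; first by rewrite divn0 invr0 mulr0.
by rewrite ler_pdivlMr ?ltr0n // -natrM ler_nat leq_trunc_div.
Qed.

(** Both sides run over the pairs with [d * m <= x]. *)
Lemma hyperbola_exchange (G : nat -> nat -> R) x :
  \sum_(1 <= d < x.+1) \sum_(1 <= m < (x %/ d).+1) G d m =
  \sum_(1 <= m < x.+1) \sum_(1 <= d < (x %/ m).+1) G d m.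
Proof.
have H (F : nat -> nat -> R) : \sum_(1 <= d < x.+1) \sum_(1 <= m < (x %/ d).+1) F d m =
    \sum_(1 <= d < x.+1) \sum_(1 <= m < x.+1 | (d * m <= x)%N) F d m.
  apply: eq_big_nat => d /andP[d0 dx].
  rewrite [RHS]big_mkcond (big_cat_nat (n := (x %/ d).+1)) //=; last by rewrite ltnS leq_div.
  rewrite [X in _ + X](_ : _ = 0) ?addr0; last first.
    rewrite big_nat big1 // => m /andP[m1 m2]; case: ifP => // h.
    by move: m1; rewrite ltnNge leq_divRL // mulnC h.
  apply: eq_big_nat => m /andP[m0 m1]; case: ifP => // /negP[].
  by move: m1; rewrite ltnS leq_divRL // mulnC.
rewrite !H (exchange_big_dep xpredT) //=; apply: eq_bigr => m _; apply: eq_bigl => d.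
by rewrite mulnC.
Qed.

Lemma ln_sqf n : sqf n -> ln (n%:R : R) = \sum_(p <- divisors n | prime p) ln p%:R.
Proof.
move=> s; have n0 := sqf_gt0 s; rewrite {1}(sqf_prod s) ln_prod; last first.
  by apply/allP => p; rewrite mem_primes => /and3P[/prime_gt0].
rewrite -[RHS]big_filter; apply: perm_big; apply: uniq_perm; rewrite ?primes_uniq //.
  by rewrite filter_uniq ?divisors_uniq.
by move=> p; rewrite mem_filter -dvdn_divisors // mem_primes n0.
Qed.

(* Split [ln x <= ln n + x / n] and [ln n] into the [ln p] with [p %| n], then apply Chebyshev. *)
Lemma mean_value_bound f x : (0 < x)%N -> (forall n, 0 <= f n) -> (forall n, ~~ sqf n -> f n = 0) ->
  (forall p m, prime p -> (0 < m)%N -> f (p * m)%N <= f m) ->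
  ln x%:R * \sum_(1 <= n < x.+1) f n <= 4 * x%:R * \sum_(1 <= n < x.+1) f n / n%:R.
Proof.
move=> x0 f0 fs fp.
have H1 : \sum_(1 <= n < x.+1) f n * ln n%:R <= 3 * x%:R * \sum_(1 <= n < x.+1) f n / n%:R.
  pose F d m := if prime d then ln d%:R * f (d * m)%N else 0 : R.
  apply: (@le_trans _ _ (\sum_(1 <= n < x.+1) \sum_(d <- divisors n) F d (n %/ d)%N)).
    rewrite big_nat [leRHS]big_nat; apply: ler_sum => n /andP[n0 nx].
    case: (boolP (sqf n)) => [s|/fs ->]; last first.
      by rewrite mul0r sumr_ge0 // => d _; rewrite /F; case: ifP => // _; rewrite mulr_ge0 // ln_nat_ge0.
    rewrite ln_sqf // mulr_sumr big_mkcond /=.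
    rewrite big_seq [leRHS]big_seq; apply: ler_sum => d; rewrite -dvdn_divisors // => dn.
    by rewrite /F; case: ifP => // _; rewrite mulnC divnK // mulrC.
  rewrite sum_divisors_pairs hyperbola_exchange mulr_sumr big_nat [leRHS]big_nat.
  apply: ler_sum => m /andP[m0 mx].
  apply: (@le_trans _ _ (f m * \sum_(1 <= p < (x %/ m).+1 | prime p) ln p%:R)).
    rewrite mulr_sumr [leRHS]big_mkcond; apply: ler_sum => p _.
    by rewrite /F; case: ifP => // pp; rewrite mulrC ler_wpM2r ?ln_nat_ge0 // fp.
  rewrite mulrA [_ * f m]mulrC -mulrA ler_wpM2l // -mulrA.
  apply: le_trans (chebyshev_theta _) _; rewrite ler_wpM2l //; exact: natr_div_le.
rewrite [leLHS]mulr_sumr; apply: (@le_trans _ _ (\sum_(1 <= n < x.+1) (f n * ln n%:R + x%:R * (f n / n%:R)))).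
  rewrite big_nat [leRHS]big_nat; apply: ler_sum => n /andP[n0 nx].
  rewrite mulrC mulrCA -mulrDr ler_wpM2l // -lerBlDl.
  have n0' : 0 < n%:R :> R by rewrite ltr0n.
  have x0' : 0 < x%:R :> R by rewrite ltr0n.
  rewrite -ln_div ?posrE //; apply: le_trans (ln_le_sub1 _) _; first exact: divr_gt0.
  by rewrite lerBlDr lerDl.
by rewrite big_split /= -mulr_sumr; lra.
Qed.
End Analytic.

(** * Density of integers whose primes satisfy a quadratic condition *)

Local Open Scope nat_scope.

Definition sqf_all (Q : pred nat) n := sqf n && all Q (primes n).

Lemma sqf_all_dvd Q d n : (d %| n) -> sqf_all Q n -> sqf_all Q d.
Proof.
move=> dn /andP[s /allP a]; rewrite /sqf_all (sqf_dvd dn s) /=; apply/allP => p.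
rewrite mem_primes => /and3P[pp d0 pd]; apply: a.
by rewrite mem_primes pp (sqf_gt0 s) (dvdn_trans pd).
Qed.

Lemma sqf_all_coprimeM Q a b : coprime a b -> sqf_all Q a -> sqf_all Q b -> sqf_all Q (a * b).
Proof.
move=> c /andP[sa ha] /andP[sb hb]; rewrite /sqf_all sqf_coprimeM //=.
by rewrite (perm_all _ (perm_primesM (sqf_gt0 sa) (sqf_gt0 sb) c)) all_cat ha hb.
Qed.

Lemma oddsqE n : oddsq n = sqf_all odd n.
Proof.
rewrite /oddsq /sqf_all andbC; case s: (sqf n) => //=; apply/idP/allP.
  by move=> o p; rewrite mem_primes => /and3P[_ _ /dvdn_odd]; apply.
move=> h; apply/negPn/negP => ev; have : 2 \in primes n by rewrite mem_primes /= (sqf_gt0 s) dvdn2.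
by move/h.
Qed.

Local Open Scope ring_scope.

Section Density.
Variable R : realType.
Implicit Types (f : nat -> R) (x n : nat).

Definition harm x : R := \sum_(1 <= n < x.+1) n%:R^-1.

Lemma harm_ge0 x : 0 <= harm x.
Proof. by apply: sumr_ge0 => n _; rewrite invr_ge0. Qed.

Lemma le_harm x y : (x <= y)%N -> harm x <= harm y.
Proof.
move=> xy; rewrite /harm [leRHS](big_cat_nat (n := x.+1)) //= lerDl.
by apply: sumr_ge0 => n _; rewrite invr_ge0.
Qed.

Lemma harm_le_ln x : (0 < x)%N -> harm x <= 1 + ln x%:R.
Proof.
case: x => // x _; elim: x => [|x IH]; first by rewrite /harm big_nat1 ln1 invr1 addr0.
rewrite /harm big_nat_recr //= -/(harm x.+1); have h : ln x.+1%:R <= ln x.+2%:R - x.+2%:R^-1 :> R.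
  have a0 : 0 < x.+1%:R :> R by rewrite ltr0n.
  have b0 : 0 < x.+2%:R :> R by rewrite ltr0n.
  have := ln_le_sub1 (divr_gt0 a0 b0); rewrite ln_div ?posrE //.
  have -> : x.+1%:R / x.+2%:R - 1 = - x.+2%:R^-1 :> R.
    have e : x.+1%:R = x.+2%:R - 1 :> R by rewrite -[x.+2]addn1 natrD addrK.
    by rewrite e mulrBl mulfV ?lt0r_neq0 -?e // mul1r addrAC subrr add0r.
  by rewrite lerBlDr [- _ + _]addrC.
by move: h IH; set h0 := harm _; set u := ln x.+2%:R; set v := ln x.+1%:R; set w := x.+2%:R^-1; lra.
Qed.

Lemma ge1_harm x : (0 < x)%N -> 1 <= harm x.
Proof. by move=> x0; apply: le_trans (le_harm x0); rewrite /harm big_nat1 invr1. Qed.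

Lemma sum_ge_term (F : nat -> R) m n k : (forall i, 0 <= F i) -> (m <= k < n)%N ->
  F k <= \sum_(m <= i < n) F i.
Proof.
move=> F0 hk; rewrite (bigD1_seq k) ?mem_index_iota ?iota_uniq //= lerDl.
by apply: sumr_ge0.
Qed.

Lemma sum_inv_sqr_le x : \sum_(1 <= g < x.+1) (g%:R ^- 2) <= 2 :> R.
Proof.
suff H : \sum_(1 <= g < x.+2) (g%:R ^- 2) <= 2 - x.+1%:R^-1 :> R.
  case: x => [|x] in H *; first by rewrite big_geq.
  apply: le_trans (_ : \sum_(1 <= g < x.+3) (g%:R ^- 2) <= _).
    by rewrite [leRHS]big_nat_recr //= lerDl invr_ge0 exprn_ge0.
  by apply: le_trans H _; rewrite gerBl invr_ge0.
elim: x => [|x IH]; first by rewrite big_nat1; lra.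
rewrite big_nat_recr //=; apply: le_trans (lerD IH (lexx _)) _.
have a0 : 0 < x.+1%:R :> R by rewrite ltr0n.
have b0 : 0 < x.+2%:R :> R by rewrite ltr0n.
have e : x.+2%:R = x.+1%:R + 1 :> R by rewrite -[x.+2]addn1 natrD.
have : x.+1%:R^-1 - x.+2%:R^-1 = x.+1%:R^-1 * x.+2%:R^-1 :> R.
  by rewrite e; field; rewrite -?e; lra.
have : x.+2%:R ^- 2 <= x.+1%:R^-1 * x.+2%:R^-1 :> R.
  by rewrite -exprVn expr2 ler_wpM2r ?invr_ge0 // lef_pV2 ?posrE // e lerDl.
by set C := _ ^- 2; set A := x.+1%:R^-1; set B := x.+2%:R^-1; lra.
Qed.

(** These axioms are shared by the indicator of a set defined by primes and by that indicator
    divided by [tau], the two weights to which the squaring argument is applied. *)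
Record sieve_weight f : Prop := SieveWeight {
  sw_ge0 : forall n, 0 <= f n;
  sw_supp : forall n, ~~ sqf n -> f n = 0;
  sw_dvd : forall d n, (0 < n)%N -> (d %| n)%N -> f n <= f d;
  sw_coprime : forall a b, (0 < a)%N -> (0 < b)%N -> coprime a b -> f a * f b <= f (a * b)%N }.

(* Write [m1 = g a] and [m2 = g b] with [g] the gcd. *)
Lemma sieve_weight_sqr f x : sieve_weight f ->
  (\sum_(1 <= n < x.+1) f n / n%:R) ^+ 2 <=
  2 * \sum_(1 <= n < (x ^ 2).+1) (tau n)%:R * f n / n%:R.
Proof.
move=> [f0 fs fd fc].
pose Phi a b : R := if coprime a b then f a * f b / (a * b)%:R else 0.
have Phi0 a b : 0 <= Phi a b by rewrite /Phi; case: ifP => // _; rewrite divr_ge0 ?mulr_ge0.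
(* [Phi] vanishes unless its arguments are coprime, so in the sum over [g] only the gcd of [m1] and
   [m2] contributes. *)
pose T g m1 m2 : R := if (g %| m1)%N then if (g %| m2)%N then g%:R ^- 2 * Phi (m1 %/ g)%N (m2 %/ g)%N else 0 else 0.
have T0 g m1 m2 : 0 <= T g m1 m2.
  by rewrite /T; do 2?case: ifP => // _; rewrite mulr_ge0 ?invr_ge0 ?exprn_ge0.
rewrite expr2 big_distrlr /=.
apply: (@le_trans _ _ (\sum_(1 <= m1 < x.+1) \sum_(1 <= m2 < x.+1) \sum_(1 <= g < x.+1) T g m1 m2)).
  rewrite big_nat [leRHS]big_nat; apply: ler_sum => m1 /andP[m10 m1x].
  rewrite big_nat [leRHS]big_nat; apply: ler_sum => m2 /andP[m20 m2x].
  pose g := gcdn m1 m2; have g0 : (0 < g)%N by rewrite gcdn_gt0 m10.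
  have g1 : (g %| m1)%N by apply: dvdn_gcdl.
  have g2 : (g %| m2)%N by apply: dvdn_gcdr.
  apply: le_trans (sum_ge_term (F := fun g => T g m1 m2) (k := g) _ _) => //; last first.
    by rewrite g0 ltnS (leq_trans (dvdn_leq m10 g1)).
  have a0 : (0 < m1 %/ g)%N by rewrite divn_gt0 // dvdn_leq.
  have b0 : (0 < m2 %/ g)%N by rewrite divn_gt0 // dvdn_leq.
  have cop : coprime (m1 %/ g) (m2 %/ g).
    by rewrite /coprime -(eqn_pmul2r g0) muln_gcdl !divnK // mul1n.
  rewrite /T g1 g2 /Phi cop.
  rewrite mulrACA -invfM -natrM.
  have -> : (m1 * m2)%N%:R = g%:R ^+ 2 * ((m1 %/ g) * (m2 %/ g))%N%:R :> R.
    by rewrite -natrX -natrM -{1}(divnK g1) -{1}(divnK g2); congr (_%:R); rewrite -mulnn; lia.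
  rewrite invfM mulrCA ler_wpM2l ?invr_ge0 ?exprn_ge0 // ler_wpM2r ?invr_ge0 //.
  by apply: ler_pM => //; apply: fd => //; apply: dvdn_div.
have -> : \sum_(1 <= m1 < x.+1) \sum_(1 <= m2 < x.+1) \sum_(1 <= g < x.+1) T g m1 m2 =
   \sum_(1 <= g < x.+1) \sum_(1 <= m1 < x.+1) \sum_(1 <= m2 < x.+1) T g m1 m2.
  rewrite [RHS]exchange_big; apply: eq_bigr => m1 _; exact: exchange_big.
have -> : \sum_(1 <= g < x.+1) \sum_(1 <= m1 < x.+1) \sum_(1 <= m2 < x.+1) T g m1 m2 =
   \sum_(1 <= g < x.+1) g%:R ^- 2 * \sum_(1 <= a < (x %/ g).+1) \sum_(1 <= b < (x %/ g).+1) Phi a b.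
  apply: eq_big_nat => g /andP[g0 gx]; rewrite mulr_sumr.
  rewrite -(sum_multiples (fun a => g%:R ^- 2 * \sum_(1 <= b < (x %/ g).+1) Phi a b)) // [RHS]big_mkcond /=.
  apply: eq_bigr => m1 _; rewrite /T; case: ifP => _; last by rewrite big1.
  by rewrite mulr_sumr -(sum_multiples (fun b => g%:R ^- 2 * Phi (m1 %/ g)%N b)) // [RHS]big_mkcond.
(* The ranges of [a] and [b] are enlarged from [x %/ g] to [x], so that the sum over [g] splits off
   and costs at most 2. *)
apply: (@le_trans _ _ (\sum_(1 <= g < x.+1) g%:R ^- 2 * \sum_(1 <= a < x.+1) \sum_(1 <= b < x.+1) Phi a b)).
  apply: ler_sum => g _; rewrite ler_wpM2l ?invr_ge0 ?exprn_ge0 //.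
  rewrite [leRHS](big_cat_nat (n := (x %/ g).+1)) //=; last by rewrite ltnS leq_div.
  apply: ler_wpDr; first by apply: sumr_ge0 => a _; apply: sumr_ge0.
  apply: ler_sum => a _; rewrite [leRHS](big_cat_nat (n := (x %/ g).+1)) //=; last by rewrite ltnS leq_div.
  by apply: ler_wpDr => //; apply: sumr_ge0.
rewrite -mulr_suml; apply: ler_pM.
- by apply: sumr_ge0 => g _; rewrite invr_ge0 exprn_ge0.
- by apply: sumr_ge0 => a _; apply: sumr_ge0.
- exact: sum_inv_sqr_le.
pose F n : R := f n / n%:R.
have F0 n : 0 <= F n by rewrite divr_ge0.
(* [tau n] counts the factorisations [n = a * b]; all pairs with [a, b <= x] are among them, since
   then [a * b <= x ^ 2]. *)
have -> : \sum_(1 <= n < (x ^ 2).+1) (tau n)%:R * f n / n%:R =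
  \sum_(1 <= n < (x ^ 2).+1) \sum_(d <- divisors n) F (d * (n %/ d))%N.
  apply: eq_big_nat => n /andP[n0 _]; rewrite (eq_big_seq (fun=> F n)); last first.
    by move=> d; rewrite -dvdn_divisors // mulnC => dn; rewrite divnK.
  by rewrite big_const_seq count_predT iter_addr_0 -mulrA mulr_natl.
rewrite (sum_divisors_pairs (fun d m => F (d * m)%N)).
case: (posnP x) => [->|x0]; first by rewrite !big_geq.
have xx : (x <= x ^ 2)%N by rewrite -mulnn leq_pmulr.
rewrite [leRHS](big_cat_nat (n := x.+1)) //=; apply: ler_wpDr.
  by apply: sumr_ge0 => a _; apply: sumr_ge0.
rewrite big_nat [leRHS]big_nat; apply: ler_sum => a /andP[a0 ax].
have xa : (x <= x ^ 2 %/ a)%N by rewrite leq_divRL // -mulnn leq_mul2l -ltnS ax orbT.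
rewrite [leRHS](big_cat_nat (n := x.+1)) //=; apply: ler_wpDr; first by apply: sumr_ge0.
rewrite big_nat [leRHS]big_nat; apply: ler_sum => b /andP[b0 bx].
rewrite /Phi; case: ifP => // cab; rewrite /F ler_wpM2r ?invr_ge0 //; exact: fc.
Qed.

(** Turns a bound for a logarithmic sum, weighted by [tau], into one for the plain count, with a
    gain of [ln x] from [mean_value_bound]. *)
Lemma sieve_weight_mean f x : (0 < x)%N -> sieve_weight f ->
  (ln x%:R * \sum_(1 <= n < x.+1) f n) ^+ 2 <=
  32 * x%:R ^+ 2 * \sum_(1 <= n < (x ^ 2).+1) (tau n)%:R * f n / n%:R.
Proof.
move=> x0 sf; have [f0 fs fd fc] := sf.
have h1 := sieve_weight_sqr x sf.
have h2 : ln x%:R * \sum_(1 <= n < x.+1) f n <= 4 * x%:R * \sum_(1 <= n < x.+1) f n / n%:R.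
  apply: mean_value_bound => // p m pp m0; apply: fd; last exact: dvdn_mull.
  by rewrite muln_gt0 m0 prime_gt0.
apply: (@le_trans _ _ ((4 * x%:R * \sum_(1 <= n < x.+1) f n / n%:R) ^+ 2)).
  rewrite ler_sqr // nnegrE ?mulr_ge0 ?ln_nat_ge0 //; first exact: sumr_ge0.
  by apply: sumr_ge0 => n _; rewrite divr_ge0.
rewrite exprMn; apply: le_trans (ler_wpM2l _ h1) _; first by rewrite exprn_ge0 // mulr_ge0.
by rewrite le_eqVlt; apply/orP; left; apply/eqP; ring.
Qed.

Lemma sieve_weight_ind Q : sieve_weight (fun n => (sqf_all Q n)%:R).
Proof.
split=> [n|n|d n n0 dn|a b a0 b0 c].
- exact: ler0n.
- by rewrite /sqf_all => /negPf ->.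
- by rewrite ler_nat; case: (boolP (sqf_all Q n)) => // /(sqf_all_dvd dn) ->.
rewrite -natrM ler_nat; case: (boolP (sqf_all Q a)) => // ha; case: (boolP (sqf_all Q b)) => // hb.
by rewrite sqf_all_coprimeM.
Qed.

Lemma sieve_weight_tau Q : sieve_weight (fun n => (sqf_all Q n)%:R / (tau n)%:R).
Proof.
have [h0 hs hd hc] := sieve_weight_ind Q.
split=> [n|n|d n n0 dn|a b a0 b0 c].
- by rewrite divr_ge0.
- by move=> /hs ->; rewrite mul0r.
- have d0 := dvdn_gt0 n0 dn; apply: ler_pM; rewrite ?invr_ge0 ?hd //.
  by rewrite lef_pV2 ?posrE ?ltr0n ?tau_gt0 // ler_nat tau_dvd.
by rewrite tauM // mulrACA natrM invfM ler_wpM2r ?hc // mulr_ge0 ?invr_ge0.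
Qed.

(** Summation by parts; the induction runs on a stronger claim that keeps the current partial sum of
    [a] in the bound. *)
Lemma abel_sum_le (a c : nat -> R) m n B : 0 <= B ->
  (forall k, \sum_(m <= i < k) a i <= B) ->
  (forall i, (m <= i)%N -> c i.+1 <= c i) -> (forall i, 0 <= c i) ->
  \sum_(m <= i < n) a i * c i <= B * c m.
Proof.
move=> B0 aB cd c0; case: (leqP n m) => [nm|mn]; first by rewrite big_geq // mulr_ge0.
rewrite -(subnK mn); elim: (n - m.+1)%N => [|k IH].
  by rewrite add0n big_nat1; have := aB m.+1; rewrite big_nat1 => h; rewrite ler_wpM2r.
suff H j : \sum_(m <= i < j + m.+1) a i * c i <=
     (\sum_(m <= i < j + m.+1) a i) * c (j + m)%N + B * (c m - c (j + m)%N).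
  apply: le_trans (H _) _; have := ler_wpM2r (c0 (k.+1 + m)%N) (aB (k.+1 + m.+1)%N); lra.
elim: j {IH} => [|j IH]; first by rewrite !add0n !big_nat1 subrr mulr0 addr0.
rewrite addSn big_nat_recr ?leq_addl 1?leqW //=; last by rewrite addnS ltnW // ltnS leq_addl.
rewrite [X in _ <= X * _ + _]big_nat_recr /=; last by rewrite addnS ltnW // ltnS leq_addl.
rewrite addnS -addSn; set A := \sum_(m <= i < j.+1 + m) a i.
have hA : A <= B by exact: aB.
have hc : c (j.+1 + m)%N <= c (j + m)%N by rewrite addSn cd // leq_addl.
move: IH; rewrite addnS -addSn -/A => IH.
have : 0 <= (B - A) * (c (j + m)%N - c (j.+1 + m)%N) by rewrite mulr_ge0 // subr_ge0.
move: IH; set S := \sum_(_ <= _ < _) _; lra.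
Qed.

Lemma rchar_norm q f n : rchar q f -> `|f n| <= 1.
Proof. by move=> [_ _ _ fv _ _]; case: (fv n) => ->; rewrite ?normr0 ?normrN ?normr1 ?ler01. Qed.

(** At a prime power the local sum is geometric with ratio 0, 1 or -1; in the last case it
    alternates between 1 and 0. *)
Lemma rchar_divisors_ge0 q f n : rchar q f -> (0 < n)%N -> 0 <= \sum_(d <- divisors n) f d.
Proof.
move=> [q0 f1 fM fv _ _] n0; apply: sum_divisors_ge0 => // p k pp _.
have fX i : f (p ^ i)%N = f p ^+ i by elim: i => [|i IH]; rewrite ?f1 // expnS fM exprS IH.
under eq_bigr do rewrite fX.
case: (fv p) => ->; try by apply: sumr_ge0 => i _; rewrite exprn_ge0.
suff -> : \sum_(i < k.+1) (-1 : R) ^+ i = (~~ odd k)%:R by rewrite ler0n.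
elim: k => [|k IH]; first by rewrite big_ord1.
by rewrite big_ord_recr /= IH exprS -signr_odd; case: (odd k) => /=; rewrite ?expr1 ?expr0 ?mulrNN ?mulr1 ?add0r ?subrr.
Qed.

(** Interchanging the sums gives [f d] against the decreasing [harm (x %/ d) / d]. The terms
    [d <= q] are bounded trivially; beyond [q], partial summation with the period bound [q] leaves
    at most [harm x]. *)
Lemma rchar_mean q f x : rchar q f ->
  \sum_(1 <= n < x.+1) (\sum_(d <- divisors n) f d) / n%:R <= (harm q + 1) * harm x.
Proof.
move=> cf; have [q0 f1 fM fv fm fs] := cf.
pose c d : R := harm (x %/ d) / d%:R.
have c0 d : 0 <= c d by rewrite divr_ge0 ?harm_ge0.
have -> : \sum_(1 <= n < x.+1) (\sum_(d <- divisors n) f d) / n%:R = \sum_(1 <= d < x.+1) f d * c d.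
  transitivity (\sum_(1 <= n < x.+1) \sum_(d <- divisors n) f d * (d%:R^-1 * (n %/ d)%N%:R^-1)).
    apply: eq_big_nat => n /andP[n0 _]; rewrite mulr_suml; apply: eq_big_seq => d.
    by rewrite -dvdn_divisors // => dn; rewrite -invfM -natrM mulnC divnK.
  rewrite (sum_divisors_pairs (fun d m => f d * (d%:R^-1 * m%:R^-1))).
  apply: eq_bigr => d _; rewrite -mulr_sumr -mulr_sumr /c /harm; congr (_ * _).
  by rewrite mulrC.
have small n : (n <= x)%N -> \sum_(1 <= d < n.+1) f d * c d <= harm n * harm x.
  move=> nx; rewrite [harm n]/harm mulr_suml big_nat [leRHS]big_nat; apply: ler_sum => d /andP[d0 dn].
  apply: le_trans (ler_norm _) _; rewrite normrM (ger0_norm (c0 d)) /c [leRHS]mulrC -[leRHS]mul1r.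
  apply: ler_pM => //; [exact: (c0 d) | exact: (rchar_norm d cf) |].
  by rewrite ler_wpM2r ?invr_ge0 // le_harm // leq_div.
have hx := harm_ge0 x.
case: (leqP x q) => xq.
  apply: le_trans (small x (leqnn x)) _; rewrite ler_wpM2r //.
  by apply: le_trans (le_harm xq) _; rewrite lerDl.
rewrite (big_cat_nat (n := q.+1)) //=; last by rewrite ltnS ltnW.
rewrite mulrDl mul1r; apply: lerD; first by apply: small; exact: ltnW.
apply: (@le_trans _ _ (q%:R * c q.+1)).
  apply: abel_sum_le => // [k|i qi].
    by apply: le_trans (ler_norm _) _; apply: periodic_sum_le => // n; exact: (rchar_norm n cf).
  have i0 : (0 < i)%N by exact: leq_trans qi.
  apply: ler_pM; rewrite ?harm_ge0 ?invr_ge0 ?le_harm ?leq_div2l //.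
  by rewrite lef_pV2 ?posrE ?ltr0n // ler_nat.
rewrite /c mulrCA -[leRHS]mulr1; apply: ler_pM; rewrite ?harm_ge0 ?le_harm ?leq_div ?divr_ge0 //.
by rewrite ler_pdivrMr ?ltr0n // mul1r ler_nat.
Qed.

(** On the set all divisors have [f d = 1], so [tau n] is the divisor sum of [f]; off the set that
    divisor sum is nonnegative and may be added. *)
Lemma rchar_sieve_sum q f (Q : pred nat) x : rchar q f -> (forall p, prime p -> Q p -> f p = 1) ->
  \sum_(1 <= n < x.+1) (tau n)%:R * (sqf_all Q n)%:R / n%:R <= (harm q + 1) * harm x.
Proof.
move=> cf fQ; apply: le_trans (rchar_mean x cf).
rewrite big_nat [leRHS]big_nat; apply: ler_sum => n /andP[n0 _].
rewrite ler_wpM2r ?invr_ge0 //; case: (boolP (sqf_all Q n)) => hn; last first.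
  by rewrite mulr0 (rchar_divisors_ge0 cf).
have [_ f1 fM _ _ _] := cf.
rewrite mulr1 (eq_big_seq (fun=> 1)) ?big_const_seq ?count_predT ?iter_addr_0 // => d.
rewrite -dvdn_divisors // => dn; have /andP[sd /allP ad] := sqf_all_dvd dn hn.
rewrite (sqf_prod sd).
have : {in primes d, forall p, f p = 1}.
  by move=> p pd; apply: fQ; [move: pd; rewrite mem_primes => /andP[]|exact: ad].
elim: (primes d) => [|p s IH] h; first by rewrite big_nil.
by rewrite big_cons fM h ?mem_head // mul1r IH // => r rs; apply: h; rewrite in_cons rs orbT.
Qed.

Lemma harm_pow_le x k : (2 <= x)%N -> (0 < k)%N -> harm (x ^ k) <= 4 * k%:R * ln x%:R.
Proof.
move=> x2 k0; have x0 : (0 < x)%N by exact: ltnW.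
apply: le_trans (harm_le_ln _) _; first by rewrite expn_gt0 x0.
rewrite natrX lnXn ?ltr0n // -[_ *+ k]mulr_natl.
have h2 : 1 / 2 <= ln (2 : R).
  have : ln (2^-1 : R) <= 2^-1 - 1 by apply: ln_le_sub1; rewrite invr_gt0.
  by rewrite lnV ?posrE //; lra.
have hx : 1 / 2 <= ln (x%:R : R) by apply: le_trans h2 _; exact: (@le_ln_nat R 2 x).
have k1 : 1 <= k%:R :> R by rewrite ler1n.
have : 1 * (1 / 2) <= k%:R * ln (x%:R : R) by apply: ler_pM => //; lra.
move=> h; rewrite -mulrA; move: h; set c := k%:R * ln x%:R; lra.
Qed.

(* Squaring the sum of [1 / n] over this set costs a factor [tau n] (by [sieve_weight_sqr]), and
   on the set [tau n] is the divisor sum of [f], whose mean is bounded by cancellation over a period. *)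
Lemma density_rchar q f (Q : pred nat) x : (2 <= x)%N -> rchar q f -> (forall p, prime p -> Q p -> f p = 1) ->
  ln x%:R * (\sum_(1 <= n < x.+1) (sqf_all Q n)%:R) ^+ 2 <= 256 * x%:R ^+ 2 * (harm q + 1).
Proof.
move=> x2 cf fQ; have x0 : (0 < x)%N by exact: ltnW.
have l0 : 0 < ln (x%:R : R) by rewrite ln_gt0 // ltr1n.
rewrite -(ler_pM2l l0) mulrA -expr2 -exprMn.
apply: le_trans (sieve_weight_mean x0 (sieve_weight_ind Q)) _.
apply: le_trans (ler_wpM2l _ (rchar_sieve_sum (x ^ 2) cf fQ)) _; first by rewrite mulr_ge0 ?exprn_ge0.
apply: le_trans (ler_wpM2l _ (ler_wpM2l _ (harm_pow_le x2 _))) _; rewrite ?mulr_ge0 ?exprn_ge0 ?addr_ge0 ?harm_ge0 //.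
by rewrite le_eqVlt; apply/orP; left; apply/eqP; ring.
Qed.

(** Squaring produces a factor [tau n] that cancels the weight, and a plain harmonic sum of order
    [ln x] remains. *)
Lemma density_tau Q x : (2 <= x)%N ->
  ln x%:R * (\sum_(1 <= n < x.+1) (sqf_all Q n)%:R / (tau n)%:R) ^+ 2 <= 256 * x%:R ^+ 2 :> R.
Proof.
move=> x2; have x0 : (0 < x)%N by exact: ltnW.
have l0 : 0 < ln (x%:R : R) by rewrite ln_gt0 // ltr1n.
rewrite -(ler_pM2l l0) mulrA -expr2 -exprMn.
apply: le_trans (sieve_weight_mean x0 (sieve_weight_tau Q)) _.
apply: (@le_trans _ _ (32 * x%:R ^+ 2 * harm (x ^ 2))).
  rewrite ler_wpM2l ?mulr_ge0 ?exprn_ge0 // big_nat [leRHS]big_nat; apply: ler_sum => n /andP[n0 _].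
  rewrite -[leRHS]mul1r ler_wpM2r ?invr_ge0 // mulrCA mulfV ?mulr1 ?lern1 ?leq_b1 //.
  by rewrite pnatr_eq0 -lt0n tau_gt0.
apply: le_trans (ler_wpM2l _ (harm_pow_le x2 _)) _; rewrite ?mulr_ge0 ?exprn_ge0 //.
by rewrite le_eqVlt; apply/orP; left; apply/eqP; ring.
Qed.

(** The first squaring removes the weight [1 / tau n]; the second creates a factor [tau n], which
    the character controls. The fourth power of the logarithmic sum is thus of order [ln x], which
    leaves [ln x ^ 3] as the gain. *)
Lemma density_rchar_tau q f (Q : pred nat) x : (2 <= x)%N -> rchar q f -> (forall p, prime p -> Q p -> f p = 1) ->
  ln x%:R ^+ 3 * (\sum_(1 <= n < x.+1) (sqf_all Q n)%:R / (tau n)%:R) ^+ 4 <=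
  32 ^+ 3 * x%:R ^+ 4 * (harm q + 1).
Proof.
move=> x2 cf fQ; have x0 : (0 < x)%N by exact: ltnW.
have l0 : 0 < ln (x%:R : R) by rewrite ln_gt0 // ltr1n.
set A := \sum_(1 <= n < x.+1) _.
pose S : R := \sum_(1 <= n < (x ^ 2).+1) (sqf_all Q n)%:R / n%:R.
have h1 : (ln x%:R * A) ^+ 2 <= 32 * x%:R ^+ 2 * S.
  apply: le_trans (sieve_weight_mean x0 (sieve_weight_tau Q)) _.
  rewrite ler_wpM2l ?mulr_ge0 ?exprn_ge0 // big_nat [leRHS]big_nat; apply: ler_sum => n /andP[n0 _].
  by rewrite mulrCA mulfV ?mulr1 // pnatr_eq0 -lt0n tau_gt0.
have h2 : S ^+ 2 <= 2 * ((harm q + 1) * harm ((x ^ 2) ^ 2)).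
  apply: le_trans (sieve_weight_sqr _ (sieve_weight_ind Q)) _.
  by rewrite ler_wpM2l // (rchar_sieve_sum _ cf fQ).
have h3 : harm ((x ^ 2) ^ 2) <= 16 * ln x%:R.
  by rewrite -expnM; apply: le_trans (harm_pow_le x2 _) _ => //; rewrite -natrM.
rewrite -(ler_pM2l l0) mulrA -exprS -exprMn -[4%N]/(2 * 2)%N exprM.
apply: (@le_trans _ _ ((32 * x%:R ^+ 2 * S) ^+ 2)).
  rewrite ler_sqr // nnegrE ?sqr_ge0 // mulr_ge0 ?mulr_ge0 ?exprn_ge0 //.
  by apply: sumr_ge0 => n _; rewrite divr_ge0.
rewrite exprMn; apply: le_trans (ler_wpM2l _ h2) _; first by rewrite exprn_ge0 ?mulr_ge0 ?exprn_ge0.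
apply: le_trans (ler_wpM2l _ (ler_wpM2l _ (ler_wpM2l _ h3))) _; rewrite ?exprn_ge0 ?mulr_ge0 ?exprn_ge0 ?addr_ge0 ?harm_ge0 //.
by rewrite le_eqVlt; apply/orP; left; apply/eqP; rewrite exprM; ring.
Qed.

End Density.

(** * A bilinear bound for Jacobi symbols *)

Local Open Scope nat_scope.

(** Every divisor of [a * b] is the product of its gcd with [a] and a divisor of [b]. *)
Lemma tauM_le a b : 0 < a -> 0 < b -> tau (a * b) <= tau a * tau b.
Proof.
move=> a0 b0; rewrite /tau -(size_allpairs muln); apply: uniq_leq_size; first exact: divisors_uniq.
move=> d; rewrite -dvdn_divisors ?muln_gt0 ?a0 // => dab.
have d0 : 0 < d by rewrite (dvdn_gt0 _ dab) // muln_gt0 a0.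
have g0 : 0 < gcdn d a by rewrite gcdn_gt0 d0.
apply/allpairsP; exists (gcdn d a, d %/ gcdn d a) => /=.
rewrite -!dvdn_divisors // dvdn_gcdr mulnC divnK ?dvdn_gcdl //; split=> //.
rewrite -(@Gauss_dvdr _ (a %/ gcdn d a)).
  by rewrite -(@dvdn_pmul2r (gcdn d a)) // divnK ?dvdn_gcdl // mulnAC divnK ?dvdn_gcdr.
by rewrite /coprime -(eqn_pmul2r g0) muln_gcdl !divnK ?dvdn_gcdl ?dvdn_gcdr // mul1n.
Qed.

Local Open Scope ring_scope.

Section Bilinear.
Variable R : realType.
Implicit Types (a b : nat -> R).

Lemma sum_divisors_const m (z : R) : \sum_(d <- divisors m) z = (tau m)%:R * z.
Proof. by rewrite big_const_seq count_predT iter_addr_0 mulr_natl. Qed.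

(** Lagrange's identity: the defect is half the sum of the squares [(u i * v j - v i * u j) ^ 2]. *)
Lemma cauchy_schwarz (u v : nat -> R) (s : seq nat) :
  (\sum_(i <- s) u i * v i) ^+ 2 <= (\sum_(i <- s) u i ^+ 2) * \sum_(i <- s) v i ^+ 2.
Proof.
have h : 0 <= \sum_(i <- s) \sum_(j <- s) (u i * v j - v i * u j) ^+ 2.
  by apply: sumr_ge0 => i _; apply: sumr_ge0 => j _; rewrite sqr_ge0.
have e : \sum_(i <- s) \sum_(j <- s) (u i * v j - v i * u j) ^+ 2 =
  (\sum_(i <- s) u i ^+ 2) * (\sum_(i <- s) v i ^+ 2) +
  (\sum_(i <- s) v i ^+ 2) * (\sum_(i <- s) u i ^+ 2) - 2 * (\sum_(i <- s) u i * v i) ^+ 2.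
  rewrite expr2 !big_distrlr /= mulr_sumr -big_split /= -sumrN -big_split /=.
  apply: eq_bigr => i _; rewrite mulr_sumr -big_split /= -sumrN -big_split /=.
  by apply: eq_bigr => j _; ring.
by move: h; rewrite e [X in _ + X - _]mulrC; set UV := _ * _; lra.
Qed.

Lemma power_mean a n i : (\sum_(1 <= y < n.+1) a y) ^+ (2 ^ i) <=
  n%:R ^+ (2 ^ i).-1 * \sum_(1 <= y < n.+1) a y ^+ (2 ^ i).
Proof.
elim: i => [|i IH]; first by rewrite expr0 mul1r.
have e2 k (z : R) : z ^+ (2 ^ k.+1) = (z ^+ (2 ^ k)) ^+ 2 by rewrite -exprM expnS mulnC.
(* The first squaring is separate: squaring the induction hypothesis needs its left side to be
   nonnegative, which is not known for the exponent [2 ^ 0]. *)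
case: i IH => [_|i IH].
  have := cauchy_schwarz (fun=> 1) a (index_iota 1 n.+1).
  under eq_bigr do rewrite mul1r.
  by rewrite expr1n sumr_const_nat subn1.
have ge0 k (z : R) : 0 <= z ^+ (2 ^ k.+1) by rewrite e2 sqr_ge0.
rewrite e2; apply: (@le_trans _ _ ((n%:R ^+ (2 ^ i.+1).-1 * \sum_(1 <= y < n.+1) a y ^+ (2 ^ i.+1)) ^+ 2)).
  by rewrite ler_sqr // nnegrE // mulr_ge0 ?exprn_ge0 // sumr_ge0.
have := cauchy_schwarz (fun=> 1) (fun y => a y ^+ (2 ^ i.+1)) (index_iota 1 n.+1).
under eq_bigr do rewrite mul1r.
rewrite expr1n sumr_const_nat subn1 /= => h.
rewrite exprMn; apply: le_trans (ler_wpM2l _ h) _; first by rewrite sqr_ge0.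
rewrite mulrA -exprM -exprSr (_ : ((2 ^ i.+1).-1 * 2).+1 = (2 ^ i.+2).-1)%N; last first.
  have : (0 < 2 ^ i.+1)%N by rewrite expn_gt0.
  by rewrite [(2 ^ i.+2)%N]expnS; lia.
by rewrite ler_wpM2l ?exprn_ge0 // le_eqVlt; apply/orP; left; apply/eqP/eq_bigr => y _; rewrite (e2 i.+1).
Qed.

Definition kronR x y : R := (kron x y)%:~R.

Lemma kronR_norm x y : `|kronR x y| <= 1.
Proof. by rewrite /kronR; case: (kron_cases x y) => ->; rewrite ?mulr0z ?mulrN1z ?mulr1z ?normr0 ?normrN ?normr1 ?ler01. Qed.

Lemma kronR_orthogonal x1 x2 m n : oddsq x1 -> oddsq x2 -> x1 != x2 ->
  `|\sum_(m <= y < n) kronR x1 y * kronR x2 y| <= (x1 * x2)%N%:R.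
Proof.
move=> h1 h2 ne; have := kron_orthogonal m n h1 h2 ne.
rewrite -(ler_int R) intr_norm rmorph_sum rmorph_nat /= => h; apply: le_trans _ h.
by rewrite le_eqVlt; apply/orP; left; apply/eqP; congr `|_|; apply: eq_bigr => y _; rewrite rmorphM.
Qed.

(** After Cauchy-Schwarz in [y] the square over [x] is opened. The [M] diagonal pairs give at most
    [N] each; the others, at most [M ^ 2] in number, give at most [x1 * x2 <= M ^ 2] by
    orthogonality. *)
Lemma large_sieve M N a b : (forall x, a x != 0 -> oddsq x) -> (forall x, `|a x| <= 1) ->
  (\sum_(1 <= y < N.+1) b y * \sum_(1 <= x < M.+1) a x * kronR x y) ^+ 2 <=
  (\sum_(1 <= y < N.+1) b y ^+ 2) * (M%:R * N%:R + M%:R ^+ 4).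
Proof.
move=> ao a1; apply: le_trans (cauchy_schwarz _ _ _) _.
rewrite ler_wpM2l ?sumr_ge0 // => [y _|]; first exact: sqr_ge0.
have -> : \sum_(1 <= y < N.+1) (\sum_(1 <= x < M.+1) a x * kronR x y) ^+ 2 =
  \sum_(1 <= x1 < M.+1) \sum_(1 <= x2 < M.+1) a x1 * a x2 * \sum_(1 <= y < N.+1) kronR x1 y * kronR x2 y.
  under [RHS]eq_bigr => x1 _ do under eq_bigr => x2 _ do rewrite mulr_sumr.
  under [RHS]eq_bigr => x1 _ do rewrite exchange_big.
  rewrite [RHS]exchange_big; apply: eq_bigr => y _; rewrite expr2 big_distrlr /=.
  by apply: eq_bigr => x1 _; apply: eq_bigr => x2 _; rewrite mulrACA.
have -> : M%:R * N%:R + M%:R ^+ 4 =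
  \sum_(1 <= x1 < M.+1) \sum_(1 <= x2 < M.+1) ((if x2 == x1 then N%:R else 0) + M%:R ^+ 2) :> R.
  under eq_bigr => x1 _ do rewrite big_split /= sumr_const_nat.
  rewrite big_split /= sumr_const_nat subn1 /=; congr (_ + _).
    rewrite (eq_big_nat _ _ (F2 := fun=> N%:R)); first by rewrite sumr_const_nat subn1 mulr_natl.
    move=> x1 hx; rewrite -big_mkcond big_nat1_eq.
    by rewrite hx.
  by rewrite ?subn1 /= -[RHS]mulr_natr -[X in _ = X * _]mulr_natr; ring.
rewrite big_nat [leRHS]big_nat; apply: ler_sum => x1 /andP[x10 x1M].
rewrite big_nat [leRHS]big_nat; apply: ler_sum => x2 /andP[x20 x2M].
have [z|nz] := eqVneq (a x1 * a x2) 0.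
  by rewrite z mul0r addr_ge0 ?exprn_ge0 //; case: ifP.
have /norP[n1 n2] : ~~ ((a x1 == 0) || (a x2 == 0)) by rewrite -mulf_eq0.
apply: le_trans (ler_norm _) _; rewrite normrM -[leRHS]mul1r; apply: ler_pM => //.
  by rewrite normrM -[1]mul1r; apply: ler_pM.
case: eqP => [->|/eqP ne].
  apply: ler_wpDr; first exact: exprn_ge0.
  apply: le_trans (ler_norm_sum _ _ _) _.
  apply: le_trans (_ : \sum_(1 <= y < N.+1) 1 <= _); last by rewrite sumr_const_nat subn1.
  by apply: ler_sum => y _; rewrite normrM -[1]mul1r; apply: ler_pM => //; exact: kronR_norm.
rewrite add0r; apply: le_trans (kronR_orthogonal _ _ (ao _ n1) (ao _ n2) _) _; first by rewrite eq_sym.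
by rewrite -natrX ler_nat -mulnn leq_mul.
Qed.

(** [A] is the Dirichlet square of [a]. It does not depend on [phi], so the same coefficients serve
    all symbols [kronR y] at once. *)
Lemma square_linear_form M a c : (forall m, (0 < m)%N -> `|a m| <= (tau m)%:R ^+ c) ->
  exists A : nat -> R, (forall m, (0 < m)%N -> `|A m| <= (tau m)%:R ^+ (2 * c).+1) /\
  forall phi : nat -> R, (forall x y, phi (x * y)%N = phi x * phi y) ->
   (\sum_(1 <= x < M.+1) a x * phi x) ^+ 2 = \sum_(1 <= m < (M ^ 2).+1) A m * phi m.
Proof.
move=> ac; exists (fun m => \sum_(d <- divisors m)
   if (d <= M)%N && (m %/ d <= M)%N then a d * a (m %/ d)%N else 0); split.
  move=> m m0; apply: le_trans (ler_norm_sum _ _ _) _.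
  apply: (@le_trans _ _ (\sum_(d <- divisors m) (tau m)%:R ^+ (2 * c))).
    rewrite big_seq [leRHS]big_seq; apply: ler_sum => d; rewrite -dvdn_divisors // => dm.
    case: ifP => _; last by rewrite normr0 exprn_ge0.
    have h e : (e %| m)%N -> `|a e| <= (tau m)%:R ^+ c.
      move=> em; apply: le_trans (ac _ (dvdn_gt0 m0 em)) _.
      by rewrite lerXn2r ?nnegrE // ler_nat tau_dvd.
    by rewrite normrM mul2n -addnn exprD; apply: ler_pM => //; apply: h => //; rewrite dvdn_div.
  by rewrite big_const_seq count_predT iter_addr_0 -[X in X <= _]mulr_natr exprSr.
move=> phi phiM.
transitivity (\sum_(1 <= m < (M ^ 2).+1) \sum_(d <- divisors m)
    if (d <= M)%N && (m %/ d <= M)%N then a d * phi d * (a (m %/ d)%N * phi (m %/ d)%N) else 0); last first.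
  apply: eq_big_nat => m /andP[m0 _]; rewrite mulr_suml; apply: eq_big_seq => d.
  rewrite -dvdn_divisors // => dm; case: ifP => _; last by rewrite mul0r.
  by rewrite mulrACA -phiM mulnC divnK.
rewrite (sum_divisors_pairs (fun d e => if (d <= M)%N && (e <= M)%N then a d * phi d * (a e * phi e) else 0)).
case: (posnP M) => [->|M0]; first by rewrite !big_geq // expr0n.
have MM : (M <= M ^ 2)%N by rewrite -mulnn leq_pmulr.
rewrite expr2 big_distrlr [RHS](big_cat_nat (n := M.+1)) //= [X in _ = _ + X](_ : _ = 0); last first.
  rewrite big_nat big1 // => d /andP[dM _]; rewrite big1 // => e _.
  by rewrite leqNgt dM.
rewrite addr0; apply: eq_big_nat => d /andP[d0 dM].
have Md : (M <= M ^ 2 %/ d)%N by rewrite leq_divRL // -mulnn leq_mul2l -ltnS dM orbT.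
rewrite [RHS](big_cat_nat (n := M.+1)) //= [X in _ = _ + X](_ : _ = 0); last first.
  by rewrite big_nat big1 // => e /andP[eM _]; rewrite [(e <= M)%N]leqNgt eM andbF.
by rewrite addr0; apply: eq_big_nat => e /andP[e0 eM]; rewrite -ltnS dM -ltnS eM.
Qed.

Lemma power_linear_form i : exists c, forall M a, (forall m, `|a m| <= 1) ->
  exists A : nat -> R, (forall m, (0 < m)%N -> `|A m| <= (tau m)%:R ^+ c) /\
  forall phi : nat -> R, (forall x y, phi (x * y)%N = phi x * phi y) ->
   (\sum_(1 <= x < M.+1) a x * phi x) ^+ (2 ^ i) = \sum_(1 <= m < (M ^ (2 ^ i)).+1) A m * phi m.
Proof.
elim: i => [|i [c IH]]; first by exists 0%N => M a a1; exists a; split=> // m _; rewrite expr0.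
exists (2 * c).+1 => M a a1; have [A [hA eA]] := IH M a a1.
have [B [hB eB]] := square_linear_form (M ^ 2 ^ i) hA.
exists B; split=> // phi phiM.
by rewrite expnSr exprM eA // eB // -expnM.
Qed.

(** One factor [tau m] is spent on a sum over [m = d * e], and the others split by
    submultiplicativity; so the next moment is at most the square of the previous one. *)
Lemma tau_moment j : exists c, forall M,
  \sum_(1 <= m < M.+1) (tau m)%:R ^+ j / m%:R <= harm R M ^+ c.
Proof.
elim: j => [|j [c IH]].
  exists 1%N => M; rewrite expr1 /harm le_eqVlt; apply/orP; left; apply/eqP/eq_bigr => m _.
  by rewrite expr0 mul1r.
exists (2 * c)%N => M.
pose F m : R := (tau m)%:R ^+ j / m%:R.
have F0 m : 0 <= F m by rewrite divr_ge0 ?exprn_ge0.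
apply: (@le_trans _ _ (\sum_(1 <= m < M.+1) \sum_(d <- divisors m) F d * F (m %/ d)%N)).
  rewrite big_nat [leRHS]big_nat; apply: ler_sum => m /andP[m0 mM].
  rewrite exprS -mulrA -sum_divisors_const.
  rewrite big_seq [leRHS]big_seq; apply: ler_sum => d; rewrite -dvdn_divisors // => dm.
  have d0 := dvdn_gt0 m0 dm; have e0 : (0 < m %/ d)%N by rewrite divn_gt0 // dvdn_leq.
  have de : (d * (m %/ d))%N = m by rewrite mulnC divnK.
  rewrite /F mulrACA -exprMn -invfM -!natrM de.
  rewrite ler_wpM2r ?invr_ge0 // lerXn2r ?nnegrE // ler_nat -{1}de.
  exact: tauM_le.
rewrite (sum_divisors_pairs (fun d e => F d * F e)).
apply: (@le_trans _ _ ((\sum_(1 <= m < M.+1) F m) ^+ 2)).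
  rewrite expr2 big_distrlr; apply: ler_sum => d _.
  rewrite [leRHS](big_cat_nat (n := (M %/ d).+1)) //=; last by rewrite ltnS leq_div.
  by apply: ler_wpDr => //; apply: sumr_ge0 => e _; rewrite mulr_ge0.
by rewrite mulnC exprM lerXn2r ?nnegrE ?exprn_ge0 ?harm_ge0 // sumr_ge0.
Qed.

Lemma tau_moment_sum j : exists c, forall M,
  \sum_(1 <= m < M.+1) (tau m)%:R ^+ j <= M%:R * harm R M ^+ c.
Proof.
have [c hc] := tau_moment j; exists c => M.
apply: le_trans (ler_wpM2l _ (hc M)) => //.
rewrite mulr_sumr big_nat [leRHS]big_nat; apply: ler_sum => m /andP[m0 mM].
rewrite mulrCA ler_peMr ?exprn_ge0 // ler_pdivlMr ?ltr0n // mul1r ler_nat //.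
Qed.

Lemma bilinear_trivial_zero W M N a b : (M <= W)%N ->
  (forall x, a x != 0 -> oddsq x /\ (W < x)%N) ->
  \sum_(1 <= x < M.+1) \sum_(1 <= y < N.+1) a x * b y * kronR x y = 0.
Proof.
move=> MW ha; rewrite big_nat big1 // => x /andP[_ xM]; rewrite big1 // => y _.
have [->|/ha[_ Wx]] := eqVneq (a x) 0; first by rewrite !mul0r.
by move: xM; rewrite ltnS leqNgt (leq_ltn_trans MW Wx).
Qed.

(* For [N >= M ^ 3] Cauchy-Schwarz and orthogonality suffice.  Otherwise the sum over [x] is raised
   to the power 16 first, which makes [x] range up to [M ^ 16 >= N ^ 3]. *)
Lemma bilinear_ordered : exists c, forall X W M N a b, (M <= N)%N -> (N <= X)%N ->
  (forall x, `|a x| <= 1) -> (forall x, `|b x| <= 1) ->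
  (forall x, a x != 0 -> oddsq x /\ (W < x)%N) ->
  (forall x, b x != 0 -> oddsq x /\ (W < x)%N) ->
  (forall x y, a x != 0 -> b y != 0 -> kron x y = kron y x) ->
  (\sum_(1 <= x < M.+1) \sum_(1 <= y < N.+1) a x * b y * kronR x y) ^+ 32 * W%:R <=
  2 ^+ 16 * (M%:R * N%:R) ^+ 32 * harm R (X ^ 16) ^+ c.
Proof.
have [c1 hc1] := power_linear_form 4; have [c hc] := tau_moment_sum (c1 * 2).
exists c => X W M N a b MN NX a1 b1 ha hb sym.
case: (leqP M W) => MW.
  rewrite (bilinear_trivial_zero _ _ MW ha) expr0n mul0r.
  by rewrite !mulr_ge0 ?exprn_ge0 ?mulr_ge0 ?harm_ge0.
have M0 : (0 < M)%N by exact: leq_trans MW.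
have X0 : (0 < X)%N by exact: leq_trans M0 (leq_trans MN NX).
have hX : 1 <= harm R (X ^ 16) by apply: ge1_harm; rewrite expn_gt0 X0.
have hXc : 1 <= harm R (X ^ 16) ^+ c by exact: exprn_ege1.
have bsum : \sum_(1 <= y < N.+1) b y ^+ 2 <= N%:R.
  apply: (@le_trans _ _ (\sum_(1 <= y < N.+1) 1)); last by rewrite sumr_const_nat subn1.
  by apply: ler_sum => y _; rewrite -real_normK ?num_real // expr_le1.
have WM : W%:R <= M%:R :> R by rewrite ler_nat ltnW.
set T := \sum_(1 <= x < M.+1) _.
have T32 : 0 <= T ^+ 32 by rewrite -[32%N]/(2 * 16)%N exprM exprn_ge0 ?sqr_ge0.
have [MN3|MN3] := leqP (M ^ 3) N.
  have eT : T = \sum_(1 <= y < N.+1) b y * \sum_(1 <= x < M.+1) a x * kronR x y.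
    rewrite /T exchange_big; apply: eq_bigr => y _; rewrite mulr_sumr.
    by apply: eq_bigr => x _; rewrite mulrA [b y * _]mulrC.
  have h : T ^+ 2 * M%:R <= 2 * (M%:R * N%:R) ^+ 2.
    apply: (@le_trans _ _ (N%:R * (M%:R * N%:R + M%:R ^+ 4) * M%:R)).
      rewrite ler_wpM2r // eT; apply: le_trans (large_sieve _ _ _ _ _) _ => //; first by move=> x /ha[].
      by rewrite ler_wpM2r ?addr_ge0 ?mulr_ge0 ?exprn_ge0.
    have : M%:R ^+ 3 <= N%:R :> R by rewrite -natrX ler_nat.
    rewrite (_ : N%:R * _ * _ = M%:R ^+ 2 * N%:R * (N%:R + M%:R ^+ 3)); last by ring.
    rewrite (_ : 2 * (_ * _) ^+ 2 = M%:R ^+ 2 * N%:R * (2 * N%:R)); last by ring.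
    by move=> h; rewrite ler_wpM2l ?mulr_ge0 ?exprn_ge0 //; lra.
  (* [T ^+ 2] has gained a factor [M > W]; the 16th power brings this to the exponent dictated by
     the other case. *)
  apply: (@le_trans _ _ (T ^+ 32 * M%:R ^+ 16)).
    by rewrite ler_wpM2l // (le_trans WM) // ler_eXnr // ler1n.
  apply: (@le_trans _ _ (2 ^+ 16 * (M%:R * N%:R) ^+ 32)); last by rewrite ler_peMr ?mulr_ge0 ?exprn_ge0 ?mulr_ge0.
  rewrite -[32%N]/(2 * 16)%N !(exprM _ 2 16) -!exprMn lerXn2r // nnegrE; first by rewrite mulr_ge0 // sqr_ge0.
  by rewrite mulr_ge0 // sqr_ge0.
(* Of [b] only its support survives the 16th power. It must be kept, since multiplicativity of
   [kronR y] needs [y] odd. *)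
pose e y : R := (b y != 0)%:R.
(* Reciprocity turns the symbol into [kronR y x], which is completely multiplicative in the variable
   [x] whose sum is raised to the 16th power. *)
have T16 : T ^+ 16 <= N%:R ^+ 15 * \sum_(1 <= y < N.+1) e y * (\sum_(1 <= x < M.+1) a x * kronR y x) ^+ 16.
  have -> : T = \sum_(1 <= y < N.+1) b y * \sum_(1 <= x < M.+1) a x * kronR y x.
    rewrite /T exchange_big; apply: eq_bigr => y _; rewrite mulr_sumr.
    apply: eq_bigr => x _; rewrite mulrA [b y * _]mulrC.
    have [->|ax] := eqVneq (a x) 0; first by rewrite !mul0r.
    have [->|bY] := eqVneq (b y) 0; first by rewrite !mulr0 !mul0r.
    by rewrite /kronR sym.
  apply: le_trans (power_mean _ _ 4) _; rewrite ler_wpM2l ?exprn_ge0 //.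
  apply: ler_sum => y _; rewrite exprMn /e -[(2 ^ 4)%N]/16%N.
  rewrite -[16%N]/(2 * 8)%N !(exprM _ 2 8); apply: ler_wpM2r; first by rewrite exprn_ge0 // sqr_ge0.
  have [->|_] := eqVneq (b y) 0; first by rewrite expr0n expr0n.
  by rewrite exprn_ile1 ?sqr_ge0 // -real_normK ?num_real // expr_le1.
have [A [hA eA]] := hc1 M a a1.
have T16' : T ^+ 16 <= N%:R ^+ 15 * \sum_(1 <= m < (M ^ 16).+1) A m * \sum_(1 <= y < N.+1) e y * kronR y m.
  apply: le_trans T16 _; rewrite ler_wpM2l ?exprn_ge0 // le_eqVlt; apply/orP; left; apply/eqP.
  under [RHS]eq_bigr => m _ do rewrite mulr_sumr.
  rewrite [RHS]exchange_big; apply: eq_bigr => y _.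
  rewrite /e; have [_|bY] := eqVneq (b y) 0.
    by rewrite mul0r big1 // => m _; rewrite mul0r mulr0.
  have [/andP[oy _] _] := hb y bY.
  rewrite mul1r -[16%N]/(2 ^ 4)%N eA => [|x z]; last by rewrite /kronR kronMr // rmorphM.
  by apply: eq_bigr => m _; rewrite mul1r.
set T' := \sum_(1 <= m < _) _ in T16'.
(* Here [y] is the variable on which orthogonality acts. The off-diagonal term [N ^ 4] is absorbed
   by [N * M ^ 16], because [N < M ^ 3]. *)
have hT' : T' ^+ 2 <= M%:R ^+ 16 * harm R (X ^ 16) ^+ c * (2 * (N%:R * M%:R ^+ 16)).
  apply: le_trans (large_sieve _ _ _ _ _) _.
  - by move=> y; rewrite /e; have [_|/hb[] //] := eqVneq (b y) 0; rewrite eqxx.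
  - by move=> y; rewrite /e; case: (b y != 0); rewrite ?normr1 // normr0 ler01.
  apply: ler_pM.
  - by apply: sumr_ge0 => m _; rewrite sqr_ge0.
  - by rewrite addr_ge0 ?mulr_ge0 ?exprn_ge0.
  - apply: (@le_trans _ _ (\sum_(1 <= m < (M ^ 16).+1) (tau m)%:R ^+ (c1 * 2))).
      rewrite big_nat [leRHS]big_nat; apply: ler_sum => m /andP[m0 _].
      by rewrite exprM -[A m ^+ 2]real_normK ?num_real // lerXn2r ?nnegrE ?exprn_ge0 // hA.
    apply: le_trans (hc _) _; rewrite natrX ler_wpM2l ?exprn_ge0 //.
    by rewrite lerXn2r ?nnegrE ?harm_ge0 // le_harm // leq_exp2r // (leq_trans MN).
  have : N%:R ^+ 4 <= N%:R * M%:R ^+ 16 :> R.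
    rewrite exprS ler_wpM2l // -!natrX ler_nat.
    apply: (@leq_trans ((M ^ 3) ^ 3)); first by rewrite leq_exp2r // ltnW.
    by rewrite -expnM leq_pexp2l.
  by rewrite natrX; lra.
(* The 32nd power falls short of its trivial size by a factor [N], and this factor pays for
   [W <= N]. *)
apply: (@le_trans _ _ ((N%:R ^+ 15 * T') ^+ 2 * N%:R)).
  have WN : W%:R <= N%:R :> R by rewrite ler_nat (leq_trans (ltnW MW)).
  have t0 : 0 <= T ^+ 16 by rewrite -[16%N]/(2 * 8)%N exprM exprn_ge0 ?sqr_ge0.
  apply: ler_pM => //; rewrite -[32%N]/(16 * 2)%N exprM lerXn2r // nnegrE //.
  exact: le_trans t0 T16'.
rewrite exprMn; apply: le_trans (ler_wpM2r _ (ler_wpM2l _ hT')) _ => //; first by rewrite sqr_ge0.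
rewrite (_ : (N%:R ^+ 15) ^+ 2 * _ * _ = 2 * ((M%:R * N%:R) ^+ 32 * harm R (X ^ 16) ^+ c)); last by ring.
by rewrite -mulrA ler_wpM2r ?mulr_ge0 ?exprn_ge0 ?mulr_ge0 ?harm_ge0 // ler_eXnr // ler1n.
Qed.

Lemma bilinear : exists c, forall X W M N a b, (M <= X)%N -> (N <= X)%N ->
  (forall x, `|a x| <= 1) -> (forall x, `|b x| <= 1) ->
  (forall x, a x != 0 -> oddsq x /\ (W < x)%N) ->
  (forall x, b x != 0 -> oddsq x /\ (W < x)%N) ->
  (forall x y, a x != 0 -> b y != 0 -> kron x y = kron y x) ->
  (\sum_(1 <= x < M.+1) \sum_(1 <= y < N.+1) a x * b y * kronR x y) ^+ 32 * W%:R <=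
  2 ^+ 16 * (M%:R * N%:R) ^+ 32 * harm R (X ^ 16) ^+ c.
Proof.
have [c hc] := bilinear_ordered; exists c => X W M N a b MX NX a1 b1 ha hb sym.
case/orP: (leq_total M N) => MN; first exact: hc.
have := hc X W N M b a MN MX b1 a1 hb ha _; rewrite [N%:R * M%:R]mulrC => h.
have -> : \sum_(1 <= x < M.+1) \sum_(1 <= y < N.+1) a x * b y * kronR x y =
  \sum_(1 <= x < N.+1) \sum_(1 <= y < M.+1) b x * a y * kronR x y.
  rewrite exchange_big; apply: eq_bigr => y _; apply: eq_bigr => x _.
  have [->|ax] := eqVneq (a x) 0; first by rewrite !(mul0r, mulr0).
  have [->|bY] := eqVneq (b y) 0; first by rewrite !(mul0r, mulr0).
  by rewrite /kronR sym // [a x * _]mulrC.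
by apply: h => x y bx ay; apply/esym/sym.
Qed.

End Bilinear.

(** * Boxes *)

Local Open Scope nat_scope.

(* [s] and [t] are the parities of the exponents of 2 in [a] and in [a * n]. *)
Definition good (s t : bool) d e :=
  [&& one4 d, oddsq e, all (fun p => leg p (2 ^ t * e) == 1%R) (primes d) &
      all (fun p => leg p (2 ^ s * d) == 1%R) (primes e)].

Local Open Scope ring_scope.

Section Box.
Variable R : realType.

Lemma sum_cut (F : nat -> R) M k : (0 < k)%N -> (forall n, (M < n * k)%N -> F n = 0) ->
  \sum_(1 <= n < M.+1) F n = \sum_(1 <= n < (M %/ k).+1) F n.
Proof.
move=> k0 F0; rewrite (big_cat_nat (n := (M %/ k).+1)) //=; last by rewrite ltnS leq_div.
rewrite [X in _ + X](_ : _ = 0) ?addr0 // big_nat big1 // => n /andP[nk _].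
by apply: F0; move: nk; rewrite ltn_divLR.
Qed.

(** With cofactors [m] and [n] fixed, the variables stop at [M / m] and [N / n]; keeping these
    quotients means that summing over the cofactors later costs only harmonic sums. [del] is the
    relative saving after the 32nd root. *)
Lemma bilinear_cut : exists c, forall X W M N m n (a b : nat -> R) (del : R),
  (M <= X)%N -> (N <= X)%N -> 0 <= del -> 2 ^+ 16 * harm R (X ^ 16) ^+ c <= del ^+ 32 * W%:R ->
  (0 < m)%N -> (0 < n)%N ->
  (forall x, `|a x| <= 1) -> (forall x, `|b x| <= 1) ->
  (forall x, a x != 0 -> [/\ oddsq x, (W < x)%N & (x * m <= M)%N]) ->
  (forall x, b x != 0 -> [/\ oddsq x, (W < x)%N & (x * n <= N)%N]) ->
  (forall x y, a x != 0 -> b y != 0 -> kron x y = kron y x) ->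
  `|\sum_(1 <= x < M.+1) \sum_(1 <= y < N.+1) a x * b y * kronR R x y| <=
   del * (M%:R / m%:R) * (N%:R / n%:R).
Proof.
have [c hc] := bilinear R; exists c => X W M N m n a b del MX NX d0 hW m0 n0 a1 b1 ha hb sym.
rewrite (sum_cut m0) => [|x xm]; last first.
  by rewrite big1 // => y _; have [->|/ha[_ _]] := eqVneq (a x) 0; rewrite ?mul0r // leqNgt xm.
under eq_bigr => x _.
  rewrite (sum_cut n0) => [|y yn]; last first.
    by have [->|/hb[_ _]] := eqVneq (b y) 0; rewrite ?mulr0 ?mul0r // leqNgt yn.
  over.
have ha' x : a x != 0 -> oddsq x /\ (W < x)%N by move=> /ha[].
have hb' x : b x != 0 -> oddsq x /\ (W < x)%N by move=> /hb[].
have := hc X W (M %/ m)%N (N %/ n)%N a b (leq_trans (leq_div _ _) MX) (leq_trans (leq_div _ _) NX) a1 b1 ha' hb' sym.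
set T := \sum_(1 <= x < _) _ => hT.
(* For [W = 0] the hypothesis on [del] would make a number at least 1 nonpositive, unless [X = 0],
   when the sum is empty. *)
case: (posnP W) => [W0|W0].
  move: hW; rewrite W0 mulr0 => /le_lt_trans h; have := h 1 ltr01.
  case: (posnP X) => [X0|X0].
    by move: MX; rewrite X0 leqn0 => /eqP M0; rewrite /T M0 div0n big_geq // normr0 !mul0r mulr0 mul0r lexx.
  have : 1 <= 2 ^+ 16 * harm R (X ^ 16) ^+ c.
    by apply: mulr_ege1; apply: exprn_ege1; rewrite ?ler1n // ge1_harm // expn_gt0 X0.
  by move=> h1; rewrite ltNge h1.
have W0' : 0 < W%:R :> R by rewrite ltr0n.
apply: (@le_trans _ _ (del * ((M %/ m)%:R * (N %/ n)%:R))); last first.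
  rewrite -mulrA ler_wpM2l // ler_pM //; exact: natr_div_le.
rewrite -(@ler_pXn2r _ 32) ?nnegrE ?mulr_ge0 // -normrX ger0_norm; last first.
  by rewrite -[32%N]/(2 * 16)%N exprM exprn_ge0 // sqr_ge0.
rewrite -(ler_pM2r W0'); apply: le_trans hT _.
rewrite (mulrAC (2 ^+ 16)) [(del * _) ^+ 32]exprMn [leRHS]mulrAC ler_wpM2r //.
by rewrite exprn_ge0 ?mulr_ge0.
Qed.

Definition gweight n : R := (one4 n)%:R / (tau n)%:R.
Definition hweight n : R := (oddsq n)%:R / (tau n)%:R.
Definition smooth_sum (f : nat -> R) M W : R :=
  \sum_(1 <= i < W.+1) \sum_(1 <= n < (M %/ i).+1) f n.

(** The coefficient of a factorisation [u * v]: [1 / tau] normalises the number of factorisations,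
    and all cutoffs depend on the product alone, so the two factors can be exchanged. *)
Definition cofw (P : pred nat) W M u v : R :=
  if [&& (u * v <= M)%N, (W ^ 2 < u * v)%N & P (u * v)%N] then (tau (u * v))%:R^-1 else 0.

Section Coef.
Variables (P : pred nat) (W M : nat).
Hypotheses (Pd : forall d n, (d %| n)%N -> P n -> P d) (Ps : forall n, P n -> oddsq n).
Local Notation cf := (cofw P W M).

Lemma cofw_ge0 u v : 0 <= cf u v.
Proof. by rewrite /cofw; case: ifP => _; rewrite ?invr_ge0. Qed.

Lemma cofw_sym u v : cf u v = cf v u. Proof. by rewrite /cofw mulnC. Qed.

Lemma cofw_supp u v : cf u v != 0 -> [/\ (u * v <= M)%N, (W ^ 2 < u * v)%N, P u & P v].
Proof.
rewrite /cofw; case: ifP => [/and3P[h1 h2 h3] _|]; last by rewrite eqxx.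
by split=> //; apply: Pd h3; [exact: dvdn_mulr | exact: dvdn_mull].
Qed.

Lemma cofw_le1 u v : cf u v <= 1.
Proof.
rewrite /cofw; case: ifP => [/and3P[_ _ /Ps/oddsq_gt0 h]|_]; last exact: ler01.
by rewrite invf_le1 ?ltr0n ?ler1n tau_gt0.
Qed.

Lemma cofw_le u v : cf u v <= if (u * v <= M)%N then (P v)%:R / (tau v)%:R else 0.
Proof.
have [->|h] := eqVneq (cf u v) 0.
  by case: ifP => // _; rewrite divr_ge0.
have [-> _ _ pv] := cofw_supp h; move: h; rewrite pv /cofw; case: ifP; last by rewrite eqxx.
move=> /and3P[_ _ /Ps/oddsq_gt0 uv0] _; rewrite mul1r.
have v0 : (0 < v)%N by move: uv0; rewrite muln_gt0 => /andP[].
by rewrite lef_pV2 ?posrE ?ltr0n ?tau_gt0 // ler_nat tau_dvd // dvdn_mull.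
Qed.

Lemma sum_cofw_smooth : \sum_(1 <= u < M.+1) \sum_(1 <= v < M.+1) (u <= W)%N%:R * cf u v <=
  smooth_sum (fun n => (P n)%:R / (tau n)%:R) M W.
Proof.
have S0 i : 0 <= \sum_(1 <= n < (M %/ i).+1) (P n)%:R / (tau n)%:R :> R.
  by apply: sumr_ge0 => n _; rewrite divr_ge0.
apply: (@le_trans _ _ (\sum_(1 <= u < M.+1) (u <= W)%N%:R * \sum_(1 <= n < (M %/ u).+1) (P n)%:R / (tau n)%:R)).
  rewrite big_nat [leRHS]big_nat; apply: ler_sum => u /andP[u0 uM].
  rewrite -mulr_sumr ler_wpM2l // (@sum_cut _ _ u) // => [|v]; last first.
    by rewrite ltnNge mulnC /cofw => /negPf ->.
  rewrite big_nat [leRHS]big_nat; apply: ler_sum => v /andP[v0 vM].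
  apply: le_trans (cofw_le _ _) _; case: ifP => // _; by rewrite divr_ge0.
rewrite /smooth_sum; under eq_bigr do rewrite mulrC mulr_natr mulrb.
rewrite -big_mkcond /=; case: (leqP W M) => WM.
  rewrite [leLHS]big_mkcond [leLHS](big_cat_nat (n := W.+1)) //= [X in _ + X](_ : _ = 0) ?addr0.
    by apply: ler_sum => i _; case: ifP.
  by rewrite big_nat big1 // => i /andP[iW _]; rewrite leqNgt iW.
rewrite [leRHS](big_cat_nat (n := M.+1)) //=; last by rewrite ltnS ltnW.
apply: ler_wpDr; first exact: sumr_ge0.
by rewrite big_mkcond; apply: ler_sum => i _; case: ifP.
Qed.

Lemma sum_divisors_cofw (F : nat -> nat -> R) :
  \sum_(1 <= d < M.+1) ((W ^ 2 < d)%N && P d)%:R / (tau d)%:R * \sum_(u <- divisors d) F u (d %/ u)%N =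
  \sum_(1 <= u < M.+1) \sum_(1 <= v < M.+1) cf u v * F u v.
Proof.
transitivity (\sum_(1 <= d < M.+1) \sum_(u <- divisors d) cf u (d %/ u)%N * F u (d %/ u)%N).
  apply: eq_big_nat => d /andP[d0 dM]; rewrite mulr_sumr; apply: eq_big_seq => u.
  rewrite -dvdn_divisors // => ud; rewrite /cofw mulnC divnK // [(d <= M)%N]dM /=.
  by case: ifP; rewrite ?mul1r // mul0r.
rewrite (sum_divisors_pairs (fun u v => cf u v * F u v)); apply: eq_big_nat => u /andP[u0 _].
rewrite [RHS](@sum_cut _ _ u) // => v; rewrite ltnNge mulnC /cofw => /negPf -> /=.
by rewrite mul0r.
Qed.

End Coef.
End Box.

Section Box.
Variable R : realType.
Local Notation kr := (kronR R).

Lemma kronR_Mr x a b : odd x -> kr x (a * b) = kr x a * kr x b.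
Proof. by move=> ox; rewrite /kronR kronMr // rmorphM. Qed.

(** Each divisor sum divided by its [tau] is nonnegative and equals 1 on good pairs. The majorant is
    a combination of Jacobi symbols, so cancellation can be exploited. *)
Lemma good_le s t W d e : (0 < d)%N -> (0 < e)%N ->
  ([&& (W ^ 2 < d)%N, (W ^ 2 < e)%N & good s t d e])%:R <=
  ((W ^ 2 < d)%N && one4 d)%:R / (tau d)%:R * (((W ^ 2 < e)%N && oddsq e)%:R / (tau e)%:R *
   ((\sum_(u <- divisors d) kr u (2 ^ t * e)) * \sum_(v <- divisors e) kr v (2 ^ s * d))) :> R.
Proof.
move=> d0 e0.
have ge0 x a : oddsq x -> 0 <= \sum_(u <- divisors x) kr u a.
  by move=> ox; rewrite /kronR -rmorph_sum /= ler0z sum_kron_ge0.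
rewrite /good; case: (boolP (one4 d)) => [o4|_]; last by rewrite !andbF !mul0r.
case: (boolP (oddsq e)) => [oe|_]; last by rewrite !andbF /= !mul0r mulr0.
rewrite !andbT /=.
case: (W ^ 2 < d)%N; last by rewrite !mul0r.
case: (W ^ 2 < e)%N; last by rewrite /= !mul0r mulr0.
rewrite !mul1r /=; case: (boolP (_ && _)) => [/andP[g1 g2]|_]; last first.
  by rewrite !mulr_ge0 ?invr_ge0 // ge0 // one4_oddsq.
have full x a : (0 < x)%N -> all (fun p => leg p a == 1) (primes x) ->
    \sum_(u <- divisors x) kr u a = (tau x)%:R.
  by move=> x0 g; rewrite /kronR -rmorph_sum /= sum_kron_good // rmorph_nat.
have tn x : (0 < x)%N -> (tau x)%:R != 0 :> R by move=> x0; rewrite pnatr_eq0 -lt0n tau_gt0.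
rewrite !full // [X in _ <= X](_ : _ = 1) //.
by field; rewrite !tn.
Qed.

Lemma sum_rev3 (I J K : seq nat) (F : nat -> nat -> nat -> R) :
  \sum_(i <- I) \sum_(j <- J) \sum_(k <- K) F i j k =
  \sum_(k <- K) \sum_(j <- J) \sum_(i <- I) F i j k.
Proof.
transitivity (\sum_(i <- I) \sum_(k <- K) \sum_(j <- J) F i j k).
  by apply: eq_bigr => i _; exact: exchange_big.
rewrite exchange_big; apply: eq_bigr => k _; exact: exchange_big.
Qed.

(* With [d = u u'] and [e = v v'], either [u'], [v] or [u], [v'] are both large and the bilinear
   bound applies, or [u], [v] or [u'], [v'] are both at most [W]. *)
Lemma box_bound : exists c, forall X W M N (del : R) s t,
  (M <= X)%N -> (N <= X)%N -> 0 <= del -> 2 ^+ 16 * harm R (X ^ 16) ^+ c <= del ^+ 32 * W%:R ->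
  \sum_(1 <= d < M.+1) \sum_(1 <= e < N.+1)
     ([&& (W ^ 2 < d)%N, (W ^ 2 < e)%N & good s t d e])%:R <=
  2 * (del * (M%:R * harm R M) * (N%:R * harm R N)) +
  2 * (smooth_sum (@gweight R) M W * smooth_sum (@hweight R) N W).
Proof.
have [c hc] := bilinear_cut R; exists c => X W M N del s t MX NX d0 hW.
pose cd := cofw R one4 W M; pose ce := cofw R oddsq W N.
have ids n : oddsq n -> oddsq n by [].
have cd0 u u' : 0 <= cd u u' by exact: cofw_ge0.
have ce0 v v' : 0 <= ce v v' by exact: cofw_ge0.
have cd1 u u' : cd u u' <= 1 by exact: (cofw_le1 R W M one4_oddsq).
have ce1 v v' : ce v v' <= 1 by exact: (cofw_le1 R W N ids).
have cdS u u' : cd u u' != 0 -> [/\ (u * u' <= M)%N, (W ^ 2 < u * u')%N, one4 u & one4 u'].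
  exact: (cofw_supp one4_dvd).
have ceS v v' : ce v v' != 0 -> [/\ (v * v' <= N)%N, (W ^ 2 < v * v')%N, oddsq v & oddsq v'].
  exact: (cofw_supp oddsq_dvd).
pose t0 u u' v v' : R := cd u u' * (ce v v' * (kr u (2 ^ t * (v * v')) * kr v (2 ^ s * (u * u')))).
have t0E u u' v v' : t0 u u' v v' = cd u u' * ce v v' *
   (kr u (2 ^ t) * kr u v * kr u v') * (kr v (2 ^ s) * kr v u * kr v u').
  have [z|/cdS[_ _ /one4_oddsq/andP[ou _] _]] := eqVneq (cd u u') 0; first by rewrite /t0 z !mul0r.
  have [z|/ceS[_ _ /andP[ov _] _]] := eqVneq (ce v v') 0; first by rewrite /t0 z !(mul0r, mulr0).
  by rewrite /t0 !kronR_Mr // !mulrA.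
apply: (@le_trans _ _ (\sum_(1 <= u < M.+1) \sum_(1 <= u' < M.+1) \sum_(1 <= v < N.+1) \sum_(1 <= v' < N.+1) t0 u u' v v')).
  pose wd d : R := ((W ^ 2 < d)%N && one4 d)%:R / (tau d)%:R.
  pose we e : R := ((W ^ 2 < e)%N && oddsq e)%:R / (tau e)%:R.
  apply: (@le_trans _ _ (\sum_(1 <= d < M.+1) wd d * \sum_(u <- divisors d)
     \sum_(1 <= e < N.+1) we e * \sum_(v <- divisors e)
       (kr u (2 ^ t * (v * (e %/ v))) * kr v (2 ^ s * (u * (d %/ u)))))).
    rewrite big_nat [leRHS]big_nat; apply: ler_sum => d /andP[dp _].
    rewrite exchange_big mulr_sumr big_nat [leRHS]big_nat; apply: ler_sum => e /andP[ep _].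
    apply: le_trans (good_le _ _ _ dp ep) _; rewrite -/(wd d) -/(we e) -mulr_sumr.
    rewrite le_eqVlt; apply/orP; left; apply/eqP; congr (_ * (_ * _)); rewrite big_distrlr /=.
    apply: eq_big_seq => u; rewrite -dvdn_divisors // => ud; apply: eq_big_seq => v.
    rewrite -dvdn_divisors // => ve.
    by rewrite [(u * _)%N]mulnC [(v * _)%N]mulnC !divnK.
  rewrite le_eqVlt; apply/orP; left; apply/eqP.
  rewrite (@sum_divisors_cofw _ one4 W M (fun u u' => \sum_(1 <= e < N.+1) we e *
     \sum_(v <- divisors e) (kr u (2 ^ t * (v * (e %/ v))) * kr v (2 ^ s * (u * u'))))).
  apply: eq_bigr => u _; apply: eq_bigr => u' _.
  rewrite (@sum_divisors_cofw _ oddsq W N (fun v v' => kr u (2 ^ t * (v * v')) * kr v (2 ^ s * (u * u')))).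
  by rewrite mulr_sumr; apply: eq_bigr => v _; rewrite mulr_sumr.
pose I1 u' v := (W < u')%N && (W < v)%N.
pose I2 u v' := (W < u)%N && (W < v')%N.
pose t1 u u' v v' : R := (I1 u' v)%:R * t0 u u' v v'.
(* [t0] can be negative, so the overlap of the two cases must not be counted twice. The factor
   excluding it depends only on [u'] and [v], which are the fixed variables of the second bilinear
   sum. *)
pose t2 u u' v v' : R := (~~ I1 u' v)%:R * ((I2 u v')%:R * t0 u u' v v').
pose t3 u u' v v' : R := (u <= W)%N%:R * cd u u' * ((v <= W)%N%:R * ce v v').
pose t4 u u' v v' : R := (u' <= W)%N%:R * cd u u' * ((v' <= W)%N%:R * ce v v').
have tle u u' v v' : t0 u u' v v' <= t1 u u' v v' + t2 u u' v v' + (t3 u u' v v' + t4 u u' v v').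
  have t3ge : 0 <= t3 u u' v v' by rewrite !mulr_ge0.
  have t4ge : 0 <= t4 u u' v v' by rewrite !mulr_ge0.
  rewrite /t1 /t2; case: (boolP (I1 u' v)) => i1; first by rewrite mul1r mul0r addr0 lerDl addr_ge0.
  case: (boolP (I2 u v')) => i2; first by rewrite mul0r !mul1r add0r lerDl addr_ge0.
  rewrite !mul0r mulr0 addr0 add0r.
  have le : t0 u u' v v' <= cd u u' * ce v v'.
    rewrite /t0 mulrA -[leRHS]mulr1 ler_wpM2l ?mulr_ge0 //.
    by apply: le_trans (ler_norm _) _; rewrite normrM -[leRHS]mulr1 ler_pM // kronR_norm.
  have [z|cdn] := eqVneq (cd u u') 0.
    by apply: le_trans le _; rewrite z mul0r addr_ge0.
  have [z|cen] := eqVneq (ce v v') 0.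
    by apply: le_trans le _; rewrite z mulr0 addr_ge0.
  have [_ uW _ _] := cdS _ _ cdn; have [_ vW _ _] := ceS _ _ cen.
  (* A product above [W ^ 2] has a factor above [W]. When neither bilinear case applies, [u' <= W]
     forces [u > W] and then [v' <= W]; likewise [v <= W] forces [u <= W]. *)
  have big x y : (W ^ 2 < x * y)%N -> (W < x)%N || (W < y)%N.
    by apply: contraTT; rewrite negb_or -!leqNgt -mulnn => /andP[h1 h2]; exact: leq_mul.
  apply: le_trans le _; rewrite /t3 /t4 [(u <= W)%N]leqNgt [(v <= W)%N]leqNgt [(u' <= W)%N]leqNgt [(v' <= W)%N]leqNgt.
  have := big _ _ uW; have := big _ _ vW; move: i1 i2; rewrite /I1 /I2.
  by case: (W < u)%N => /=; case: (W < u')%N => /=; case: (W < v)%N => /=; case: (W < v')%N => //= *;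
   rewrite ?mul1r ?mul0r ?add0r ?addr0.
apply: (@le_trans _ _ (\sum_(1 <= u < M.+1) \sum_(1 <= u' < M.+1) \sum_(1 <= v < N.+1) \sum_(1 <= v' < N.+1)
   (t1 u u' v v' + t2 u u' v v' + (t3 u u' v v' + t4 u u' v v')))).
  by do 4!(apply: ler_sum => ? _).
under eq_bigr do under eq_bigr do under eq_bigr do rewrite big_split /=.
under eq_bigr do under eq_bigr do rewrite big_split /=.
under eq_bigr do rewrite big_split /=.
rewrite big_split /=; apply: lerD.
  under eq_bigr do under eq_bigr do under eq_bigr do rewrite big_split /=.
  under eq_bigr do under eq_bigr do rewrite big_split /=.
  under eq_bigr do rewrite big_split /=.
  rewrite big_split /= [X in _ <= X]mulr_natl mulr2n; apply: lerD.
    apply: le_trans (ler_norm _) _.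
    rewrite (eq_bigr (fun u => \sum_(1 <= v' < N.+1) \sum_(1 <= v < N.+1) \sum_(1 <= u' < M.+1) t1 u u' v v')) /=; last first.
      by move=> u _; exact: sum_rev3.
    have -> : del * (M%:R * harm R M) * (N%:R * harm R N) =
      \sum_(1 <= u < M.+1) \sum_(1 <= v' < N.+1) del * (N%:R / v'%:R) * (M%:R / u%:R).
      transitivity ((del * M%:R * N%:R) * (harm R M * harm R N)); first by ring.
      rewrite /harm big_distrlr /= mulr_sumr; apply: eq_bigr => u _; rewrite mulr_sumr.
      by apply: eq_bigr => v' _; ring.
    apply: le_trans (ler_norm_sum _ _ _) _; rewrite big_nat [leRHS]big_nat; apply: ler_sum => u /andP[u0 uM].
    apply: le_trans (ler_norm_sum _ _ _) _; rewrite big_nat [leRHS]big_nat; apply: ler_sum => v' /andP[v0 vN].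
    (* With [u] and [v'] fixed, every symbol but [kr v u'] depends on at most one of the running
       variables; those in [v] are absorbed into the coefficient, the rest is a constant factor. *)
    pose a x : R := (W < x)%N%:R * ce x v' * (kr u x * kr x (2 ^ s) * kr x u).
    pose b y : R := (W < y)%N%:R * cd u y.
    have -> : \sum_(1 <= v < N.+1) \sum_(1 <= u' < M.+1) t1 u u' v v' =
      (kr u (2 ^ t) * kr u v') * \sum_(1 <= v < N.+1) \sum_(1 <= u' < M.+1) a v * b u' * kr v u'.
      rewrite mulr_sumr; apply: eq_bigr => v _; rewrite mulr_sumr; apply: eq_bigr => u' _.
      rewrite /t1 t0E /a /b /I1 -mulnb natrM.
      move: (kr u (2 ^ t)) (kr v (2 ^ s)) (kr u v) (kr u v') (kr v u) (kr v u') => *; ring.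
    rewrite normrM -[leRHS]mul1r; apply: ler_pM => //; first by rewrite normrM -[1]mul1r ler_pM // kronR_norm.
    have n1 (B : bool) : `|B%:R| <= 1 :> R by case: B; rewrite ?normr1 // normr0 ler01.
    apply: hc NX MX d0 hW v0 u0 _ _ _ _ _.
    - move=> x; rewrite /a !normrM (ger0_norm (ce0 _ _)).
      by rewrite !mulr_ile1 ?mulr_ge0 ?normr_ge0 ?kronR_norm.
    - by move=> y; rewrite /b normrM (ger0_norm (cd0 _ _)) mulr_ile1.
    - move=> x; rewrite /a; case: (W < x)%N; last by rewrite !mul0r eqxx.
      by have [->|/ceS[h1 _ h2 _]] := eqVneq (ce x v') 0; rewrite ?mulr0 ?mul0r ?eqxx.
    - move=> y; rewrite /b; case: (W < y)%N; last by rewrite !mul0r eqxx.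
      have [->|/cdS[h1 _ _ h2]] := eqVneq (cd u y) 0; rewrite ?mulr0 ?eqxx //.
      by rewrite mulnC one4_oddsq.
    move=> x y; rewrite /a /b.
    have [->|/ceS[_ _ h1 _]] := eqVneq (ce x v') 0; first by rewrite mulr0 mul0r eqxx.
    have [->|/cdS[_ _ _ h2]] := eqVneq (cd u y) 0; first by rewrite mulr0 eqxx.
    by move=> _ _; exact: kron_sym.
  apply: le_trans (ler_norm _) _.
  rewrite exchange_big /=.
  rewrite (eq_bigr (fun u' => \sum_(1 <= v < N.+1) \sum_(1 <= u < M.+1) \sum_(1 <= v' < N.+1) t2 u u' v v')) /=; last first.
    by move=> u' _; exact: exchange_big.
  have -> : del * (M%:R * harm R M) * (N%:R * harm R N) =
      \sum_(1 <= u' < M.+1) \sum_(1 <= v < N.+1) del * (M%:R / u'%:R) * (N%:R / v%:R).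
      transitivity ((del * M%:R * N%:R) * (harm R M * harm R N)); first by ring.
      rewrite /harm big_distrlr /= mulr_sumr; apply: eq_bigr => u' _; rewrite mulr_sumr.
      by apply: eq_bigr => v _; ring.
  apply: le_trans (ler_norm_sum _ _ _) _; rewrite big_nat [leRHS]big_nat; apply: ler_sum => u' /andP[u0 uM].
  apply: le_trans (ler_norm_sum _ _ _) _; rewrite big_nat [leRHS]big_nat; apply: ler_sum => v /andP[v0 vN].
  pose a x : R := (W < x)%N%:R * cd x u' * (kr x (2 ^ t) * kr x v * kr v x).
  pose b y : R := (W < y)%N%:R * ce v y.
  have -> : \sum_(1 <= u < M.+1) \sum_(1 <= v' < N.+1) t2 u u' v v' =
      ((~~ I1 u' v)%:R * (kr v (2 ^ s) * kr v u')) * \sum_(1 <= u < M.+1) \sum_(1 <= v' < N.+1) a u * b v' * kr u v'.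
    rewrite mulr_sumr; apply: eq_bigr => u _; rewrite mulr_sumr; apply: eq_bigr => v' _.
    rewrite /t2 t0E /a /b /I2 -mulnb natrM.
    move: (kr u (2 ^ t)) (kr v (2 ^ s)) (kr u v) (kr u v') (kr v u) (kr v u') => *; ring.
  have n1 (B : bool) : `|B%:R| <= 1 :> R by case: B; rewrite ?normr1 // normr0 ler01.
  rewrite normrM -[leRHS]mul1r; apply: ler_pM => //.
    by rewrite !normrM mulr_ile1 ?mulr_ge0 // mulr_ile1 ?kronR_norm.
  apply: hc MX NX d0 hW u0 v0 _ _ _ _ _.
  - move=> x; rewrite /a !normrM (ger0_norm (cd0 _ _)).
    by rewrite !mulr_ile1 ?mulr_ge0 ?normr_ge0 ?kronR_norm.
  - by move=> y; rewrite /b normrM (ger0_norm (ce0 _ _)) mulr_ile1.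
  - move=> x; rewrite /a; case: (W < x)%N; last by rewrite !mul0r eqxx.
    have [->|/cdS[h1 _ h2 _]] := eqVneq (cd x u') 0; rewrite ?mulr0 ?mul0r ?eqxx //.
    by rewrite one4_oddsq.
  - move=> y; rewrite /b; case: (W < y)%N; last by rewrite !mul0r eqxx.
    have [->|/ceS[h1 _ _ h2]] := eqVneq (ce v y) 0; rewrite ?mulr0 ?eqxx //.
    by rewrite mulnC.
  move=> x y; rewrite /a /b.
  have [->|/cdS[_ _ h1 _]] := eqVneq (cd x u') 0; first by rewrite mulr0 mul0r eqxx.
  have [->|/ceS[_ _ _ h2]] := eqVneq (ce v y) 0; first by rewrite mulr0 eqxx.
  by move=> _ _; apply/esym; exact: kron_sym.
under eq_bigr do under eq_bigr do under eq_bigr do rewrite big_split /=.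
under eq_bigr do under eq_bigr do rewrite big_split /=.
under eq_bigr do rewrite big_split /=.
rewrite big_split /= [X in _ <= X]mulr_natl mulr2n.
have sd := sum_cofw_smooth R W M one4_dvd one4_oddsq.
have se := sum_cofw_smooth R W N oddsq_dvd ids.
have prod (A B : nat -> nat -> R) : \sum_(1 <= u < M.+1) \sum_(1 <= u' < M.+1) \sum_(1 <= v < N.+1) \sum_(1 <= v' < N.+1)
   A u u' * B v v' = (\sum_(1 <= u < M.+1) \sum_(1 <= u' < M.+1) A u u') * \sum_(1 <= v < N.+1) \sum_(1 <= v' < N.+1) B v v'.
  rewrite mulr_suml; apply: eq_bigr => u _; rewrite mulr_suml; apply: eq_bigr => u' _.
  by rewrite mulr_sumr; apply: eq_bigr => v _; rewrite mulr_sumr.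
apply: lerD; rewrite prod; apply: ler_pM => //; try by do 2!(apply: sumr_ge0 => ? _); rewrite mulr_ge0.
  rewrite exchange_big /=; apply: le_trans sd; do 2!(apply: ler_sum => ? _).
  by rewrite /cd cofw_sym.
rewrite exchange_big /=; apply: le_trans se; do 2!(apply: ler_sum => ? _).
by rewrite /ce cofw_sym.
Qed.

End Box.

(** * Summation over boxes *)

Section FourthRoot.
Variable R : realType.
Implicit Types y z : R.

Definition rt4 z : R := Num.sqrt (Num.sqrt z).

Lemma rt4_ge0 z : 0 <= rt4 z. Proof. exact: sqrtr_ge0. Qed.
Lemma rt4_gt0 z : 0 < z -> 0 < rt4 z. Proof. by move=> z0; rewrite !sqrtr_gt0. Qed.
Lemma rt4K z : 0 <= z -> rt4 z ^+ 4 = z.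
Proof. by move=> z0; rewrite -[4%N]/(2 * 2)%N exprM sqr_sqrtr ?sqrtr_ge0 // sqr_sqrtr. Qed.
Lemma rt4_sqr z : 0 <= z -> rt4 z ^+ 2 = Num.sqrt z.
Proof. by move=> z0; rewrite sqr_sqrtr ?sqrtr_ge0. Qed.
Lemma le_rt4 y z : y <= z -> rt4 y <= rt4 z.
Proof. by move=> yz; rewrite ler_wsqrtr // ler_wsqrtr. Qed.

Lemma ler_rt4 y z : 0 <= y -> y ^+ 4 <= z -> y <= rt4 z.
Proof.
move=> y0 yz; have z0 : 0 <= z by apply: le_trans yz; exact: exprn_ge0.
by rewrite -(@ler_pXn2r _ 4) // ?nnegrE ?rt4_ge0 // rt4K.
Qed.

Local Notation r n := (rt4 n%:R).

(** Telescopes: with [a], [b] consecutive fourth roots,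
    [1 = a ^ 4 - b ^ 4 <= 4 * (a - b) * a ^ 3]. *)
Lemma sum_inv_rt4_cube n : \sum_(1 <= k < n.+1) (r k)^-1 ^+ 3 <= 4 * r n.
Proof.
elim: n => [|n IH]; first by rewrite big_geq // mulr_ge0 ?rt4_ge0.
rewrite big_nat_recr //=; apply: le_trans (lerD IH (lexx _)) _.
have a0 : 0 < r n.+1 by rewrite rt4_gt0 ?ltr0n.
have b0 : 0 <= r n by exact: rt4_ge0.
have ba : r n <= r n.+1 by rewrite le_rt4 // ler_nat.
have e : r n.+1 ^+ 4 - r n ^+ 4 = 1 by rewrite !rt4K // -natrB // subSnn.
move: e a0 b0 ba; set a := r n.+1; set b := r n => e a0 b0 ba.
suff h : 1 <= 4 * (a - b) * a ^+ 3.
  have a3 : 0 < a ^+ 3 by rewrite exprn_gt0.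
  have : a^-1 ^+ 3 <= 4 * (a - b) by rewrite exprVn -[_^-1]mul1r ler_pdivrMr.
  lra.
have c1 : b ^+ 3 <= a ^+ 3 by rewrite lerXn2r ?nnegrE // ltW.
have c2 : a ^+ 2 * b <= a ^+ 3 by rewrite [leRHS]exprSr ler_wpM2l // exprn_ge0 // ltW.
have c3 : a * b ^+ 2 <= a ^+ 3 by rewrite [leRHS]exprS (ler_wpM2l (ltW a0)) // lerXn2r ?nnegrE // ltW.
rewrite [leLHS](_ : _ = (a - b) * (a ^+ 3 + a ^+ 2 * b + a * b ^+ 2 + b ^+ 3)); last by rewrite -e; ring.
rewrite [leRHS](_ : _ = (a - b) * (4 * a ^+ 3)); last by ring.
by apply: ler_wpM2l; [rewrite subr_ge0|lra].
Qed.

Lemma sum_inv_rt4_sqr n : \sum_(1 <= k < n.+1) (r k)^-1 ^+ 2 <= 2 * r n ^+ 2.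
Proof.
elim: n => [|n IH]; first by rewrite big_geq // mulr_ge0 ?exprn_ge0 ?rt4_ge0.
rewrite big_nat_recr //=; apply: le_trans (lerD IH (lexx _)) _.
have a0 : 0 < r n.+1 by rewrite rt4_gt0 ?ltr0n.
have b0 : 0 <= r n by exact: rt4_ge0.
have ba : r n <= r n.+1 by rewrite le_rt4 // ler_nat.
have e : r n.+1 ^+ 4 - r n ^+ 4 = 1 by rewrite !rt4K // -natrB // subSnn.
move: e a0 b0 ba; set a := r n.+1; set b := r n => e a0 b0 ba.
have a2 : 0 < a ^+ 2 by rewrite exprn_gt0.
have c1 : b ^+ 2 <= a ^+ 2 by rewrite lerXn2r ?nnegrE // ltW.
have h : 1 <= 2 * (a ^+ 2 - b ^+ 2) * a ^+ 2.
  rewrite [leLHS](_ : _ = (a ^+ 2 - b ^+ 2) * (a ^+ 2 + b ^+ 2)); last by rewrite -e; ring.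
  rewrite [leRHS](_ : _ = (a ^+ 2 - b ^+ 2) * (2 * a ^+ 2)); last by ring.
  by apply: ler_wpM2l; [rewrite subr_ge0|lra].
have : a^-1 ^+ 2 <= 2 * (a ^+ 2 - b ^+ 2) by rewrite exprVn -[_^-1]mul1r ler_pdivrMr.
lra.
Qed.

(** A discrete Beta integral. One of [j.+1] and [n - j] is always at least [n / 2]; its factor is
    replaced by its size at [n], and the other is summed. *)
Lemma sum_inv_rt4_mixed n : (0 < n)%N ->
  \sum_(0 <= j < n) (r j.+1)^-1 ^+ 3 * (r (n - j))^-1 ^+ 2 <= 32 * (r n)^-1.
Proof.
move=> n0; have rn0 : 0 < r n by rewrite rt4_gt0 ?ltr0n.
have half k : (n <= k.*2)%N -> (r k)^-1 <= 2 * (r n)^-1.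
  move=> nk; have k0 : (0 < k)%N by lia.
  have rk0 : 0 < r k by rewrite rt4_gt0 ?ltr0n.
  rewrite -invf_div lef_pV2 ?posrE ?divr_gt0 // ler_pdivrMr // mulrC.
  rewrite -(@ler_pXn2r _ 4) ?nnegrE ?mulr_ge0 ?rt4_ge0 // exprMn !rt4K //.
  rewrite -!natrX -natrM ler_nat; lia.
have ip k : 0 <= (r k)^-1 by rewrite invr_ge0 rt4_ge0.
apply: (@le_trans _ _ (\sum_(0 <= j < n) ((r j.+1)^-1 ^+ 3 * (4 * (r n)^-1 ^+ 2) + (8 * (r n)^-1 ^+ 3) * (r (n - j))^-1 ^+ 2))).
  rewrite big_nat [leRHS]big_nat; apply: ler_sum => j jn.
  case: (leqP n (n - j).*2) => h.
    apply: ler_wpDr; first by rewrite !mulr_ge0 ?exprn_ge0.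
    rewrite ler_wpM2l ?exprn_ge0 // (_ : 4 * _ = (2 * (r n)^-1) ^+ 2); last by ring.
    by rewrite lerXn2r ?nnegrE ?mulr_ge0 // half.
  apply: ler_wpDl; first by rewrite !mulr_ge0 ?exprn_ge0.
  rewrite ler_wpM2r ?exprn_ge0 // (_ : 8 * _ = (2 * (r n)^-1) ^+ 3); last by ring.
  rewrite lerXn2r ?nnegrE ?mulr_ge0 // half //; lia.
rewrite big_split /= -mulr_suml -mulr_sumr.
have s1 : \sum_(0 <= j < n) (r j.+1)^-1 ^+ 3 <= 4 * r n.
  by apply: le_trans (sum_inv_rt4_cube n); rewrite big_add1.
have s2 : \sum_(0 <= j < n) (r (n - j))^-1 ^+ 2 <= 2 * r n ^+ 2.
  apply: le_trans (sum_inv_rt4_sqr n); rewrite [leRHS]big_add1 /= big_nat_rev /= add0n.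
  rewrite le_eqVlt; apply/orP; left; apply/eqP; apply: eq_big_nat => j jn; congr ((r _)^-1 ^+ 2); lia.
apply: le_trans (lerD (ler_wpM2r _ s1) (ler_wpM2l _ s2)) _; rewrite ?mulr_ge0 ?exprn_ge0 //.
by rewrite le_eqVlt; apply/orP; left; apply/eqP; field; rewrite lt0r_neq0.
Qed.

End FourthRoot.

(** * Density bounds in the form needed for boxes and for small variables *)

Section Regions.
Variable R : realType.

Lemma rchar_intr q (f : nat -> int) : rchar q f -> rchar q (fun n => (f n)%:~R : R).
Proof.
case=> q0 f1 fM fv fm fs; split=> // [|a b|n|n|]; rewrite ?f1 ?fM ?rmorphM ?fm //.
  by case: (fv n) => ->; [constructor 1|constructor 2|constructor 3]; rewrite ?mulrN1z.
by rewrite -rmorph_sum /= fs.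
Qed.

Lemma one4E n : one4 n = sqf_all (fun p => p %% 4 == 1)%N n. Proof. by []. Qed.

Lemma chi4_one4 p : (p %% 4 == 1)%N -> (chi4 p)%:~R = 1 :> R.
Proof.
move=> p4; rewrite /chi4 p4; have -> : odd p by rewrite (divn_eq p 4) (eqP p4) oddD oddM andbF.
by [].
Qed.

Lemma harm_le_id x : harm R x <= x%:R.
Proof.
apply: (@le_trans _ _ (\sum_(1 <= n < x.+1) 1)); last by rewrite sumr_const_nat subn1.
rewrite /harm big_nat [leRHS]big_nat; apply: ler_sum => n /andP[n0 _].
by rewrite invf_le1 ?ltr0n // ler1n.
Qed.

(** [M %/ i >= W >= i], so [M] is at most the cube of the quotient and dividing by [i] costs only a
    constant in the logarithm. *)
Lemma div_cube_bound M W i : (2 <= W)%N -> (W ^ 2 <= M)%N -> (0 < i <= W)%N ->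
  (2 <= M %/ i)%N /\ ln (M%:R : R) <= 3 * ln ((M %/ i)%:R).
Proof.
move=> W2 WM /andP[i0 iW]; set x := (M %/ i)%N.
have xW : (W <= x)%N.
  apply: leq_trans (leq_div2l M i0 iW).
  by rewrite leq_divRL ?mulnn // (leq_trans i0 iW).
have x2 : (2 <= x)%N by exact: leq_trans xW.
split=> //; have x0 : (0 < x)%N by exact: ltnW.
have M0 : (0 < M)%N by apply: leq_trans WM; rewrite expn_gt0 (leq_trans _ W2).
have Mx : (M <= x ^ 3)%N.
  have h1 : (M < x.+1 * i)%N by rewrite -ltn_divLR.
  have h2 : (x.+1 * i <= x.+1 * x)%N by rewrite leq_mul2l (leq_trans iW xW) orbT.
  apply: leq_trans (ltnW h1) (leq_trans h2 _).
  by rewrite (expnS x 2) mulnC leq_mul2l -mulnn; apply/orP; right; nia.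
apply: le_trans (le_ln_nat R M0 Mx) _.
by rewrite natrX lnXn ?ltr0n // -[_ *+ 3]mulr_natl.
Qed.

(** [density_rchar_tau] for [chi4] is applied at each [M %/ i]; the quotients [M / i] sum to
    [M * harm W]. The third power of [rt4] is the saving 3/4. *)
Lemma smooth_gweight M W : (2 <= W)%N -> (W ^ 2 <= M)%N ->
  rt4 (ln M%:R) ^+ 3 * smooth_sum (@gweight R) M W <= 64 * M%:R * harm R W.
Proof.
move=> W2 WM; rewrite /smooth_sum /harm !mulr_sumr big_nat [leRHS]big_nat.
apply: ler_sum => i hi; have [x2 hx] := div_cube_bound W2 WM hi.
set x := (M %/ i)%N in x2 hx *.
have lM0 : 0 <= ln (M%:R : R) by exact: ln_nat_ge0.
apply: (@le_trans _ _ (64 * x%:R)); last by rewrite -mulrA ler_wpM2l // natr_div_le.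
set A := \sum_(1 <= n < _) _.
have A0 : 0 <= A by apply: sumr_ge0 => n _; rewrite divr_ge0.
have hA := density_rchar_tau x2 (rchar_intr rchar_chi4) (fun p _ h => chi4_one4 h).
rewrite -/A in hA.
rewrite -(@ler_pXn2r _ 4) ?nnegrE ?mulr_ge0 ?exprn_ge0 ?rt4_ge0 //.
rewrite exprMn -exprM -[(3 * 4)%N]/(4 * 3)%N exprM rt4K //.
apply: (@le_trans _ _ ((3 * ln x%:R) ^+ 3 * A ^+ 4)).
  by rewrite ler_wpM2r ?exprn_ge0 // lerXn2r ?nnegrE ?mulr_ge0 ?ln_nat_ge0.
rewrite exprMn -mulrA; apply: le_trans (ler_wpM2l _ hA) _; first exact: exprn_ge0.
apply: (@le_trans _ _ (3 ^+ 3 * (32 ^+ 3 * x%:R ^+ 4 * 5))).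
  rewrite ler_wpM2l ?exprn_ge0 // ler_wpM2l ?mulr_ge0 ?exprn_ge0 //.
  by have := harm_le_id 4; lra.
rewrite exprMn (_ : _ * _ = 3 ^+ 3 * 32 ^+ 3 * 5 * x%:R ^+ 4); last by ring.
(* The constant 64 works because its fourth power [2 ^ 9 * 32 ^ 3] exceeds [3 ^ 3 * 5 * 32 ^ 3]. *)
rewrite ler_wpM2r ?exprn_ge0 // -!natrX -!natrM ler_nat.
have -> : (64 ^ 4 = 2 ^ 9 * 32 ^ 3)%N by rewrite -[64%N]/(2 ^ 6)%N -[32%N]/(2 ^ 5)%N -!expnM -!expnD.
by rewrite mulnAC leq_mul2r; apply/orP; right.
Qed.

Lemma smooth_hweight M W : (2 <= W)%N -> (W ^ 2 <= M)%N ->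
  rt4 (ln M%:R) ^+ 2 * smooth_sum (@hweight R) M W <= 64 * M%:R * harm R W.
Proof.
move=> W2 WM; rewrite /smooth_sum /harm !mulr_sumr big_nat [leRHS]big_nat.
apply: ler_sum => i hi; have [x2 hx] := div_cube_bound W2 WM hi.
set x := (M %/ i)%N in x2 hx *.
have lM0 : 0 <= ln (M%:R : R) by exact: ln_nat_ge0.
apply: (@le_trans _ _ (64 * x%:R)); last by rewrite -mulrA ler_wpM2l // natr_div_le.
set A := \sum_(1 <= n < _) _.
have A0 : 0 <= A by apply: sumr_ge0 => n _; rewrite divr_ge0.
have hA := density_tau R odd x2.
have eA : \sum_(1 <= n < x.+1) (sqf_all odd n)%:R / (tau n)%:R = A.
  by apply: eq_bigr => n _; rewrite /hweight oddsqE.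
rewrite eA in hA.
rewrite -(@ler_pXn2r _ 2) ?nnegrE ?mulr_ge0 ?exprn_ge0 ?rt4_ge0 //.
rewrite exprMn -exprM rt4K //.
apply: (@le_trans _ _ ((3 * ln x%:R) * A ^+ 2)); first by rewrite ler_wpM2r ?exprn_ge0.
rewrite -mulrA; apply: le_trans (ler_wpM2l _ hA) _ => //.
by rewrite exprMn mulrA ler_wpM2r ?exprn_ge0 // -!natrX -!natrM ler_nat.
Qed.

(** Since [i <= V] and [V ^ 4 <= X], the quotient [X %/ i] has a square at least [X], so [ln X] may
    replace its logarithm. [B] stands for the density. *)
Lemma density_cut (Q : pred nat) q (f : nat -> R) X V i B : (2 <= V)%N -> (V ^ 4 <= X)%N -> (0 < i <= V)%N ->
  rchar q f -> (forall p, prime p -> Q p -> f p = 1) ->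
  0 <= B -> 512 * (harm R q + 1) <= ln X%:R * B ^+ 2 ->
  \sum_(1 <= n < (X %/ i).+1) (sqf_all Q n)%:R <= X%:R / i%:R * B.
Proof.
move=> V2 VX /andP[i0 iV] cf fQ B0 hB.
set x := (X %/ i)%N.
have X0 : (0 < X)%N by apply: leq_trans VX; rewrite expn_gt0 (leq_trans _ V2).
have xV : (V ^ 3 <= x)%N.
  apply: leq_trans (leq_div2l X i0 iV).
  by rewrite leq_divRL -?expnSr // (leq_trans i0 iV).
have V3 : (V * 4 <= V ^ 3)%N by rewrite (expnS V 2) leq_mul2l -[4%N]/(2 ^ 2)%N leq_exp2r // V2 orbT.
have x2 : (2 <= x)%N by apply: leq_trans xV; apply: leq_trans V3; lia.
have Xx : (X <= x ^ 2)%N.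
  have h1 : (X < x.+1 * i)%N by rewrite -ltn_divLR.
  have h2 : (x.+1 * i <= x.+1 * V)%N by rewrite leq_mul2l iV orbT.
  apply: leq_trans (ltnW h1) (leq_trans h2 _).
  by rewrite -mulnn; nia.
have lX : ln (X%:R : R) <= 2 * ln x%:R.
  apply: le_trans (le_ln_nat R X0 Xx) _.
  by rewrite natrX lnXn ?ltr0n 1?ltnW // -[_ *+ 2]mulr_natl.
have hA := density_rchar x2 cf fQ.
apply: (@le_trans _ _ (x%:R * B)); last by rewrite ler_wpM2r // natr_div_le.
set A := \sum_(1 <= n < _) _ in hA *.
have A0 : 0 <= A by apply: sumr_ge0.
have lx0 : 0 < ln (x%:R : R) by rewrite ln_gt0 // ltr1n.
rewrite -(@ler_pXn2r _ 2) ?nnegrE ?mulr_ge0 // -(ler_pM2l lx0).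
apply: le_trans hA _.
apply: (@le_trans _ _ (x%:R ^+ 2 * (2^-1 * (ln X%:R * B ^+ 2)))).
  rewrite (_ : 256 * _ * _ = x%:R ^+ 2 * (2^-1 * (512 * (harm R q + 1)))); last by field.
  by rewrite ler_wpM2l ?exprn_ge0 // ler_wpM2l ?invr_ge0.
rewrite exprMn [leRHS]mulrCA; apply: ler_wpM2l; first exact: exprn_ge0.
have : ln X%:R * B ^+ 2 <= 2 * ln x%:R * B ^+ 2 by rewrite ler_wpM2r ?exprn_ge0.
by set u := ln X%:R * _; rewrite -mulrA; lra.
Qed.

End Regions.

(** * Little-o bound for the number of pairs *)

Section Total.
Variable R : realType.

(** For fixed [d] every prime of [e] has [psi s d p = 1]. The condition [s || (d != 1)], which
    removes the form with leading coefficient 1, makes this character nonprincipal; its modulus is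
    at most [8 * V]. *)
Lemma region_small_d (s t : bool) X V (B : R) : (2 <= V)%N -> (V ^ 4 <= X)%N ->
  0 <= B -> 512 * (harm R (8 * V) + 1) <= ln X%:R * B ^+ 2 ->
  \sum_(1 <= d < X.+1) \sum_(1 <= e < X.+1)
    ([&& (d <= V)%N, s || (d != 1)%N, (d * e <= X)%N & good s t d e])%:R <= X%:R * B * harm R V.
Proof.
move=> V2 VX B0 hB.
have VleX : (V <= X)%N by apply: leq_trans VX; rewrite -{1}(expn1 V) leq_pexp2l // ltnW.
rewrite (big_cat_nat (n := V.+1)) //= [X in _ + X](_ : _ = 0) ?addr0; last first.
  by rewrite big_nat big1 // => d /andP[dV _]; rewrite big1 // => e _; rewrite leqNgt dV.
rewrite /harm mulr_sumr big_nat [leRHS]big_nat; apply: ler_sum => d hd.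
have /andP[d0 _] := hd.
case: (boolP ((s || (d != 1)%N) && one4 d)) => [/andP[sd o4]|h]; last first.
  rewrite big1 => [|e _]; first by rewrite !mulr_ge0 ?invr_ge0.
  by rewrite /good; move: h; case: (s || _) => /= [/negPf ->|_]; rewrite !andbF.
rewrite (@sum_cut _ _ _ d) // => [|e]; last by rewrite mulnC ltnNge => /negPf ->; rewrite !andbF.
pose Q p := odd p && (leg p (2 ^ s * d) == 1).
have cf := rchar_intr R (rchar_psi (one4_oddsq o4) sd).
apply: (@le_trans _ _ (\sum_(1 <= e < (X %/ d).+1) (sqf_all Q e)%:R)).
  apply: ler_sum => e _; rewrite ler_nat; case: (boolP (sqf_all Q e)) => [_|]; first exact: leq_b1.
  rewrite leqn0 eqb0; apply: contra => /and4P[_ _ _ /and4P[_ oe _ g]].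
  move: oe; rewrite oddsqE => /andP[sq /allP od]; rewrite /sqf_all sq /=.
  by apply/allP => p pe; rewrite /Q od //=; exact: (allP g).
rewrite mulrAC.
apply: (density_cut V2 VX _ cf) => //.
- by move=> p pp /andP[op /eqP]; rewrite leg_psi // => ->.
- apply: le_trans hB; rewrite ler_wpM2l // lerD2r le_harm // leq_mul2l.
  by move: hd; rewrite ltnS => /andP[_ ->]; rewrite orbT.
Qed.

(** For fixed [e] the primes of [d] lie in the class 1 mod 4, and [chi4] gives density zero. *)
Lemma region_small_e (s t : bool) X V (B : R) : (2 <= V)%N -> (V ^ 4 <= X)%N ->
  0 <= B -> 512 * (harm R (8 * V) + 1) <= ln X%:R * B ^+ 2 ->
  \sum_(1 <= d < X.+1) \sum_(1 <= e < X.+1)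
    ([&& (e <= V)%N, (d * e <= X)%N & good s t d e])%:R <= X%:R * B * harm R V.
Proof.
move=> V2 VX B0 hB.
have VleX : (V <= X)%N by apply: leq_trans VX; rewrite -{1}(expn1 V) leq_pexp2l // ltnW.
rewrite exchange_big (big_cat_nat (n := V.+1)) //= [X in _ + X](_ : _ = 0) ?addr0; last first.
  by rewrite big_nat big1 // => e /andP[eV _]; rewrite big1 // => d _; rewrite leqNgt eV.
rewrite /harm mulr_sumr big_nat [leRHS]big_nat; apply: ler_sum => e he.
have /andP[e0 _] := he.
rewrite (@sum_cut _ _ _ e) // => [|d]; last by rewrite ltnNge => /negPf ->; rewrite !andbF.
apply: (@le_trans _ _ (\sum_(1 <= d < (X %/ e).+1) (sqf_all (fun p => p %% 4 == 1)%N d)%:R)).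
  apply: ler_sum => d _; rewrite ler_nat -one4E; case: (boolP (one4 d)) => [_|]; first exact: leq_b1.
  by rewrite leqn0 eqb0; apply: contra => /and3P[_ _ /and4P[]].
rewrite mulrAC.
apply: (density_cut V2 VX _ (rchar_intr R rchar_chi4)) => //.
- by move=> p _; exact: chi4_one4.
- by apply: le_trans hB; rewrite ler_wpM2l // lerD2r le_harm //; lia.
Qed.

Lemma ln2_bounds : 1 / 2 <= ln (2 : R) <= 1.
Proof.
have h1 : ln (2^-1 : R) <= 2^-1 - 1 by apply: ln_le_sub1; rewrite invr_gt0.
have h2 : ln (2 : R) <= 2 - 1 by apply: ln_le_sub1.
by apply/andP; split; [move: h1; rewrite lnV ?posrE //; lra | lra].
Qed.

Lemma half_ln_pow2 k n : (0 < n)%N -> (2 ^ k <= n)%N -> k%:R / 2 <= ln (n%:R : R).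
Proof.
move=> n0 kn; have k0 : (0 < 2 ^ k)%N by rewrite expn_gt0.
apply: le_trans (le_ln_nat R k0 kn); rewrite natrX lnXn // -[ln _ *+ k]mulr_natl ler_wpM2l //.
by have /andP[h _] := ln2_bounds; rewrite -div1r.
Qed.

Lemma inv_rt4_le k (z : R) : (0 < k)%N -> k%:R / 2 <= z -> (rt4 z)^-1 <= 2 * (rt4 (k%:R : R))^-1.
Proof.
move=> k0 kz; have k0' : 0 < k%:R :> R by rewrite ltr0n.
have z0 : 0 < z by apply: lt_le_trans kz; rewrite divr_gt0.
have r0 := rt4_gt0 k0'; have rz := rt4_gt0 z0.
rewrite -invf_div lef_pV2 ?posrE ?divr_gt0 // ler_pdivrMr //.
rewrite -(@ler_pXn2r _ 4) ?nnegrE ?mulr_ge0 ?rt4_ge0 // exprMn !rt4K // ?(ltW z0) //.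
lra.
Qed.

(** The number of ranges [V * 2 ^ j < d <= V * 2 ^ j.+1] allowed for: [e > V] and [d * e <= X] force
    [2 ^ j <= X / V ^ 2]. *)
Definition boxes X V := (trunc_log 2 (X %/ V ^ 2)).+1.

(** The number of boxes is of exact order log X: squaring [X < 2 ^ n * V ^ 2] and using [V ^ 4 <= X]
    gives [X < 4 ^ n]. *)
Lemma boxes_props X V : (2 <= V)%N -> (V ^ 4 <= X)%N ->
  (2 ^ (boxes X V).-1 * V ^ 2 <= X)%N /\ (X < 4 ^ boxes X V)%N.
Proof.
move=> V2 VX; have V0 : (0 < V ^ 2)%N by rewrite expn_gt0 (leq_trans _ V2).
have q0 : (0 < X %/ V ^ 2)%N.
  by rewrite divn_gt0 // (leq_trans _ VX) // leq_pexp2l // ltnW.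
have [h1 h2] : (2 ^ (boxes X V).-1 <= X %/ V ^ 2)%N /\ (X %/ V ^ 2 < 2 ^ boxes X V)%N.
  by split; [exact: trunc_logP | exact: trunc_log_ltn].
split; first by rewrite -leq_divRL.
move: h2; rewrite ltn_divLR // => h2.
have X0 : (0 < X)%N by apply: leq_trans VX; rewrite expn_gt0 (leq_trans _ V2).
rewrite -(ltn_pmul2l X0); apply: (@leq_trans ((2 ^ boxes X V * V ^ 2) ^ 2)).
  by rewrite -mulnn ltn_mul.
have -> : (4 ^ boxes X V = 2 ^ (boxes X V * 2))%N by rewrite -[4%N]/(2 ^ 2)%N -expnM mulnC.
by rewrite expnMn -!expnM mulnC leq_mul2r VX orbT.
Qed.

Lemma region_large s t X V : (2 <= V)%N -> (V ^ 4 <= X)%N ->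
  \sum_(1 <= d < X.+1) \sum_(1 <= e < X.+1)
    ([&& (V < d)%N, (V < e)%N, (d * e <= X)%N & good s t d e])%:R <=
  \sum_(0 <= j < boxes X V) \sum_(1 <= d < (V * 2 ^ j.+1).+1) \sum_(1 <= e < (X %/ (V * 2 ^ j)).+1)
    ([&& (V < d)%N, (V < e)%N & good s t d e])%:R :> R.
Proof.
move=> V2 VX; have V0 : (0 < V)%N by exact: leq_trans V2.
have [hb _] := boxes_props V2 VX.
pose T j d e : R := if (d <= V * 2 ^ j.+1)%N && (e <= X %/ (V * 2 ^ j))%N then
    ([&& (V < d)%N, (V < e)%N & good s t d e])%:R else 0.
have T0 j d e : 0 <= T j d e by rewrite /T; case: ifP.
apply: (@le_trans _ _ (\sum_(1 <= d < X.+1) \sum_(1 <= e < X.+1) \sum_(0 <= j < boxes X V) T j d e)).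
  rewrite big_nat [leRHS]big_nat; apply: ler_sum => d /andP[d0 dX].
  rewrite big_nat [leRHS]big_nat; apply: ler_sum => e /andP[e0 eX].
  case: (boolP [&& _, _, _ & _]) => [/and4P[Vd Ve de g]|_]; last by apply: sumr_ge0.
  have q0 : (0 < d.-1 %/ V)%N by rewrite divn_gt0 //; lia.
  (* The predecessor makes the dyadic ranges open on the left and closed on the right. *)
  set j := trunc_log 2 (d.-1 %/ V).
  have h1 : (2 ^ j * V <= d.-1)%N by rewrite -leq_divRL //; exact: trunc_logP.
  have h2 : (d.-1 < 2 ^ j.+1 * V)%N by rewrite -ltn_divLR //; exact: trunc_log_ltn.
  have h3 : (e * (V * 2 ^ j) <= X)%N.
    apply: leq_trans de; rewrite mulnC leq_mul2r; apply/orP; right.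
    by rewrite mulnC; apply: leq_trans h1 (leq_pred d).
  have jb : (j < boxes X V)%N.
    rewrite ltnS; apply: trunc_log_max => //; rewrite leq_divRL ?expn_gt0 ?V0 //.
    apply: leq_trans h3; rewrite mulnC -mulnn -mulnA leq_mul // ltnW //.
  apply: le_trans (@sum_ge_term R (fun j => T j d e) 0 (boxes X V) j (fun j => T0 j d e) jb).
  rewrite /T (_ : (d <= _)%N) /=; last by rewrite mulnC; lia.
  by rewrite leq_divRL ?h3 ?muln_gt0 ?V0 ?expn_gt0 // Vd Ve g.
have -> : \sum_(1 <= d < X.+1) \sum_(1 <= e < X.+1) \sum_(0 <= j < boxes X V) T j d e =
  \sum_(0 <= j < boxes X V) \sum_(1 <= d < X.+1) \sum_(1 <= e < X.+1) T j d e.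
  rewrite [RHS]exchange_big; apply: eq_bigr => d _; exact: exchange_big.
rewrite big_nat [leRHS]big_nat; apply: ler_sum => j /andP[_ jb].
have c1 : (V * 2 ^ j.+1 <= X)%N.
  apply: leq_trans hb; rewrite -mulnn mulnCA leq_mul //.
  by rewrite expnSr leq_mul // leq_pexp2l // -ltnS.
have c2 : (X %/ (V * 2 ^ j) <= X)%N by exact: leq_div.
rewrite (big_cat_nat (n := (V * 2 ^ j.+1).+1)) //= [X in _ + X](_ : _ = 0) ?addr0; last first.
  by rewrite big_nat big1 // => d /andP[h _]; rewrite big1 // => e _; rewrite /T leqNgt h.
rewrite big_nat [leRHS]big_nat; apply: ler_sum => d /andP[d0 dM].
rewrite (big_cat_nat (n := (X %/ (V * 2 ^ j)).+1)) //= [X in _ + X](_ : _ = 0) ?addr0; last first.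
  by rewrite big_nat big1 // => e /andP[h _]; rewrite /T [(e <= _)%N]leqNgt h andbF.
by apply: ler_sum => e _; rewrite /T; case: ifP.
Qed.

Definition total (s t : bool) X : R := \sum_(1 <= d < X.+1) \sum_(1 <= e < X.+1)
    ([&& s || (d != 1)%N, (d * e <= X)%N & good s t d e])%:R.

(** The three error terms come from small [d] or [e], from the bilinear bound over at most
    [1 + 2 * ln X] boxes, and from the factorisations with small factors, whose savings are
    convolved over the boxes. *)
Lemma total_bound : exists c, forall X W (del B : R) s t,
  (2 <= W)%N -> ((W ^ 2) ^ 4 <= X)%N ->
  0 <= del -> 2 ^+ 16 * harm R (X ^ 16) ^+ c <= del ^+ 32 * W%:R ->
  0 <= B -> 512 * (harm R (8 * W ^ 2) + 1) <= ln X%:R * B ^+ 2 ->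
  total s t X <= X%:R * (2 * B * harm R (W ^ 2) + 4 * (1 + 2 * ln X%:R) * del * harm R X ^+ 2 +
     2 ^+ 25 * harm R W ^+ 2 * (rt4 (ln X%:R))^-1).
Proof.
have [c hc] := box_bound R; exists c => X W del B s t W2 WX d0 hW B0 hB.
set V := (W ^ 2)%N in WX hB *.
have V4 : (4 <= V)%N by rewrite -[4%N]/(2 ^ 2)%N leq_exp2r.
have V2 : (2 <= V)%N by exact: leq_trans V4.
have V0 : (0 < V)%N by exact: leq_trans V2.
have X0 : (0 < X)%N by apply: leq_trans WX; rewrite expn_gt0 V0.
have lX := ln_nat_ge0 R X.
set n := boxes X V.
have [hb1 hb2] := boxes_props V2 WX; rewrite -/n in hb1 hb2.
have n0 : (0 < n)%N by [].
apply: (@le_trans _ _ (X%:R * B * harm R V + X%:R * B * harm R V +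
   \sum_(0 <= j < n) \sum_(1 <= d < (V * 2 ^ j.+1).+1) \sum_(1 <= e < (X %/ (V * 2 ^ j)).+1)
    ([&& (V < d)%N, (V < e)%N & good s t d e])%:R)).
  apply: le_trans (lerD (lerD (region_small_d s t V2 WX B0 hB) (region_small_e s t V2 WX B0 hB)) (region_large s t V2 WX)).
  rewrite -!big_split /=; apply: ler_sum => d _; rewrite -!big_split /=; apply: ler_sum => e _.
  rewrite [(d <= V)%N]leqNgt [(e <= V)%N]leqNgt -!natrD ler_nat.
  by case: (s || _); case: (_ <= X)%N; case: (good s t d e); case: (V < d)%N; case: (V < e)%N.
have nlX : n%:R <= 1 + 2 * ln X%:R :> R.
  have : (n.-1)%:R / 2 <= ln (X%:R : R).
    by apply: half_ln_pow2 => //; apply: leq_trans hb1; rewrite leq_pmulr // expn_gt0 V0.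
  have -> : n%:R = n.-1%:R + 1 :> R by rewrite -natr1.
  lra.
have rn : (rt4 (n%:R : R))^-1 <= 2 * (rt4 (ln (X%:R : R)))^-1.
  have Xn : ln (X%:R : R) <= 2 * n%:R.
    apply: le_trans (le_ln_nat R X0 (ltnW hb2)) _.
    rewrite natrX lnXn // -[ln _ *+ n]mulr_natl mulrC ler_wpM2r //.
    rewrite (_ : 4 = 2 * 2); last by ring.
    rewrite lnM ?posrE //; have /andP[_ h] := ln2_bounds; lra.
  have X2 : (1 < X)%N by apply: leq_trans WX; apply: leq_trans V2 _; rewrite -{1}(expn1 V) leq_pexp2l.
  have lX0 : 0 < ln (X%:R : R) by rewrite ln_gt0 // ltr1n.
  have r0 := rt4_gt0 lX0.
  have rn0 : 0 < rt4 (n%:R : R) by rewrite rt4_gt0 // ltr0n.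
  rewrite -invf_div lef_pV2 ?posrE ?divr_gt0 // ler_pdivrMr //.
  rewrite -(@ler_pXn2r _ 4) ?nnegrE ?mulr_ge0 ?rt4_ge0 // exprMn !rt4K //.
  by apply: le_trans Xn _; rewrite mulrC ler_wpM2l // -natrX ler_nat.
have hWg := harm_ge0 R W; have hXg := harm_ge0 R X.
have box j : (0 <= j < n)%N -> \sum_(1 <= d < (V * 2 ^ j.+1).+1) \sum_(1 <= e < (X %/ (V * 2 ^ j)).+1)
    ([&& (V < d)%N, (V < e)%N & good s t d e])%:R <=
    4 * X%:R * del * harm R X ^+ 2 +
    2 ^+ 19 * X%:R * harm R W ^+ 2 * ((rt4 (j.+1%:R : R))^-1 ^+ 3 * (rt4 ((n - j)%:R : R))^-1 ^+ 2).
  move=> /andP[_ jn]; set M := (V * 2 ^ j.+1)%N; set N := (X %/ (V * 2 ^ j))%N.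
  have MX : (M <= X)%N.
    apply: leq_trans hb1; rewrite /M -mulnn mulnCA leq_mul //.
    by rewrite expnSr leq_mul // leq_pexp2l // -ltnS prednK.
  have NX : (N <= X)%N by exact: leq_div.
  have MV : (V <= M)%N by rewrite leq_pmulr // expn_gt0.
  have e1 : (2 ^ j * 2 ^ (n - j).-1 = 2 ^ n.-1)%N by rewrite -expnD -[(n - j).-1]subn1 addnBA ?subn_gt0 // subnKC ?(ltnW jn) // subn1.
  (* In box [j] the logarithms of [M] and [N] are at least of order [j.+1] and [n - j], the two
     quantities convolved in [sum_inv_rt4_mixed]. *)
  have NV' : (V * 2 ^ (n - j).-1 <= N)%N.
    have q0 : (0 < V * 2 ^ j)%N by rewrite muln_gt0 V0 expn_gt0.
    have h : (V * 2 ^ (n - j).-1 * (V * 2 ^ j) = 2 ^ n.-1 * V ^ 2)%N by rewrite -e1 -mulnn; ring.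
    by rewrite /N (leq_divRL _ _ q0) h.
  have NV : (V <= N)%N by apply: leq_trans NV'; rewrite leq_pmulr // expn_gt0.
  have MN : M%:R * N%:R <= 2 * X%:R :> R.
    rewrite -!natrM ler_nat /M expnS mulnCA -mulnA leq_mul2l /= mulnC.
    exact: leq_trunc_div.
  have M0 : (0 < M)%N by exact: leq_trans MV.
  have N0 : (0 < N)%N by exact: leq_trans NV.
  have lM : j.+1%:R / 2 <= ln (M%:R : R) by apply: half_ln_pow2 => //; rewrite leq_pmull.
  have lN : (n - j)%:R / 2 <= ln (N%:R : R).
    apply: half_ln_pow2 => //; apply: leq_trans NV'.
    by rewrite -{1}(@prednK (n - j)) ?subn_gt0 // expnS leq_mul.
  have rM := inv_rt4_le (isT : 0 < j.+1)%N lM.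
  have nj0 : (0 < n - j)%N by rewrite subn_gt0.
  have rN := inv_rt4_le nj0 lN.
  have gM := smooth_gweight R W2 MV; have gN := smooth_hweight R W2 NV.
  have lM0 : 0 < ln (M%:R : R) by apply: lt_le_trans lM; rewrite divr_gt0.
  have lN0 : 0 < ln (N%:R : R) by apply: lt_le_trans lN; rewrite divr_gt0 // ltr0n subn_gt0.
  have pM := rt4_gt0 lM0; have pN := rt4_gt0 lN0.
  have iM : 0 <= (rt4 (j.+1%:R : R))^-1 by rewrite invr_ge0 rt4_ge0.
  have iN : 0 <= (rt4 ((n - j)%:R : R))^-1 by rewrite invr_ge0 rt4_ge0.
  apply: le_trans (hc X W M N del s t MX NX d0 hW) _; apply: lerD.
    have hMX := le_harm R MX; have hNX := le_harm R NX.
    have -> : 2 * (del * (M%:R * harm R M) * (N%:R * harm R N)) = (2 * del) * ((M%:R * N%:R) * (harm R M * harm R N)) by ring.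
    have -> : 4 * X%:R * del * harm R X ^+ 2 = (2 * del) * ((2 * X%:R) * (harm R X * harm R X)) by ring.
    by rewrite ler_wpM2l ?mulr_ge0 // ler_pM ?mulr_ge0 ?harm_ge0 // ler_pM ?harm_ge0.
  have gM' : smooth_sum (@gweight R) M W <= 64 * M%:R * harm R W * (8 * (rt4 (j.+1%:R : R))^-1 ^+ 3).
    apply: (@le_trans _ _ (64 * M%:R * harm R W * (rt4 (ln M%:R))^-1 ^+ 3)).
      by rewrite exprVn ler_pdivlMr ?exprn_gt0 // mulrC.
    rewrite ler_wpM2l ?mulr_ge0 // (_ : 8 * _ = (2 * (rt4 j.+1%:R)^-1) ^+ 3); last by ring.
    by rewrite lerXn2r ?nnegrE ?mulr_ge0 // invr_ge0 ltW.
  have gN' : smooth_sum (@hweight R) N W <= 64 * N%:R * harm R W * (4 * (rt4 ((n - j)%:R : R))^-1 ^+ 2).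
    apply: (@le_trans _ _ (64 * N%:R * harm R W * (rt4 (ln N%:R))^-1 ^+ 2)).
      by rewrite exprVn ler_pdivlMr ?exprn_gt0 // mulrC.
    rewrite ler_wpM2l ?mulr_ge0 // (_ : 4 * _ = (2 * (rt4 (n - j)%:R)^-1) ^+ 2); last by ring.
    by rewrite lerXn2r ?nnegrE ?mulr_ge0 // invr_ge0 ltW.
  have s0 f : (forall k, 0 <= f k) -> forall K, 0 <= smooth_sum f K W :> R.
    by move=> f0 K; apply: sumr_ge0 => i _; apply: sumr_ge0.
  have g0 : 0 <= smooth_sum (@gweight R) M W by apply: s0 => k; rewrite divr_ge0.
  have h0 : 0 <= smooth_sum (@hweight R) N W by apply: s0 => k; rewrite divr_ge0.
  (* The constants multiply to [2 * 64 * 64 * 8 * 4 = 2 ^ 18]; [M * N <= 2 * X] supplies the last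
     2. *)
  apply: le_trans (ler_wpM2l _ (ler_pM g0 h0 gM' gN')) _ => //.
  set a := (rt4 j.+1%:R)^-1 in iM *; set b := (rt4 _)^-1 in iN *.
  rewrite (_ : 2 * _ = (2 ^+ 18 * harm R W ^+ 2 * (a ^+ 3 * b ^+ 2)) * (M%:R * N%:R)); last by ring.
  rewrite (_ : 2 ^+ 19 * _ * _ * _ = (2 ^+ 18 * harm R W ^+ 2 * (a ^+ 3 * b ^+ 2)) * (2 * X%:R)); last by ring.
  by rewrite ler_wpM2l // !mulr_ge0 ?exprn_ge0.
have boxsum : \sum_(0 <= j < n) \sum_(1 <= d < (V * 2 ^ j.+1).+1) \sum_(1 <= e < (X %/ (V * 2 ^ j)).+1)
    ([&& (V < d)%N, (V < e)%N & good s t d e])%:R <=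
    (1 + 2 * ln X%:R) * (4 * X%:R * del * harm R X ^+ 2) +
    2 ^+ 19 * X%:R * harm R W ^+ 2 * (32 * (2 * (rt4 (ln X%:R))^-1)).
  apply: (@le_trans _ _ (\sum_(0 <= j < n) (4 * X%:R * del * harm R X ^+ 2 +
    2 ^+ 19 * X%:R * harm R W ^+ 2 * ((rt4 (j.+1%:R : R))^-1 ^+ 3 * (rt4 ((n - j)%:R : R))^-1 ^+ 2)))).
    by rewrite big_nat [leRHS]big_nat; apply: ler_sum.
  rewrite big_split /= sumr_const_nat subn0 -[_ *+ n]mulr_natl -mulr_sumr; apply: lerD.
    by rewrite ler_wpM2r // !mulr_ge0 ?exprn_ge0.
  rewrite ler_wpM2l ?mulr_ge0 ?exprn_ge0 //; apply: le_trans (sum_inv_rt4_mixed R n0) _.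
  by rewrite ler_wpM2l.
apply: le_trans (lerD (lexx _) boxsum) _.
by rewrite le_eqVlt; apply/orP; left; apply/eqP; ring.
Qed.

End Total.

(** * Choice of the parameters and passage to the limit *)

Section Limit.
Variable R : realType.

(** The exponential exceeds its Taylor term of degree [m.+1], and one factor [L] pays for the
    factorial. *)
Lemma power_le_expR m (L : R) : 1 <= L -> (m.+1`!)%:R <= L -> L ^+ m <= expR L.
Proof.
move=> L1 hL; have L0 : 0 <= L by exact: le_trans L1.
apply: le_trans (_ : L ^+ m.+1 / (m.+1`!)%:R <= _); last first.
  by apply: le_trans (expR_ge1Dxn m L0); rewrite lerDr.
by rewrite ler_pdivlMr ?ltr0n ?fact_gt0 // exprSr ler_wpM2l // exprn_ge0.
Qed.

(** Used with [y ^ 16 = ln X], so that log log X is absorbed by a small power of log X. *)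
Lemma one_plus_ln_le (y : R) : 0 < y -> 1 + ln (y ^+ 16) <= 16 * y.
Proof.
move=> y0; rewrite lnXn // -[ln _ *+ _]mulr_natl; have := ln_le_sub1 y0; lra.
Qed.

(** Everything is measured in [y], the 16th root of [L]. Each term is at most a constant times
    [Lam ^ 2 / y ^ 4], and [Lam <= 16 * K.+2 * y], so a factor [y ^ 2] is left over. *)
Lemma error_bound (K : nat) (L y Lam : R) (W X : nat) : (0 < W)%N -> (0 < X)%N -> L = ln X%:R ->
  1 <= L -> 0 < y -> rt4 L = y ^+ 4 -> y ^+ 16 = L ->
  Lam = 1 + ln W%:R -> ln (W%:R : R) <= K.+1%:R * ln L ->
  2 * (64 * Lam / Num.sqrt L) * harm R (W ^ 2) + 4 * (1 + 2 * L) * (L ^- 4) * harm R X ^+ 2 +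
     2 ^+ 25 * harm R W ^+ 2 * (rt4 L)^-1 <= 2 ^+ 34 * K.+2%:R ^+ 2 / y ^+ 2.
Proof.
move=> W0 X0 eL L1 y0 ey4 ey16 eLam hlnW.
have L0 : 0 < L by exact: lt_le_trans ltr01 L1.
have lW := ln_nat_ge0 R W.
have lL : 0 <= ln L by rewrite ln_ge0.
have Lam1 : 1 <= Lam by rewrite eLam lerDl.
have hW : harm R W <= Lam by rewrite eLam harm_le_ln.
have hW2 : harm R (W ^ 2) <= 2 * Lam.
  apply: le_trans (harm_le_ln _ _) _; first by rewrite expn_gt0 W0.
  rewrite natrX lnXn ?ltr0n // -[ln _ *+ _]mulr_natl eLam; lra.
have hX : harm R X <= 2 * L by apply: le_trans (harm_le_ln _ X0) _; rewrite -eL; lra.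
have y1 : 1 <= y.
  rewrite leNgt; apply/negP => hy; have : y ^+ 16 < 1 by apply: exprn_ilt1 => //; exact: ltW.
  by rewrite ey16 ltNge L1.
have hLam : Lam <= 16 * K.+2%:R * y.
  have h1 : Lam <= K.+2%:R * (1 + ln L).
    rewrite eLam mulrDr mulr1; apply: lerD; first by rewrite ler1n.
    by apply: le_trans hlnW _; rewrite ler_wpM2r // ler_nat.
  apply: le_trans h1 _; have := one_plus_ln_le y0; rewrite ey16 => h2.
  rewrite (_ : 16 * _ * _ = K.+2%:R * (16 * y)); last by ring.
  by rewrite ler_wpM2l.
have sL : Num.sqrt L = y ^+ 8 by rewrite -rt4_sqr ?ltW // ey4 -exprM.
have inv_le m n : (m <= n)%N -> (y ^+ n)^-1 <= (y ^+ m)^-1.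
  by move=> mn; rewrite lef_pV2 ?posrE ?exprn_gt0 // ler_weXn2l.
have ip n : 0 <= (y ^+ n)^-1 by rewrite invr_ge0 exprn_ge0 // ltW.
have Lam0 : 0 <= Lam by exact: le_trans Lam1.
have T1 : 2 * (64 * Lam / Num.sqrt L) * harm R (W ^ 2) <= 256 * Lam ^+ 2 * (y ^+ 4)^-1.
  rewrite sL; apply: (@le_trans _ _ (2 * (64 * Lam / y ^+ 8) * (2 * Lam))).
    by rewrite ler_wpM2l // !mulr_ge0.
  rewrite (_ : 2 * _ * _ = 256 * Lam ^+ 2 * (y ^+ 8)^-1); last by ring.
  by rewrite ler_wpM2l ?inv_le // mulr_ge0 ?exprn_ge0.
have T2 : 4 * (1 + 2 * L) * (L ^- 4) * harm R X ^+ 2 <= 48 * Lam ^+ 2 * (y ^+ 4)^-1.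
  have iL4 : 0 <= L ^- 4 by rewrite invr_ge0 exprn_ge0 // ltW.
  apply: (@le_trans _ _ (4 * (3 * L) * (L ^- 4) * (2 * L) ^+ 2)).
    apply: ler_pM; rewrite ?exprn_ge0 ?harm_ge0 //.
    - by rewrite !mulr_ge0 // addr_ge0 // mulr_ge0 // ltW.
    - by rewrite ler_wpM2r // ler_wpM2l //; lra.
    - by rewrite lerXn2r ?nnegrE ?harm_ge0 ?mulr_ge0 // ltW.
  rewrite (_ : 4 * _ * _ * _ = 48 * L^-1); last by field; rewrite lt0r_neq0.
  rewrite -mulrA ler_wpM2l // -ey16; apply: le_trans (inv_le 4 16 isT) _.
  by rewrite ler_peMl // exprn_ege1.
have T3 : 2 ^+ 25 * harm R W ^+ 2 * (rt4 L)^-1 <= 2 ^+ 25 * Lam ^+ 2 * (y ^+ 4)^-1.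
  rewrite ey4 ler_wpM2r // ler_wpM2l ?exprn_ge0 // lerXn2r ?nnegrE ?harm_ge0 //.
apply: (@le_trans _ _ (2 ^+ 26 * Lam ^+ 2 * (y ^+ 4)^-1)).
  have u0 : 0 <= Lam ^+ 2 * (y ^+ 4)^-1 by rewrite mulr_ge0 ?exprn_ge0.
  move: T1 T2 T3; rewrite -!(mulrA _ (Lam ^+ 2)); set u := Lam ^+ 2 * _.
  rewrite -/u in u0; have -> : 2 ^+ 26 * u = 2 ^+ 25 * u + 2 ^+ 25 * u by ring.
  have : 304 * u <= 2 ^+ 25 * u by rewrite ler_wpM2r // -natrX ler_nat.
  lra.
apply: (@le_trans _ _ (2 ^+ 26 * (16 * K.+2%:R * y) ^+ 2 * (y ^+ 4)^-1)).
  by rewrite ler_wpM2r // ler_wpM2l ?exprn_ge0 // lerXn2r ?nnegrE // !mulr_ge0 // ltW.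
rewrite le_eqVlt; apply/orP; left; apply/eqP; field; rewrite lt0r_neq0 //.
Qed.

(** Shows that the density [B = 64 * Lam / sqrt L] is admissible: the logarithm of a modulus up to
    [8 * W ^ 2] costs one factor [1 + ln W], and the square of [B] provides two. *)
Lemma small_modulus_bound (L : R) W : (0 < W)%N -> 0 < L ->
  512 * (harm R (8 * W ^ 2) + 1) <= L * (64 * (1 + ln W%:R) / Num.sqrt L) ^+ 2.
Proof.
move=> W0 L0; have lW := ln_nat_ge0 R W.
have h8 : harm R (8 * W ^ 2) <= 4 + 2 * ln W%:R.
  apply: le_trans (harm_le_ln _ _) _; first by rewrite muln_gt0 expn_gt0 W0.
  rewrite lnM_nat ?expn_gt0 ?W0 // natrX lnXn ?ltr0n // -[ln _ *+ 2]mulr_natl.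
  have -> : ln (8%:R : R) = 3 * ln 2.
    by rewrite -[8%N]/(2 ^ 3)%N natrX lnXn // [RHS]mulr_natl.
  have /andP[_ h] := ln2_bounds R; lra.
have s0 : Num.sqrt L != 0 by rewrite gt_eqF // sqrtr_gt0.
rewrite (_ : L * _ ^+ 2 = 4096 * (1 + ln W%:R) ^+ 2); last first.
  by rewrite -{1}(sqr_sqrtr (ltW L0)); field.
have : 1 + ln W%:R <= (1 + ln (W%:R : R)) ^+ 2 by rewrite ler_eXnr // lerDl.
move: h8 lW; set w := (1 + _) ^+ 2; set u := ln _; lra.
Qed.

Theorem total_little_o (eps : R) : 0 < eps -> exists X0, forall X s t, (X0 <= X)%N ->
  total R s t X <= eps * X%:R.
Proof.
move=> eps0; have [c hc] := total_bound R.
(* [W] is about [L ^ K]. In the exponent, 128 pays for the 32nd power of [del = L ^- 4], [2 * c] for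
   [harm R (X ^ 16) <= L ^ 2] to the power [c], and 1 for [2 ^ 16 <= L]. This [del] beats the factor
   [L ^ 3] of the boxes and two harmonic sums. *)
pose K := (129 + 2 * c)%N.
have eK : K = ((2 * c).+1 + 4 * 32)%N by rewrite /K; lia.
(* [W <= L ^ K.+1], so [W ^ 8 <= L ^ m], which must not exceed [expR L = X]. *)
pose m := (8 * K.+1)%N.
pose C : R := 2 ^+ 34 * K.+2%:R ^+ 2; pose z := C / eps.
have C0 : 0 <= C by rewrite mulr_ge0 ?exprn_ge0.
have z0 : 0 <= z by rewrite divr_ge0 // ltW.
(* One summand per threshold: the numerical constants, [power_le_expR], the final [z <= y], and
   [1 <= L]. *)
pose L0 : R := 2 ^+ 16 + (m.+1`!)%:R + z ^+ 16 + 1.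
have [L0a L0b L0c L0d] : [/\ 2 ^+ 16 <= L0, (m.+1`!)%:R <= L0, z ^+ 16 <= L0 & 1 <= L0].
  have gen (u v w : R) : 0 <= u -> 0 <= v -> 0 <= w ->
      [/\ u <= u + v + w + 1, v <= u + v + w + 1, w <= u + v + w + 1 & 1 <= u + v + w + 1].
    by move=> *; split; lra.
  by apply: gen; rewrite ?exprn_ge0.
exists (Num.truncn (expR L0)).+1 => X s t hX.
have X0 : (0 < X)%N by exact: leq_trans hX.
have eX : expR L0 <= X%:R.
  by apply: ltW; apply: lt_le_trans (truncnS_gt _) _; rewrite ler_nat.
pose L : R := ln X%:R.
have LL0 : L0 <= L by rewrite /L -ler_expR lnK // posrE ltr0n.
have eL : expR L = X%:R by rewrite /L lnK // posrE ltr0n.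
have La := le_trans L0a LL0; have Lb := le_trans L0b LL0; have Lc := le_trans L0c LL0; have Ld := le_trans L0d LL0.
have Lp : 0 < L by exact: lt_le_trans ltr01 Ld.
pose W := (Num.truncn (L ^+ K)).+1.
have LK0 : 0 <= L ^+ K by rewrite exprn_ge0 // ltW.
have W1 : L ^+ K <= W%:R by apply: ltW; exact: truncnS_gt.
have LK1 : 1 <= L ^+ K by exact: exprn_ege1.
have W2 : W%:R <= L ^+ K.+1.
  apply: (@le_trans _ _ (L ^+ K + 1)).
    rewrite /W -natr1 lerD2r; have := truncn_le (L ^+ K); by rewrite LK0.
  rewrite exprS; apply: (@le_trans _ _ (2 * L ^+ K)); first by rewrite mulr_natl mulr2n lerD2l.
  by rewrite ler_wpM2r // (le_trans _ La) // -{1}[2]expr1 ler_weXn2l // ler1n.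
have W0 : (0 < W)%N by [].
have two : (2 <= W)%N.
  rewrite -(ler_nat R) (le_trans _ W1) //; apply: le_trans (_ : L <= _).
    by rewrite (le_trans _ La) // -{1}[2]expr1 ler_weXn2l // ler1n.
  by rewrite ler_eXnr.
have LK10 : 0 <= L ^+ K.+1 by rewrite exprn_ge0 // ltW.
have W8 : ((W ^ 2) ^ 4 <= X)%N.
  have h : W%:R ^+ 8 <= (L ^+ K.+1) ^+ 8 by rewrite lerXn2r // nnegrE.
  rewrite -(ler_nat R) -expnM natrX -eL; apply: le_trans h _.
  rewrite -exprM mulnC; exact: power_le_expR.
have lnW : ln (W%:R : R) <= K.+1%:R * ln L.
  have W0' : 0 < W%:R :> R by rewrite ltr0n.
  by rewrite mulr_natl -lnXn // ler_ln // posrE exprn_gt0.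
pose Lam : R := 1 + ln W%:R.
have lW := ln_nat_ge0 R W.
have Lam1 : 1 <= Lam by rewrite /Lam lerDl.
pose y := rt4 (rt4 L).
have y0 : 0 < y by rewrite !rt4_gt0.
have y4 : rt4 L = y ^+ 4 by rewrite /y rt4K // rt4_ge0.
have y16 : y ^+ 16 = L by rewrite -[16%N]/(4 * 4)%N exprM -y4 rt4K // ltW.
have zy : z <= y.
  have h4 : z ^+ 4 <= rt4 L by apply: ler_rt4; rewrite ?exprn_ge0 // -exprM.
  exact: ler_rt4.
have y1 : 1 <= y.
  by apply: ler_rt4; rewrite ?expr1n //; apply: ler_rt4; rewrite ?expr1n.
have sLp : 0 < Num.sqrt L by rewrite sqrtr_gt0.
have hdel : 2 ^+ 16 * harm R (X ^ 16) ^+ c <= (L ^- 4) ^+ 32 * W%:R.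
  have X2 : (2 <= X)%N by apply: leq_trans W8; rewrite -expnM (leq_trans two) // -{1}(expn1 W) leq_pexp2l.
  have hX16 : harm R (X ^ 16) <= L ^+ 2.
    have := @harm_pow_le R X 16 X2 isT => h; apply: le_trans h _; rewrite -/L -natrM expr2 ler_wpM2r ?(ltW Lp) //.
    by rewrite (le_trans _ La) // -natrX ler_nat.
  apply: (@le_trans _ _ (L * (L ^+ 2) ^+ c)).
    by apply: ler_pM => //; rewrite ?exprn_ge0 ?harm_ge0 // lerXn2r ?nnegrE ?exprn_ge0 ?harm_ge0 // ltW.
  rewrite exprVn [leRHS]mulrC ler_pdivlMr ?exprn_gt0 // (le_trans _ W1) //.
  by rewrite eK (exprD L (2 * c).+1) (exprS L (2 * c)) (exprM L 2 c) (exprM L 4 32).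
have hB := small_modulus_bound W0 Lp.
have B0 : 0 <= 64 * Lam / Num.sqrt L by rewrite divr_ge0 ?mulr_ge0 ?(le_trans _ Lam1) // ltW.
have d0 : 0 <= L ^- 4 by rewrite invr_ge0 exprn_ge0 // ltW.
apply: le_trans (hc X W (L ^- 4) (64 * Lam / Num.sqrt L) s t two W8 d0 hdel B0 hB) _.
rewrite mulrC ler_wpM2r // -/L.
apply: le_trans (error_bound W0 X0 (erefl L) Ld y0 y4 y16 (erefl Lam) lnW) _.
by rewrite -/C ler_pdivrMr ?exprn_gt0 // mulrC -ler_pdivrMr // -/z (le_trans zy) // ler_eXnr.
Qed.

End Limit.

End Analytic.

Require Import Defs.
From Stdlib Require Import ZArith Reals.
From Coquelicot Require Import Coquelicot.
From Stdlib Require Import Lia Lra Psatz.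
From Stdlib Require Znumtheory QArith List ClassicalDescription.

(** * Local and global solubility *)
Module Solubility.
Import Znumtheory QArith.
Local Open Scope Z_scope.

Lemma coherent_ge (p : Z) (x : nat -> Z) (k j : nat) :
  Zp_coherent p x -> (p ^ Z.of_nat k | x (k + j)%nat - x k).
Proof.
intros h; induction j as [|j IH].
- rewrite Nat.add_0_r, Z.sub_diag; apply Z.divide_0_r.
- rewrite Nat.add_succ_r.
  replace (x (S (k + j)) - x k) with ((x (S (k + j)) - x (k + j)%nat) + (x (k + j)%nat - x k)) by ring.
  apply Z.divide_add_r; [|exact IH].
  apply Z.divide_trans with (p ^ Z.of_nat (k + j)); [|apply h].
  rewrite Nat2Z.inj_add, Z.pow_add_r by lia; apply Z.divide_factor_l.
Qed.

(** If [p] divides [X] and [Y], then [p ^ 2] divides [Z0], and by weighted homogeneity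
    [(p, p, p ^ 2)] can be divided out at the cost of [p ^ 4] in precision. This happens fewer than
    [k] times, so at least [p ^ 4] is left. *)
Lemma primitive_descent (p a c : Z) (k : nat) : prime p -> forall X Y Z0 : Z,
  ~ ((p ^ Z.of_nat k | X) /\ (p ^ Z.of_nat k | Y)) ->
  (p ^ Z.of_nat (4 * k + 4) | Z0 * Z0 - (a * X ^ 4 + c * Y ^ 4)) ->
  exists X' Y' Z' : Z, ~ ((p | X') /\ (p | Y')) /\
    (p ^ 4 | Z' * Z' - (a * X' ^ 4 + c * Y' ^ 4)).
Proof.
intros pp; assert (p1 : 1 < p) by (destruct pp; assumption).
assert (sq : forall z, (p * p | z * z) -> (p | z)).
{ intros z h; destruct (prime_mult p pp z z) as [h'|h']; auto.
  apply Z.divide_trans with (p * p); [apply Z.divide_factor_l | exact h]. }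
induction k as [|k IH]; intros X Y Z0 nd h.
- destruct nd; split; apply Z.divide_1_l.
- destruct (Zdivide_dec p X) as [[X' ->]|nX].
  2:{ exists X, Y, Z0; split; [tauto|]. apply Z.divide_trans with (2 := h).
      replace (Z.of_nat (4 * S k + 4)) with (4 + Z.of_nat (4 * k + 4)) by lia.
      rewrite Z.pow_add_r by lia; apply Z.divide_factor_l. }
  destruct (Zdivide_dec p Y) as [[Y' ->]|nY].
  2:{ exists (X' * p), Y, Z0; split; [tauto|]. apply Z.divide_trans with (2 := h).
      replace (Z.of_nat (4 * S k + 4)) with (4 + Z.of_nat (4 * k + 4)) by lia.
      rewrite Z.pow_add_r by lia; apply Z.divide_factor_l. }
  replace (Z.of_nat (4 * S k + 4)) with (4 + Z.of_nat (4 * k + 4)) in h by lia.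
  rewrite Z.pow_add_r in h by lia; destruct h as [q h].
  assert (h4 : Z0 * Z0 = p ^ 4 * (q * p ^ Z.of_nat (4 * k + 4) + (a * X' ^ 4 + c * Y' ^ 4))).
  { replace (Z0 * Z0) with ((Z0 * Z0 - (a * (X' * p) ^ 4 + c * (Y' * p) ^ 4)) +
      (a * (X' * p) ^ 4 + c * (Y' * p) ^ 4)) by ring. rewrite h; ring. }
  destruct (sq Z0) as [Z1 ->].
  { rewrite h4; exists (p * p * (q * p ^ Z.of_nat (4 * k + 4) + (a * X' ^ 4 + c * Y' ^ 4))); ring. }
  assert (h5 : Z1 * Z1 = p * p * (q * p ^ Z.of_nat (4 * k + 4) + (a * X' ^ 4 + c * Y' ^ 4))).
  { apply (Z.mul_reg_l _ _ (p * p)); [nia|].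
    transitivity (Z1 * p * (Z1 * p)); [ring|]. rewrite h4; ring. }
  destruct (sq Z1) as [Z2 ->].
  { rewrite h5; apply Z.divide_factor_l. }
  apply (IH X' Y' Z2).
  + intros [[u ->] [v ->]]; apply nd; rewrite Nat2Z.inj_succ, Z.pow_succ_r by lia; split;
      [exists u | exists v]; ring.
  + exists q.
    apply (Z.mul_reg_l _ _ (p * p)); [nia|].
    transitivity (Z2 * p * (Z2 * p) - p * p * (a * X' ^ 4 + c * Y' ^ 4)); [ring|].
    rewrite h5; ring.
Qed.

Lemma primitive_solution (p a c : Z) : prime p -> soluble_Qp p 0 a c ->
  exists X Y Z0 : Z, ~ ((p | X) /\ (p | Y)) /\ (p ^ 4 | Z0 * Z0 - (a * X ^ 4 + c * Y ^ 4)).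
Proof.
intros pp (x & y & z & hx & hy & hz & (k & nk) & e).
(* Makes [k + j] equal to [4 * k + 4], the precision at which the descent starts. *)
set (j := (3 * k + 4)%nat).
apply (primitive_descent p a c k pp (x (k + j)%nat) (y (k + j)%nat) (z (k + j)%nat)).
- assert (t : forall w, Zp_coherent p w -> (p ^ Z.of_nat k | w (k + j)%nat) -> (p ^ Z.of_nat k | w k)).
  { intros w hw d. replace (w k) with (w (k + j)%nat - (w (k + j)%nat - w k)) by ring.
    apply Z.divide_sub_r; [exact d | now apply coherent_ge]. }
  intros [dx dy]; destruct nk as [n|n]; apply n; now apply t.
- replace (4 * k + 4)%nat with (k + j)%nat by (unfold j; lia).
  replace (a * x (k + j)%nat ^ 4 + c * y (k + j)%nat ^ 4) with
    (a * x (k + j)%nat ^ 4 + 0 * x (k + j)%nat ^ 2 * y (k + j)%nat ^ 2 + c * y (k + j)%nat ^ 4) by ring.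
  apply e.
Qed.

Lemma prime_div_sq (p x : Z) : prime p -> (p | x * x) -> (p | x).
Proof. intros pp h; destruct (prime_mult p pp x x h); assumption. Qed.

Lemma prime_div_4 (p x : Z) : prime p -> (p | x ^ 4) -> (p | x).
Proof.
intros pp h; apply prime_div_sq; auto; apply prime_div_sq; auto.
replace (x * x * (x * x)) with (x ^ 4) by ring; assumption.
Qed.

(** Here [c = c2 * p ^ 2] with [a * c2 = (2 * m) ^ 2]. If [p] does not divide [X], reduction modulo
    [p] shows that [a] is a square. If it does, dividing by [p ^ 2] makes [c2] a square modulo [p],
    and hence also [a]. *)
Lemma local_square_coprime (p a c N : Z) : prime p -> ~ (p | 2) -> a * c = 4 * N ^ 2 ->
  (p | N) -> ~ (p * p | N) -> ~ (p | a) -> soluble_Qp p 0 a c ->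
  exists U V, ~ (p | V) /\ (p | a * (V * V) - U * U).
Proof.
intros pp p2 ac [m ->] nN na sol.
assert (p1 : 1 < p) by (destruct pp; assumption).
assert (nm : ~ (p | m)). { intros [q ->]; apply nN; exists q; ring. }
destruct (prime_mult p pp a c) as [h|[c1 ->]]; [|tauto|].
{ rewrite ac; exists (4 * m * (m * p)); ring. }
assert (ac1 : a * c1 = 4 * (m * m) * p).
{ apply (Z.mul_reg_r _ _ p); [lia|]. transitivity (a * (c1 * p)); [ring|]. rewrite ac; ring. }
destruct (prime_mult p pp a c1) as [h|[c2 ->]]; [|tauto|].
{ rewrite ac1; apply Z.divide_factor_r. }
assert (ac2 : a * c2 = 4 * (m * m)).
{ apply (Z.mul_reg_r _ _ p); [lia|]. transitivity (a * (c2 * p)); [ring|]. rewrite ac1; ring. }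
destruct (primitive_solution p a _ pp sol) as (X & Y & Z0 & prim & [q e]).
destruct (Zdivide_dec p X) as [[X1 ->]|nX].
- assert (nY : ~ (p | Y)). { intro; apply prim; split; [apply Z.divide_factor_r|assumption]. }
  destruct (prime_div_sq p Z0 pp) as [Z1 ->].
  { exists (q * p ^ 3 + a * X1 ^ 4 * p ^ 3 + c2 * p * Y ^ 4).
    replace (Z0 * Z0) with ((Z0 * Z0 - (a * (X1 * p) ^ 4 + c2 * p * p * Y ^ 4)) +
      (a * (X1 * p) ^ 4 + c2 * p * p * Y ^ 4)) by ring. rewrite e; ring. }
  assert (e1 : Z1 * Z1 = q * (p * p) + a * X1 ^ 4 * (p * p) + c2 * Y ^ 4).
  { apply (Z.mul_reg_r _ _ (p * p)); [nia|].
    transitivity (Z1 * p * (Z1 * p) - (a * (X1 * p) ^ 4 + c2 * p * p * Y ^ 4) +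
      (a * (X1 * p) ^ 4 + c2 * p * p * Y ^ 4)); [ring|]. rewrite e; ring. }
  assert (e2 : a * (Z1 * Z1) - 2 * m * (Y * Y) * (2 * m * (Y * Y)) =
     a * (q * p + a * X1 ^ 4 * p) * p).
  { rewrite e1. transitivity (a * (q * (p * p) + a * X1 ^ 4 * (p * p)) + (a * c2) * Y ^ 4 - 4 * (m * m) * Y ^ 4); [ring|].
    rewrite ac2; ring. }
  exists (2 * m * (Y * Y)), Z1; split.
  + intros [w ->].
    assert (h : (p | 2 * m * (Y * Y))).
    { apply prime_div_sq; auto.
      exists (a * (w * w * p) - a * (q * p + a * X1 ^ 4 * p)).
      replace (2 * m * (Y * Y) * (2 * m * (Y * Y))) with
       (a * (w * p * (w * p)) - (a * (w * p * (w * p)) - 2 * m * (Y * Y) * (2 * m * (Y * Y)))) by ring.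
      rewrite e2; ring. }
    destruct (prime_mult p pp _ _ h) as [h1|h1].
    * destruct (prime_mult p pp _ _ h1); tauto.
    * apply prime_div_sq in h1; auto.
  + rewrite e2; apply Z.divide_factor_r.
- exists Z0, (X * X); split.
  + intro h; apply prime_div_sq in h; auto.
  + exists (- (q * p ^ 3) - c2 * p * Y ^ 4).
    transitivity (- (Z0 * Z0 - (a * X ^ 4 + c2 * p * p * Y ^ 4)) - c2 * p * p * Y ^ 4); [ring|].
    rewrite e; ring.
Qed.

(** Both coefficients are divisible by [p] exactly once, so [p] divides [Z0], and after division by
    [p] the form itself vanishes modulo [p]. Multiplying by [a'] and using [a' * c1 = (2 * m) ^ 2]
    turns it into a sum of two squares. *)
Lemma local_square_divides (p a c N : Z) : prime p -> ~ (p | 2) -> a * c = 4 * N ^ 2 ->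
  (p | N) -> ~ (p * p | N) -> (p | a) -> ~ (p * p | a) -> soluble_Qp p 0 a c ->
  exists a' m X Y, a = a' * p /\ N = m * p /\ ~ (p | a') /\ ~ (p | 2 * m) /\ ~ (p | X) /\ ~ (p | Y) /\
    (p | a' * (X * X) * (a' * (X * X)) + 2 * m * (Y * Y) * (2 * m * (Y * Y))).
Proof.
intros pp p2 ac [m ->] nN [a' ->] na sol.
assert (p1 : 1 < p) by (destruct pp; assumption).
assert (nm : ~ (p | m)). { intros [q ->]; apply nN; exists q; ring. }
assert (na' : ~ (p | a')). { intros [q ->]; apply na; exists q; ring. }
assert (ac1 : a' * c = 4 * (m * m) * p).
{ apply (Z.mul_reg_r _ _ p); [lia|]. transitivity (a' * p * c); [ring|]. rewrite ac; ring. }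
destruct (prime_mult p pp a' c) as [h|[c1 ->]]; [|tauto|].
{ rewrite ac1; apply Z.divide_factor_r. }
assert (ac2 : a' * c1 = 4 * (m * m)).
{ apply (Z.mul_reg_r _ _ p); [lia|]. transitivity (a' * (c1 * p)); [ring|]. rewrite ac1; ring. }
destruct (primitive_solution p _ _ pp sol) as (X & Y & Z0 & prim & [q e]).
destruct (prime_div_sq p Z0 pp) as [Z1 ->].
{ exists (q * p ^ 3 + a' * X ^ 4 + c1 * Y ^ 4).
  replace (Z0 * Z0) with ((Z0 * Z0 - (a' * p * X ^ 4 + c1 * p * Y ^ 4)) +
      (a' * p * X ^ 4 + c1 * p * Y ^ 4)) by ring. rewrite e; ring. }
assert (e1 : a' * X ^ 4 + c1 * Y ^ 4 = (Z1 * Z1 - q * p ^ 2) * p).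
{ apply (Z.mul_reg_r _ _ p); [lia|].
  transitivity (Z1 * p * (Z1 * p) - (Z1 * p * (Z1 * p) - (a' * p * X ^ 4 + c1 * p * Y ^ 4))); [ring|].
  rewrite e; ring. }
assert (e2 : a' * (X * X) * (a' * (X * X)) + 2 * m * (Y * Y) * (2 * m * (Y * Y)) =
   a' * (Z1 * Z1 - q * p ^ 2) * p).
{ transitivity (a' * (a' * X ^ 4) + (4 * (m * m)) * Y ^ 4); [ring|].
  rewrite <- ac2. transitivity (a' * (a' * X ^ 4 + c1 * Y ^ 4)); [ring|]. rewrite e1; ring. }
assert (n2m : ~ (p | 2 * m)). { intro h; destruct (prime_mult p pp _ _ h); tauto. }
exists a', m, X, Y; repeat split; auto.
- intro hX; apply prim; split; auto.
  assert (h : (p | c1 * Y ^ 4)).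
  { replace (c1 * Y ^ 4) with ((a' * X ^ 4 + c1 * Y ^ 4) - a' * X ^ 4) by ring.
    apply Z.divide_sub_r; [rewrite e1; apply Z.divide_factor_r|].
    apply Z.divide_mul_r; destruct hX as [w ->]; exists (w ^ 4 * p ^ 3); ring. }
  destruct (prime_mult p pp _ _ h) as [h1|h1]; [|now apply prime_div_4].
  exfalso; apply n2m; apply prime_div_sq; auto.
  replace (2 * m * (2 * m)) with (4 * (m * m)) by ring; rewrite <- ac2; now apply Z.divide_mul_r.
- intro hY; apply prim; split; auto.
  assert (h : (p | a' * X ^ 4)).
  { replace (a' * X ^ 4) with ((a' * X ^ 4 + c1 * Y ^ 4) - c1 * Y ^ 4) by ring.
    apply Z.divide_sub_r; [rewrite e1; apply Z.divide_factor_r|].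
    apply Z.divide_mul_r; destruct hY as [w ->]; exists (w ^ 4 * p ^ 3); ring. }
  destruct (prime_mult p pp _ _ h) as [h1|h1]; [tauto | now apply prime_div_4].
- rewrite e2; apply Z.divide_factor_r.
Qed.

(** The coefficients have equal signs; were both negative, the form would be negative away from the
    origin. *)
Lemma soluble_R_pos (a c : Z) : 0 < a * c -> soluble_R 0 a c -> 0 < a.
Proof.
intros ac (x & y & z & nz & e); destruct (Z_lt_le_dec 0 a) as [h|h]; auto; exfalso.
assert (ha : a < 0). { assert (a <> 0) by (intros ->; lia). lia. }
assert (hc : c < 0) by nia.
apply IZR_lt in ha, hc; revert ha hc e nz; generalize (IZR a) (IZR c); intros A C hA hC e nz.
assert (x4 : (0 <= x * x * x * x)%R) by (replace (x*x*x*x)%R with ((x*x)*(x*x))%R by ring; apply Rle_0_sqr).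
assert (y4 : (0 <= y * y * y * y)%R) by (replace (y*y*y*y)%R with ((y*y)*(y*y))%R by ring; apply Rle_0_sqr).
assert (z2 : (0 <= z * z)%R) by apply Rle_0_sqr.
assert (pos : forall t, (t <> 0)%R -> (0 < t * t * t * t)%R).
{ intros t ht; assert (0 < t * t)%R by nra.
  replace (t*t*t*t)%R with ((t*t)*(t*t))%R by ring; apply Rmult_lt_0_compat; assumption. }
destruct nz as [n|n]; apply pos in n; nra.
Qed.

Lemma soluble_Q_integral (a c : Z) : soluble_Q 0 a c ->
  exists X Y W : Z, (X <> 0 \/ Y <> 0) /\ W * W = a * X ^ 4 + c * Y ^ 4.
Proof.
intros (x & y & z & nz & e).
(* Clears all denominators: [x] and [y] are scaled by [D], hence [z] by [D ^ 2]. *)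
set (D := Zpos (Qden x * Qden y * Qden z)).
exists (Qnum x * Zpos (Qden y * Qden z)), (Qnum y * Zpos (Qden x * Qden z)),
  (Qnum z * Zpos (Qden x * Qden y) * D); split.
- destruct (Z.eq_dec (Qnum x) 0) as [hx|hx]; [|left; nia].
  destruct (Z.eq_dec (Qnum y) 0) as [hy|hy]; [|right; nia].
  exfalso; apply nz; split; unfold Qeq; simpl; lia.
- assert (hx : (inject_Z (Qnum x * Zpos (Qden y * Qden z)) == x * inject_Z D)%Q).
  { unfold Qeq, D; simpl Qnum; simpl Qden; rewrite ?Pos2Z.inj_mul; ring. }
  assert (hy : (inject_Z (Qnum y * Zpos (Qden x * Qden z)) == y * inject_Z D)%Q).
  { unfold Qeq, D; simpl Qnum; simpl Qden; rewrite ?Pos2Z.inj_mul; ring. }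
  assert (hz : (inject_Z (Qnum z * Zpos (Qden x * Qden y) * D) == z * inject_Z D * inject_Z D)%Q).
  { unfold Qeq, D; simpl Qnum; simpl Qden; rewrite ?Pos2Z.inj_mul; ring. }
  revert hx hy hz; generalize (Qnum x * Zpos (Qden y * Qden z)) (Qnum y * Zpos (Qden x * Qden z))
    (Qnum z * Zpos (Qden x * Qden y) * D); intros X Y W hx hy hz.
  apply inject_Z_injective.
  replace (a * X ^ 4 + c * Y ^ 4) with (a * (X * X * X * X) + c * (Y * Y * Y * Y)) by ring.
  rewrite inject_Z_plus, !inject_Z_mult, hx, hy, hz.
  transitivity (z * z * (inject_Z D * inject_Z D * inject_Z D * inject_Z D))%Q; [ring|].
  rewrite e; ring.
Qed.

Lemma pow_not_divide (p x : Z) : 1 < p -> x <> 0 -> exists k : nat, ~ (p ^ Z.of_nat k | x).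
Proof.
intros p1 x0; exists (Z.to_nat (Z.abs x)); intro h.
apply Z.divide_abs_r, Z.divide_pos_le in h; [|lia].
rewrite Z2Nat.id in h by lia.
pose proof (Z.pow_gt_lin_r p (Z.abs x) p1 ltac:(lia)); lia.
Qed.

(** An integral solution is a real one, and as constant sequences it is a p-adic one; a nonzero
    integer is not divisible by all powers of [p]. *)
Lemma soluble_Q_locally (a c : Z) : soluble_Q 0 a c -> locally_soluble 0 a c.
Proof.
intros h; destruct (soluble_Q_integral a c h) as (X & Y & W & nz & e); split.
- exists (IZR X), (IZR Y), (IZR W); split.
  + destruct nz as [n|n]; [left|right]; now apply not_0_IZR.
  + apply (f_equal IZR) in e; rewrite plus_IZR, !mult_IZR in e; rewrite e.
    rewrite !(pow_IZR _ 4) || (change 4 with (Z.of_nat 4); rewrite <- !pow_IZR). ring.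
- intros p pp; assert (p1 : 1 < p) by (destruct pp; assumption).
  exists (fun _ => X), (fun _ => Y), (fun _ => W); repeat split;
    try (intro k; rewrite Z.sub_diag; apply Z.divide_0_r).
  + destruct nz as [n|n]; destruct (pow_not_divide p _ p1 n) as [k hk]; exists k; tauto.
  + intro k; rewrite e; exists 0; ring.
Qed.

Lemma soluble_Q_one (c : Z) : soluble_Q 0 1 c.
Proof.
exists 1%Q, 0%Q, 1%Q; split; [intros [h _]; discriminate h | unfold inject_Z; ring].
Qed.

End Solubility.

(** * Counting locally soluble forms *)
Module Counting.
Import Znumtheory List ClassicalDescription Solubility.
Import all_boot all_order all_algebra.
Import ssrZ zify ring lra reals sequences exp Rstruct.
Import Analytic.
Import Order.TTheory GRing.Theory Num.Theory.
Set Implicit Arguments. Unset Strict Implicit. Unset Printing Implicit Defensive.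
Local Open Scope nat_scope.

Lemma Zdivide_nat (m n : nat) : Z.divide (Z.of_nat m) (Z.of_nat n) <-> (m %| n).
Proof.
split=> [[q e]|/dvdnP[k ->]]; last by exists (Z.of_nat k); lia.
case: (posnP m) => [m0|m0].
  by rewrite m0 in e *; have -> : n = 0 by lia.
have q0 : Z.le 0 q by nia.
by apply/dvdnP; exists (Z.to_nat q); nia.
Qed.

Lemma Zprime_nat p : prime p -> Znumtheory.prime (Z.of_nat p).
Proof.
move=> pp; apply/prime_alt; split; first by have := prime_gt1 pp; lia.
move=> m [m1 mp] d; have : Z.to_nat m %| p by apply/Zdivide_nat; rewrite Z2Nat.id //; lia.
by move/primeP: pp => [_ h] /h /orP[] /eqP; lia.
Qed.

Lemma squarefree_natP n : 0 < n -> squarefree_nat n <-> sqf n.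
Proof.
move=> n0; split=> [h|h p pp d].
  apply/sqfP => // p pp; apply/negP => d; apply: (h _ (Zprime_nat pp)).
  by rewrite -Nat2Z.inj_mul; apply/Zdivide_nat; rewrite multE mulnn.
have p1 : Z.lt 1 p by case: pp.
set q := Z.to_nat p; have qE : p = Z.of_nat q by rewrite /q Z2Nat.id; lia.
have q1 : 1 < q by lia.
have : q ^ 2 %| n by apply/Zdivide_nat; move: d; rewrite qE -mulnn -Nat2Z.inj_mul.
by move=> d'; have := sqfP n0 h _ (pdiv_prime q1); rewrite (dvdn_trans _ d') // dvdn_exp2r // pdiv_dvd.
Qed.

Lemma int_of_Z_nat n : int_of_Z (Z.of_nat n) = Posz n. Proof. by lia. Qed.

(** * Integer congruences as Legendre symbols *)

Section Residue.
Variable p : nat.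
Hypotheses (pp : prime p) (op : odd p).

Definition zres (z : Z) : 'F_p := ((int_of_Z z)%:~R)%R.

Lemma zresM x y : zres (Z.mul x y) = (zres x * zres y)%R.
Proof. by rewrite /zres -[Z.mul x y]/(x * y)%R !rmorphM. Qed.
Lemma zresD x y : zres (Z.add x y) = (zres x + zres y)%R.
Proof. by rewrite /zres -[Z.add x y]/(x + y)%R !rmorphD. Qed.
Lemma zresB x y : zres (Z.sub x y) = (zres x - zres y)%R.
Proof. by rewrite /zres -[Z.sub x y]/(x - y)%R !rmorphB. Qed.
Lemma zres_nat n : zres (Z.of_nat n) = n%:R%R.
Proof. by rewrite /zres int_of_Z_nat. Qed.

Lemma zres_eq0 z : zres z = 0%R <-> Z.divide (Z.of_nat p) z.
Proof.
split=> [/eqP|[q ->]]; last by rewrite zresM zres_nat (pchar_Fp_0 pp) mulr0.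
rewrite /zres -(dvdz_pcharf (pchar_Fp pp)) => /dvdzP[q e].
exists (Z_of_int q); rewrite -[z]int_of_ZK e rmorphM /=; congr (Z.mul _ _); lia.
Qed.

Lemma zres_neq0 z : ~ Z.divide (Z.of_nat p) z -> zres z != 0%R.
Proof. by move=> h; apply/eqP => /zres_eq0. Qed.

Lemma legF_ratio (x u v : 'F_p) : (x != 0 -> v != 0 -> x * (v * v) = u * u -> legF x = 1)%R.
Proof.
move=> x0 v0 e; have -> : x = ((u / v) ^+ 2)%R.
  by rewrite expr2 mulrACA -invfM -e mulfK // mulf_neq0.
apply: legF_square => //; apply: contra x0 => /eqP uv.
have u0 : u = 0%R by rewrite -[u](divfK v0) uv mul0r.
by move/eqP: e; rewrite u0 mul0r mulf_eq0 (negPf (mulf_neq0 v0 v0)) orbF.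
Qed.

Lemma leg_local_coprime a U V : ~ Z.divide (Z.of_nat p) (Z.of_nat a) -> ~ Z.divide (Z.of_nat p) V ->
  Z.divide (Z.of_nat p) (Z.sub (Z.mul (Z.of_nat a) (Z.mul V V)) (Z.mul U U)) -> leg p a = 1%R.
Proof.
move=> na nV /zres_eq0; rewrite zresB !zresM => /eqP; rewrite subr_eq0 => /eqP e.
by rewrite /leg -zres_nat; apply: legF_ratio e; exact: zres_neq0.
Qed.

Lemma legFN1_mod4 : legF (-1 : 'F_p)%R = 1%R -> p %% 4 = 1.
Proof.
move=> h; have := legFE pp op (-1)%R; rewrite h mulr1z -signr_odd.
have n2 : (1 != -1 :> 'F_p)%R.
  by rewrite -subr_eq0 opprK; exact: (two_neq0 pp op (pchar_Fp pp)).
case o : (odd p.-1./2); first by rewrite expr1 => /eqP; rewrite (negPf n2).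
by move: o op (prime_gt1 pp); lia.
Qed.

(* [x ^ 2 + (2 m y) ^ 2 = 0] gives [i ^ 2 = -1], and [2 i = (1 + i) ^ 2]. *)
Lemma leg_local_divides (a m X Y : Z) :
  ~ Z.divide (Z.of_nat p) a -> ~ Z.divide (Z.of_nat p) (Z.mul (Zpos 2) m) ->
  ~ Z.divide (Z.of_nat p) X -> ~ Z.divide (Z.of_nat p) Y ->
  Z.divide (Z.of_nat p) (Z.add (Z.mul (Z.mul a (Z.mul X X)) (Z.mul a (Z.mul X X)))
    (Z.mul (Z.mul (Z.mul (Zpos 2) m) (Z.mul Y Y)) (Z.mul (Z.mul (Zpos 2) m) (Z.mul Y Y)))) ->
  p %% 4 = 1 /\ legF (zres a * zres m)%R = 1%R.
Proof.
move=> /zres_neq0 a0 /zres_neq0 m0 /zres_neq0 X0 /zres_neq0 Y0 /zres_eq0.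
have z2 : zres (Zpos 2) = 2%:R%R by rewrite -[Zpos 2]/(Z.of_nat 2) zres_nat.
rewrite zresD !zresM z2; move: m0; rewrite zresM z2 mulf_eq0 negb_or => /andP[t0 m0].
move: (zres a) (zres m) (zres X) (zres Y) a0 m0 X0 Y0 => {}a {}m x y a0 m0 x0 y0 e.
have v0 : (2%:R * m * (y * y) != 0)%R by rewrite !mulf_neq0.
pose i := (a * (x * x) / (2%:R * m * (y * y)))%R.
have i2 : (i * i = -1)%R.
  rewrite /i mulrACA -invfM; move/eqP: e; rewrite addr_eq0 => /eqP ->.
  by rewrite mulNr mulfV // mulf_neq0.
have lN : legF (-1 : 'F_p)%R = 1%R.
  have n10 : (-1 != 0 :> 'F_p)%R by rewrite oppr_eq0 oner_neq0.
  by apply: (@legF_ratio _ i 1%R) => //; rewrite ?oner_neq0 // mulr1 mulr1 i2.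
split; first exact: legFN1_mod4.
apply: (@legF_ratio _ (m * (1 + i) * y)%R x) => //; first by rewrite mulf_neq0.
have ax : (a * (x * x) = i * (2%:R * m * (y * y)))%R by rewrite /i divfK.
have -> : (a * m * (x * x) = m * (a * (x * x)))%R by ring.
rewrite ax; transitivity (m * m * (y * y) * (1 + i * i + 2%:R * i))%R; last by ring.
by rewrite i2 subrr add0r; ring.
Qed.

End Residue.

(** * From local solubility to the conditions on d and e *)

Lemma sqf_split2 n : sqf n -> exists (s : bool) m, [/\ n = 2 ^ s * m, odd m & sqf m].
Proof.
move=> sn; have n0 := sqf_gt0 sn; case: (boolP (odd n)) => on.
  by exists false, n; rewrite mul1n.
have d2 : 2 %| n by rewrite dvdn2.
have e : n = 2 ^ true * (n %/ 2) by rewrite expn1 mulnC divnK.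
exists true, (n %/ 2); split=> //; last by apply: sqf_dvd sn; rewrite {2}e dvdn_mull.
apply/negPn/negP => h; have := sqfP n0 sn 2 isT; rewrite {1}e -mulnn expn1.
by rewrite dvdn_mul // dvdn2.
Qed.

Lemma leg_two_sqr p k a b : prime p -> odd p -> (leg p (2 ^ (k * 2) * (b ^ 2) * a) = 1 -> leg p a = 1)%R.
Proof.
move=> pp op; have -> : 2 ^ (k * 2) * b ^ 2 = (2 ^ k * b) * (2 ^ k * b).
  by rewrite mulnACA -!mulnn expnM -mulnn.
rewrite !(legM _ _ pp op); case: (leg_cases p (2 ^ k * b)) => [z|z|z]; move: z; rewrite (legM _ _ pp op) => ->;
 by rewrite ?mul0r ?mul1r ?mulrNN ?mul1r.
Qed.

Lemma Z_of_nat_quotient (x : Z) (k p A : nat) : 0 < p -> k * p = A ->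
  Z.of_nat A = Z.mul x (Z.of_nat p) -> x = Z.of_nat k.
Proof.
move=> p0 <- h; apply: (Z.mul_reg_r _ _ (Z.of_nat p)); first by lia.
by rewrite -h Nat2Z.inj_mul.
Qed.

(** The odd part [d] of [a] divides [n], as [a] is squarefree and divides [4 * n ^ 2]. At a prime of
    [d] the local condition concerns [(a / p) * (n / p)], a square times [2 ^ (s (+) v) * e]; at a
    prime of [e] it concerns [a] itself. *)
Lemma local_good n (a c : Z) : sqf n ->
  Z.mul a c = Z.mul (Zpos 4) (Z.pow (Z.of_nat n) (Zpos 2)) -> ord_le1 a ->
  locally_soluble Z0 a c -> a <> Zpos 1 ->
  exists (s v : bool) d e, [/\ a = Z.of_nat (2 ^ s * d), n = 2 ^ v * (d * e),
     good s (s (+) v) d e & s || (d != 1)].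
Proof.
move=> sn ac [a0 sa] [solR solp] a1; have n0 := sqf_gt0 sn.
have apos : Z.lt 0 a by apply: soluble_R_pos solR; nia.
have [A aE] : exists A, a = Z.of_nat A by exists (Z.to_nat a); rewrite Z2Nat.id //; lia.
have A0 : 0 < A by lia.
have sA : sqf A by apply/squarefree_natP => // p pp; have := sa p pp; rewrite aE.
have sqn := proj2 (squarefree_natP n0) sn.
have An : A %| 4 * (n * n).
  by apply/Zdivide_nat; exists c; rewrite -aE; lia.
have [s [d [dE od sd]]] := sqf_split2 sA; have [v [n' [nE on sn']]] := sqf_split2 sn.
have n2 p : prime p -> odd p -> ~~ (p %| 2).
  by move=> pp op; rewrite dvdn_prime2 //; apply: contraL op => /eqP ->.
have dn : d %| n'.
  rewrite (sqf_prod sd); apply: dvdn_prod_primes; first exact: primes_uniq.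
    by apply/allP => p; rewrite mem_primes => /andP[].
  apply/allP => p pd; have [pp op] := odd_primes od pd.
  have pA : p %| A by rewrite dE dvdn_mull //; move: pd; rewrite mem_primes => /and3P[].
  have := dvdn_trans pA An; rewrite Euclid_dvdM // -[4]/(2 * 2) Euclid_dvdM // (negPf (n2 p pp op)) /=.
  rewrite Euclid_dvdM // orbb nE Euclid_dvdM // => /orP[|//].
  by case: (v); rewrite ?expn1 ?expn0 ?(negPf (n2 p pp op)) // dvdn1 => /eqP e; rewrite e in pp.
set e := n' %/ d; have n'E : n' = d * e by rewrite mulnC divnK.
have cde : coprime d e by apply: sqfM_coprime; rewrite -n'E.
have se : sqf e by apply: sqf_dvd sn'; rewrite n'E dvdn_mull.
have oe : odd e by apply: dvdn_odd on; rewrite n'E dvdn_mull.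
have pn p : p %| n' -> p %| n by move=> h; rewrite nE dvdn_mull.
have nsq p : prime p -> ~ Z.divide (Z.mul (Z.of_nat p) (Z.of_nat p)) (Z.of_nat n).
  by move=> pp; apply: sqn; exact: Zprime_nat.
have nZ2 p : prime p -> odd p -> ~ Z.divide (Z.of_nat p) (Zpos 2).
  by move=> pp op; rewrite -[Zpos 2]/(Z.of_nat 2) => /Zdivide_nat; apply/negP; exact: n2.
exists s, v, d, e; split.
- by rewrite aE dE.
- by rewrite -n'E.
- have Hd p : p \in primes d -> p %% 4 = 1 /\ leg p (2 ^ (s (+) v) * e) = 1%R.
    move=> pd; have [pp op] := odd_primes od pd.
    have pd' : p %| d by move: pd; rewrite mem_primes => /and3P[].
    have pnn : p %| n by apply: pn; exact: dvdn_trans dn.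
    have pA : p %| A by rewrite dE dvdn_mull.
    have [|||a' [m [X [Y [ea [en [na' [n2m [nX [nY h]]]]]]]]]] :=
      local_square_divides _ _ _ _ (Zprime_nat pp) (nZ2 p pp op) ac _ (nsq p pp) _ _ (solp _ (Zprime_nat pp)).
    - by apply/Zdivide_nat.
    - by rewrite aE; apply/Zdivide_nat.
    - by apply: sa; exact: Zprime_nat.
    have [p4 hl] := leg_local_divides pp op na' n2m nX nY h; split=> //.
    have p0 := prime_gt0 pp.
    have ea' : a' = Z.of_nat (2 ^ s * (d %/ p)).
      by apply: (Z_of_nat_quotient p0 _ (etrans (esym aE) ea)); rewrite -mulnA divnK.
    have em : m = Z.of_nat (2 ^ v * ((d %/ p) * e)).
      by apply: (Z_of_nat_quotient p0 _ en); rewrite -mulnA mulnAC divnK // nE n'E.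
    move: hl; rewrite -zresM ea' em -Nat2Z.inj_mul zres_nat => hl.
    change (leg p ((2 ^ s * (d %/ p)) * (2 ^ v * ((d %/ p) * e))) = 1%R) in hl.
    (* The factors 2 of [a] and [n] combine into a square exactly when both are present, hence
       [k = s && v]. *)
    have [k ek] : exists k : nat, 2 ^ s * (d %/ p) * (2 ^ v * (d %/ p * e)) = 2 ^ (k * 2) * (d %/ p) ^ 2 * (2 ^ (s (+) v) * e).
      by exists (s && v : nat); case: (s); case: (v); rewrite /= ?expn1 ?expn0 -?mulnn ?mul1n ?mul0n ?expn0; ring.
    by rewrite ek in hl; exact: leg_two_sqr hl.
  rewrite /good /one4 /oddsq sd oe se /=; apply/and3P; split.
  + by apply/allP => p /Hd[-> _].
  + by apply/allP => p /Hd[_ ->].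
  apply/allP => p pe; have [pp op] := odd_primes oe pe.
  have pe' : p %| e by move: pe; rewrite mem_primes => /and3P[].
  have pnn : p %| n by apply: pn; rewrite n'E dvdn_mull.
  have npA : ~~ (p %| A).
    rewrite dE Euclid_dvdM // negb_or; apply/andP; split.
      by case: (s); rewrite ?expn1 ?expn0 ?n2 // dvdn1; apply/eqP => e1; rewrite e1 in pp.
    by apply/negP => pd; have := coprime_dvdl pd (coprime_dvdr pe' cde); rewrite /coprime gcdnn => /eqP e1; rewrite e1 in pp.
  have npa : ~ Z.divide (Z.of_nat p) a by rewrite aE => /Zdivide_nat; apply/negP.
  have [|U [V [nV h]]] := local_square_coprime _ _ _ _ (Zprime_nat pp) (nZ2 p pp op) ac _ (nsq p pp) npa (solp _ (Zprime_nat pp)).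
    by apply/Zdivide_nat.
  apply/eqP; rewrite -dE; rewrite aE in h npa; exact: leg_local_coprime h.
case: (s) dE => //= dE; apply/eqP => d1; apply: a1; rewrite aE dE d1.
by [].
Qed.

(** The same match as in the filters of [ccount] and [sum_sqfree_lt], so that these are convertible
    to filters by [decb]. *)
Definition decb (P : Prop) : bool :=
  match excluded_middle_informative P with left _ => true | right _ => false end.

Lemma decbP P : reflect P (decb P).
Proof. by rewrite /decb; case: excluded_middle_informative => h; constructor. Qed.

Lemma list_seqE m k : List.seq m k = iota m k.
Proof. by elim: k m => //= k IH m; rewrite IH. Qed.

Lemma list_mapE (A B : Type) (f : A -> B) l : List.map f l = [seq f x | x <- l].
Proof. by elim: l => //= x l ->. Qed.

Lemma list_filterE (A : Type) (f : A -> bool) l : List.filter f l = [seq x <- l | f x].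
Proof. by elim: l => //= x l ->. Qed.

Lemma list_lengthE (A : Type) (l : seq A) : List.length l = size l.
Proof. by elim: l => //= x l ->. Qed.

Lemma ccountE (A : Type) (P : A -> Prop) l : ccount P l = \sum_(x <- l) decb (P x).
Proof.
rewrite /ccount list_filterE list_lengthE; elim: l => [|x l IH]; first by rewrite big_nil.
by rewrite big_cons -IH /decb /=; case: excluded_middle_informative.
Qed.

Lemma leq_sum_seq (I : eqType) (s : seq I) (F G : I -> nat) :
  {in s, forall i, F i <= G i} -> \sum_(i <- s) F i <= \sum_(i <- s) G i.
Proof. by move=> h; rewrite big_seq [leqRHS]big_seq; apply: leq_sum. Qed.

Lemma sum_eq_le1 (I : eqType) (s : seq I) (k : I) : uniq s -> \sum_(i <- s) (i == k) <= 1.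
Proof.
move=> us; have -> : \sum_(i <- s) (i == k) = count_mem k s.
  by rewrite -sum1_count [RHS]big_mkcond; apply: eq_bigr => i _ /=; case: (i == k).
by rewrite count_uniq_mem // leq_b1.
Qed.

Lemma cand_uniq M : uniq (cand M).
Proof.
rewrite /cand list_mapE list_seqE map_inj_uniq ?iota_uniq // => x y /=; lia.
Qed.

(** * Upper bound for the number of locally soluble forms *)

Definition pattern (n : nat) (s v : bool) d e :=
  [&& n == 2 ^ v * (d * e), s || (d != 1) & good s (s (+) v) d e].

Section Count.
Variable n : nat.
Hypothesis sn : sqf n.
Local Notation M := (Z.mul (Zpos 4) (Z.pow (Z.of_nat n) (Zpos 2))).

Lemma countF_sol_ge1 : 1 <= countF_sol Z0 M.
Proof.
have n0 := sqf_gt0 sn; rewrite /countF_sol /countF ccountE.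
have c1 : Zpos 1 \in cand M.
  rewrite /cand list_mapE list_seqE; apply/mapP; exists (Z.to_nat (Z.add 1 (Z.abs M))); last by lia.
  by rewrite mem_iota; nia.
rewrite (big_rem _ c1) /=; set b := decb _; have -> : b = true; last by [].
apply/decbP; exists M; split; last exact: soluble_Q_one.
split; first by rewrite Z.mul_1_l.
by split=> // p [p1 _] d; have := Z.divide_pos_le _ _ Z.lt_0_1 d; nia.
Qed.

Lemma countF_sol_le_ls : countF_sol Z0 M <= countF_ls Z0 M.
Proof.
rewrite /countF_sol /countF_ls /countF !ccountE; apply: leq_sum => a _.
case: decbP => // -[c [h1 h2]]; case: decbP => // -[].
by exists c; split=> //; exact: soluble_Q_locally.
Qed.

(** A form with [a <> 1] has [a = 2 ^ s * d] for some pattern of [n]; as [cand] has no repetitions,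
    each pattern accounts for at most one [a]. *)
Lemma countF_ls_le : countF_ls Z0 M <=
  1 + \sum_(s : bool) \sum_(v : bool) \sum_(1 <= d < n.+1) \sum_(1 <= e < n.+1) pattern n s v d e.
Proof.
have n0 := sqf_gt0 sn; rewrite /countF_ls /countF ccountE.
apply: (@leq_trans (\sum_(a <- cand M) ((a == Zpos 1) + \sum_(s : bool) \sum_(v : bool)
   \sum_(1 <= d < n.+1) \sum_(1 <= e < n.+1) (a == Z.of_nat (2 ^ s * d)) * pattern n s v d e))).
  apply: leq_sum => a _; case: decbP => // -[c [[ac oa] ls]].
  case: eqP => [_|a1] //=.
  have [s [v [d [e [ea en g sd]]]]] := local_good sn ac oa ls a1.
  have de0 : 0 < d * e by move: n0; rewrite en muln_gt0 => /andP[].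
  have den : d * e <= n by rewrite en leq_pmull // expn_gt0.
  move: (de0); rewrite muln_gt0 => /andP[d0 e0].
  rewrite add0n (bigD1 s) //= (bigD1 v) //= -!addnA; apply: leq_trans (leq_addr _ _).
  have dn : d \in index_iota 1 n.+1 by rewrite mem_index_iota d0 ltnS (leq_trans _ den) // leq_pmulr.
  have enn : e \in index_iota 1 n.+1 by rewrite mem_index_iota e0 ltnS (leq_trans _ den) // leq_pmull.
  rewrite (big_rem _ dn) /=; apply: leq_trans (leq_addr _ _).
  rewrite (big_rem _ enn) /=; apply: leq_trans (leq_addr _ _).
  by rewrite ea eqxx /pattern -en eqxx g sd.
rewrite big_split /=; apply: leq_add; first exact: sum_eq_le1 (cand_uniq M).
rewrite exchange_big; apply: leq_sum => s _; rewrite exchange_big; apply: leq_sum => v _.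
rewrite exchange_big; apply: leq_sum => d _; rewrite exchange_big; apply: leq_sum => e _.
rewrite -big_distrl /= -[leqRHS]mul1n leq_mul2r; apply/orP; right.
exact: sum_eq_le1 (cand_uniq M).
Qed.

End Count.

(** Covers all [n <= K] at once: [n] is determined by [v], [d] and [e], and it is at least
    [d * e]. *)
Definition excess K := \sum_(s : bool) \sum_(v : bool) \sum_(1 <= d < K.+1) \sum_(1 <= e < K.+1)
  [&& s || (d != 1), d * e <= K & good s (s (+) v) d e].

Lemma sum_pattern_le K (l : seq nat) : uniq l -> {in l, forall n, n <= K} ->
  \sum_(n <- l) \sum_(s : bool) \sum_(v : bool) \sum_(1 <= d < n.+1) \sum_(1 <= e < n.+1) pattern n s v d e
   <= excess K.
Proof.
move=> ul lK.
apply: (@leq_trans (\sum_(n <- l) \sum_(s : bool) \sum_(v : bool) \sum_(1 <= d < K.+1)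
   \sum_(1 <= e < K.+1) pattern n s v d e)).
  apply: leq_sum_seq => n nl; have nK := lK n nl.
  apply: leq_sum => s _; apply: leq_sum => v _.
  rewrite [leqRHS](big_cat_nat (n := n.+1)) //=; apply: leq_trans (leq_addr _ _).
  apply: leq_sum => d _; rewrite [leqRHS](big_cat_nat (n := n.+1)) //=; exact: leq_addr.
rewrite exchange_big; apply: leq_sum => s _; rewrite exchange_big; apply: leq_sum => v _.
rewrite exchange_big; apply: leq_sum => d _; rewrite exchange_big; apply: leq_sum => e _.
rewrite /pattern; case: (s || _); last by rewrite big1 // => n _; rewrite andbF.
case: (good _ _ _ _); last by rewrite big1 // => n _; rewrite !andbF.
rewrite andbT /=; under eq_bigr do rewrite andbT.
case: (leqP (d * e) K) => h; first exact: sum_eq_le1.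
rewrite big_seq big1 // => n /lK nK; case: eqP => // en.
by move: h; rewrite ltnNge (leq_trans _ nK) // en leq_pmull // expn_gt0.
Qed.

Lemma excess_total (R : realType) K :
  ((excess K)%:R = \sum_(s : bool) \sum_(v : bool) total R s (s (+) v) K)%R.
Proof.
rewrite /excess /total natr_sum; apply: eq_bigr => s _; rewrite natr_sum; apply: eq_bigr => v _.
by rewrite natr_sum; apply: eq_bigr => d _; rewrite natr_sum.
Qed.

(** * Positive density of squarefree numbers *)

Lemma sum_inv_sqr_tail (R : realType) x :
  (\sum_(2 <= b < x.+3) (b%:R ^- 2) <= 3 / 4 - x.+2%:R^-1 :> R)%R.
Proof.
(* The telescoping bound starts with equality: the term [b = 2] is [1/4 = 3/4 - 1/2]. *)
elim: x => [|x IH]; first by rewrite big_nat1; lra.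
rewrite big_nat_recr //=; apply: le_trans (lerD IH (lexx _)) _.
have a0 : (0 < x.+2%:R :> R)%R by rewrite ltr0n.
have b0 : (0 < x.+3%:R :> R)%R by rewrite ltr0n.
have e : (x.+3%:R = x.+2%:R + 1 :> R)%R by rewrite -[x.+3]addn1 natrD.
have : (x.+2%:R^-1 - x.+3%:R^-1 = x.+2%:R^-1 * x.+3%:R^-1 :> R)%R.
  by rewrite e; field; rewrite -?e; lra.
have : (x.+3%:R ^- 2 <= x.+2%:R^-1 * x.+3%:R^-1 :> R)%R.
  by rewrite -exprVn expr2 ler_wpM2r ?invr_ge0 // lef_pV2 ?posrE // e lerDl.
by set C := (_ ^- 2)%R; set A := (x.+2%:R^-1)%R; set B := (x.+3%:R^-1)%R; lra.
Qed.

(** An integer that is not squarefree is a multiple of some [b ^ 2] with [b >= 2]. The densities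
    [b ^- 2] sum to at most 3/4, so a quarter is left. *)
Lemma count_sqf (R : realType) x : x <= 4 * \sum_(1 <= n < x.+1) sqf n.
Proof.
case: (posnP x) => [->//|x0].
have h : x <= \sum_(1 <= n < x.+1) sqf n + \sum_(2 <= b < x.+3) x %/ b ^ 2.
  apply: (@leq_trans (\sum_(1 <= n < x.+1) sqf n + \sum_(1 <= n < x.+1) \sum_(2 <= b < x.+3) (b ^ 2 %| n))).
    have sx : \sum_(1 <= n < x.+1) 1 = x by rewrite sum_nat_const_nat subn1 muln1.
    rewrite -big_split /= -[leqLHS]sx.
    rewrite big_nat [leqRHS]big_nat; apply: leq_sum => n /andP[n0 nx].
    case: (boolP (sqf n)) => [//|ns]; rewrite add0n.
    have [b [b2 bn]] : exists b, 1 < b /\ b ^ 2 %| n.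
      move: ns; rewrite /sqf n0 /= => /allPn[p pn l1]; exists p.
      have pp : prime p by move: pn; rewrite mem_primes => /andP[].
      split; first exact: prime_gt1.
      by rewrite pfactor_dvdn //; move: pn; rewrite -logn_gt0; case: (logn p n) l1 => [|[]].
    have bx : b \in index_iota 2 x.+3.
      rewrite mem_index_iota b2 /=; have := dvdn_leq n0 bn; rewrite -mulnn; nia.
    by rewrite (big_rem _ bx) /= bn.
  rewrite leq_add2l exchange_big /= big_nat [leqRHS]big_nat; apply: leq_sum => b /andP[b2 _].
  have b0 : 0 < b ^ 2 by rewrite expn_gt0 (ltnW b2).
  rewrite -(ler_nat R) natr_sum; have := @sum_multiples R (fun=> 1%R) (b ^ 2) x b0.
  rewrite sumr_const_nat subn1 /= => <-; rewrite [leRHS]big_mkcond /= le_eqVlt; apply/orP; left; apply/eqP.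
  by apply: eq_bigr => n _; case: (_ %| _).
move: h; set S := \sum_(1 <= n < x.+1) _; set T := \sum_(2 <= b < x.+3) _ => h.
have hT : (T%:R <= 3 / 4 * x%:R :> R)%R.
  apply: (@le_trans _ _ (\sum_(2 <= b < x.+3) x%:R * b%:R ^- 2)%R).
    by rewrite natr_sum; apply: ler_sum => b _; rewrite -natrX natr_div_le.
  rewrite -mulr_sumr mulrC ler_wpM2r //; apply: le_trans (sum_inv_sqr_tail R x) _.
  by rewrite gerBl invr_ge0.
rewrite -(ler_nat R) natrM; move: h; rewrite -(ler_nat R) natrD.
by move: hT; set a := (x%:R)%R; set b := (T%:R)%R; set c := (S%:R)%R; lra.
Qed.

(** * Sums over squarefree n below X *)

Definition sqf_below (X : R) : seq nat := [seq n <- iota 1 (Z.to_nat (up X)) |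
  decb (squarefree_nat n /\ Rlt (INR n) X)].

Lemma sum_sqfree_ltE (g : nat -> nat) X :
  sum_sqfree_lt (fun n => INR (g n)) X = INR (\sum_(n <- sqf_below X) g n).
Proof.
rewrite /sum_sqfree_lt (_ : List.filter _ _ = sqf_below X); last first.
  by rewrite list_filterE list_seqE.
elim: (sqf_below X) => [|n l IH]; first by rewrite big_nil.
by rewrite big_cons /= IH -plus_INR.
Qed.

Lemma sqf_belowP X n : n \in sqf_below X -> sqf n /\ n <= Z.to_nat (up X).
Proof.
rewrite mem_filter mem_iota => /andP[/decbP[h _] /andP[n1 n2]].
by split; [apply/squarefree_natP | exact: n2].
Qed.

(** [up X] exceeds [X] by at most 1, so [K = up X - 2] lies strictly below [X], and every squarefree
    [n <= K] passes the strict cutoff. *)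
Lemma size_sqf_below X K : Z.to_nat (up X) = K.+2 -> K <= 4 * size (sqf_below X).
Proof.
move=> eK; apply: leq_trans (count_sqf Rdefinitions.R K) _; rewrite leq_mul2l /=.
have -> : \sum_(1 <= n < K.+1) sqf n = size [seq n <- iota 1 K | sqf n].
  by rewrite size_filter -sum1_count [RHS]big_mkcond /index_iota subn1; apply: eq_bigr => n _; case: (sqf n).
apply: uniq_leq_size; first by rewrite filter_uniq ?iota_uniq.
move=> n; rewrite !mem_filter !mem_iota eK => /andP[s /andP[n1 nK]].
rewrite n1 (leq_trans nK) ?andbT; last by lia.
apply/decbP; split; first exact/squarefree_natP.
have [u1 u2] := archimed X.
have eu : IZR (up X) = INR K.+2 by rewrite -eK INR_IZR_INZ Z2Nat.id //; lia.
have : Rle (INR n) (INR K) by apply: le_INR; apply/ssrnat.leP; move: nK; rewrite add1n ltnS.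
move: u2; rewrite eu !S_INR => u2 h; Lra.lra.
Qed.

(** The form with [a = 1] gives the lower bound for each [n], so both sums differ from the number of
    squarefree [n] by at most the excess. *)
Lemma sums_bounds X (cs := fun n => countF_sol Z0 (Z.mul (Zpos 4) (Z.pow (Z.of_nat n) (Zpos 2))))
   (cl := fun n => countF_ls Z0 (Z.mul (Zpos 4) (Z.pow (Z.of_nat n) (Zpos 2)))) :
  [/\ size (sqf_below X) <= \sum_(n <- sqf_below X) cs n,
      \sum_(n <- sqf_below X) cs n <= \sum_(n <- sqf_below X) cl n &
      \sum_(n <- sqf_below X) cl n <= size (sqf_below X) + excess (Z.to_nat (up X))].
Proof.
have sq n : n \in sqf_below X -> sqf n by case/sqf_belowP.
have sz : size (sqf_below X) = \sum_(n <- sqf_below X) 1 by rewrite sum1_size.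
split.
- by rewrite sz; apply: leq_sum_seq => n /sq; exact: countF_sol_ge1.
- by apply: leq_sum_seq => n _; exact: countF_sol_le_ls.
rewrite sz; apply: leq_trans (leq_add (leqnn _) (@sum_pattern_le (Z.to_nat (up X)) (sqf_below X) _ _)).
- by rewrite -big_split /=; apply: leq_sum_seq => n /sq; exact: countF_ls_le.
- by rewrite filter_uniq ?iota_uniq.
- by move=> n /sqf_belowP[].
Qed.

Local Open Scope ring_scope.

Lemma excess_little_o (eps : Rdefinitions.R) : Rlt 0 eps -> exists K0 : nat, forall K : nat, le K0 K ->
  Rle (INR (excess K)) (Rmult eps (INR K)).
Proof.
move=> /RltP eps0; have [K0 hK] := @total_little_o Rdefinitions.R (eps / 4%:R) (divr_gt0 eps0 (ltr0n _ 4)).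
exists K0 => K /ssrnat.leP /hK h; apply/RleP; rewrite !INRE excess_total.
rewrite big_bool !big_bool /=.
move: (h true (true (+) true)%B) (h true (true (+) false)%B) (h false (false (+) true)%B) (h false (false (+) false)%B).
move=> a1 a2 a3 a4; apply: le_trans (lerD (lerD a1 a2) (lerD a3 a4)) _.
rewrite -[eps in _ <= eps * _](divfK (_ : 4%:R != 0 :> Rdefinitions.R)) ?pnatr_eq0 //.
by rewrite le_eqVlt; apply/orP; left; apply/eqP; ring.
Qed.

(** The same bounds in the orders of the standard library, where the final limit argument takes
    place. *)
Lemma sums_bounds_le X : exists N S1 S2 : nat, [/\ le N S1, le S1 S2, le S2 (N + excess (Z.to_nat (up X)))%coq_nat &
    [/\ forall K, Z.to_nat (up X) = K.+2 -> le K (4 * N)%coq_nat,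
      sum_sqfree_lt (fun n => INR (countF_sol Z0 (Z.mul (Zpos 4) (Z.pow (Z.of_nat n) (Zpos 2))))) X = INR S1 &
      sum_sqfree_lt (fun n => INR (countF_ls Z0 (Z.mul (Zpos 4) (Z.pow (Z.of_nat n) (Zpos 2))))) X = INR S2]].
Proof.
have [h1 h2 h3] := sums_bounds X.
exists (size (sqf_below X)), (\sum_(n <- sqf_below X) countF_sol Z0 (Z.mul (Zpos 4) (Z.pow (Z.of_nat n) (Zpos 2))))%N,
  (\sum_(n <- sqf_below X) countF_ls Z0 (Z.mul (Zpos 4) (Z.pow (Z.of_nat n) (Zpos 2))))%N.
split; try exact/ssrnat.leP.
split; rewrite ?sum_sqfree_ltE // => K eK; apply/ssrnat.leP; exact: size_sqf_below.
Qed.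

End Counting.

Theorem theorem4p2 :
  is_lim
    (fun X : R =>
       (sum_sqfree_lt (fun n => INR (countF_sol 0 (4 * (Z.of_nat n) ^ 2))) X /
        sum_sqfree_lt (fun n => INR (countF_ls 0 (4 * (Z.of_nat n) ^ 2))) X)%R)
    p_infty 1%R.
Proof.
apply is_lim_spec; intros eps.
(* [1 - S1 / S2] is at most the excess over [S2], and [S2 >= N >= (U - 2) / 4] exceeds [U / 64] once
   [U > 10]; so an excess of at most [eps / 64 * U] stays below [eps * S2]. *)
destruct (@Counting.excess_little_o (eps / 64)%R) as [K0 hK0].
{ destruct eps as [e he]; simpl; lra. }
exists (INR K0 + 10)%R; intros X hX.
destruct (Counting.sums_bounds_le X) as (N & S1 & S2 & [h1 h2 h3 [hN e1 e2]]).
rewrite e1, e2; clear e1 e2.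
pose proof (pos_INR K0) as pK0.
destruct (archimed X) as [u1 u2].
set (U := Z.to_nat (up X)) in *.
assert (up0 : (0 <= up X)%Z) by (apply le_IZR; lra).
assert (eU : INR U = IZR (up X)) by (unfold U; rewrite INR_IZR_INZ, Z2Nat.id; auto).
assert (U10 : (10 < INR U)%R) by lra.
assert (UK0 : (K0 <= U)%nat) by (apply INR_le; lra).
assert (U3 : (3 <= U)%nat) by (apply INR_le; simpl; lra).
destruct U as [|[|K]]; try lia.
specialize (hN K eq_refl); specialize (hK0 _ UK0).
apply le_INR in h1, h2, h3, hN; rewrite plus_INR in h3; rewrite mult_INR in hN; simpl (INR 4) in hN.
rewrite !S_INR in *.
assert (N0 : (0 < INR N)%R) by lra.
assert (S20 : (0 < INR S2)%R) by lra.
replace (INR S1 / INR S2 - 1)%R with (- ((INR S2 - INR S1) / INR S2))%R by (field; lra).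
rewrite Rabs_Ropp, Rabs_pos_eq.
2:{ apply Rmult_le_pos; [lra|]; left; apply Rinv_0_lt_compat; lra. }
apply (Rmult_lt_reg_r (INR S2)); [lra|].
unfold Rdiv; rewrite Rmult_assoc, Rinv_l, Rmult_1_r by lra.
destruct eps as [e he]; simpl pos in *.
nra.
Qed.
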